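(* For $\lambda>0$ let $B(\lambda)$ be the number of bit comparisons used by Quicksort to sort $X_1,\dots,X_N$, where $X_1,X_2,\dots$ are independent and uniformly distributed on $(0,1)$ and $N$ is independent of them and Poisson distributed with mean $\lambda$. Asymptotically as $\lambda\to\infty$, $$\mathbf{E}\,B(\lambda)=\lambda(\ln\lambda)(\lg\lambda)-c_1\,\lambda\ln\lambda+c_2\,\lambda+\pi_\lambda\,\lambda+O(\log\lambda),$$ where, with $\beta:=2\pi/\ln 2$, $$c_1:=\frac{1}{\ln 2}(4-2\gamma-\ln 2),\qquad c_2:=\frac{1}{\ln 2}\left[\frac16(6-\ln 2)^2-(4-\ln 2)\gamma+\frac{\pi^2}{6}+\gamma^2\right],$$ $$\pi_\lambda:=\sum_{k\in\mathbb{Z}:\,k\ne 0}\frac{i}{\pi k(-1-i\beta k)}\,\Gamma(-1-i\beta k)\,\lambda^{i\beta k}.$$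
   Context: Notation: $\ln$ is the natural logarithm, $\lg$ the binary logarithm, $\gamma$ is Euler's constant, $\Gamma$ is the (meromorphically continued) gamma function. Quicksort: to sort an array of $n$ distinct keys, if $n\le 1$ do nothing. If $n\ge 2$, pick a key uniformly at random from the array (independently of everything else), called the pivot; compare each of the other keys to the pivot, thereby partitioning the remaining keys into the subarray of smaller keys and the subarray of larger keys; then recursively apply Quicksort to each of the two subarrays. Bit comparisons: for distinct $x,y\in(0,1)$ let $b(x,y)\in\{1,2,\dots\}$ be the index of the first bit at which the binary expansions of $x$ and $y$ differ (using the terminating expansion for dyadic rationals). A comparison of the keys $x$ and $y$ costs $b(x,y)$ bit comparisons, and the number of bit comparisons required to sort a list of keys is the sum of $b(x,y)$ over all pairs of keys compared by Quicksort. *)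

(* Defs.v *)
From HB Require Import structures.
From mathcomp Require Import all_boot all_order all_algebra finmap.
From mathcomp Require Import all_classical all_reals all_analysis.
From mathcomp Require Import complex.

Set Implicit Arguments.
Unset Strict Implicit.
Unset Printing Implicit Defensive.

Import Order.TTheory GRing.Theory Num.Theory.
Import numFieldNormedType.Exports.

Local Open Scope classical_set_scope.
Local Open Scope ring_scope.
Local Open Scope complex_scope.

(* For x in (0, 1) this is the k-th bit (k >= 1) of x; rounding down selects
   the terminating expansion when x is dyadic. *)
Definition bit (R : realType) (k : nat) (x : R) : bool :=
  odd `|Num.floor (2 ^+ k * x)|%N.

(* The value 0 is only taken when no bit differs, e.g. when x = y. *)
Definition first_diff_bit (R : realType) (x y : R) : nat :=
  if pselect (exists k, (0 < k)%N && (bit k x != bit k y)) is left ex_diff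
  then ex_minn ex_diff else 0%N.

(* The recursive calls of Quicksort form a binary tree whose nodes are
   addressed by words v : seq bool (the root is [::]; appending false, resp.
   true, leads to the call on the smaller, resp. larger, keys). [pivot v n] is
   the position of the pivot chosen by the call at node v when its array has
   n keys. The result lists the pairs (key, pivot) that are compared.
   Each subarray is shorter than its parent, so that fuel [size s] is enough. *)
Fixpoint comparisons_rec (R : realType) (pivot : seq bool -> nat -> nat)
    (fuel : nat) (v : seq bool) (s : seq R) : seq (R * R) :=
  if fuel is m.+1 then
    if (size s <= 1)%N then [::] else
    let i := pivot v (size s) in
    let p := nth 0 s i in
    let others := take i s ++ drop i.+1 s in
    [seq (y, p) | y <- others]
    ++ comparisons_rec pivot m (rcons v false) [seq y <- others | y < p]
    ++ comparisons_rec pivot m (rcons v true) [seq y <- others | p < y]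
  else [::].

Definition comparisons (R : realType) (pivot : seq bool -> nat -> nat)
    (s : seq R) : seq (R * R) :=
  comparisons_rec pivot (size s) [::] s.

Definition bit_comparisons (R : realType) (pivot : seq bool -> nat -> nat)
    (s : seq R) : nat :=
  (\sum_(c <- comparisons pivot s) first_diff_bit c.1 c.2)%N.

Definition mutually_independent (d : measure_display) (T : measurableType d)
    (R : realType) (P : probability T R) (I : choiceType)
    (F : I -> set_system T) : Prop :=
  forall (S : {fset I}) (E : I -> set T), (forall i, i \in S -> F i (E i)) ->
    P (\bigcap_(i in [set` S]) E i) = (\prod_(i <- S) P (E i))%E.

Definition generated_events (d d' : measure_display) (T : measurableType d)
    (T' : measurableType d') (f : T -> T') : set_system T :=
  preimage_set_system setT f measurable.

Definition model_events (d : measure_display) (T : measurableType d)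
    (R : realType) (X : nat -> T -> R) (N : T -> nat)
    (J : seq bool -> nat -> T -> nat)
    (i : unit + nat + seq bool * nat) : set_system T :=
  match i with
  | inl (inl _) => generated_events N
  | inl (inr j) => generated_events (X j)
  | inr (v, n) => generated_events (J v n)
  end.

(* The key X_(j+1) is [X j]; it lies in (0, 1) almost surely. Position
   [J v n] is used by the call at node v if the array there has n keys. *)
Record poisson_quicksort (d : measure_display) (T : measurableType d)
    (R : realType) (P : probability T R) (lambda : R)
    (X : nat -> {RV P >-> R}) (N : {RV P >-> nat})
    (J : seq bool -> nat -> {RV P >-> nat}) : Prop := PoissonQuicksort {
  keys_uniform : forall j (A : set R), measurable A ->
    distribution P (X j) A = uniform_prob (@ltr01 R) A ;
  size_poisson : forall k,
    distribution P N [set k] = (poisson_pmf lambda k)%:E ;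
  pivots_uniform : forall v n i, (i < n)%N ->
    distribution P (J v n) [set i] = (n%:R^-1)%:E ;
  model_independent :
    mutually_independent P
      (model_events (fun j => X j : T -> R) N (fun v n => J v n : T -> nat)) }.

(* B(lambda), as a function on the sample space *)
Definition quicksort_bits (T : Type) (R : realType) (X : nat -> T -> R)
    (N : T -> nat) (J : seq bool -> nat -> T -> nat) (w : T) : nat :=
  bit_comparisons (fun v n => J v n w) (mkseq (fun j => X j w) (N w)).

Definition lg (R : realType) (x : R) : R := ln x / ln 2.

Definition euler_gamma (R : realType) : R :=
  lim ((\sum_(1 <= k < n.+1) k%:R^-1 - ln n%:R : R) @[n --> \oo]).

(* Principal power t^z, for real t > 0 *)
Definition cpow (R : realType) (t : R) (z : R[i]) : R[i] :=
  (t `^ complex.Re z)%:C * (cos (complex.Im z * ln t) +i* sin (complex.Im z * ln t)).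

(* Euler's integral of t^(z-1) e^(-t), for Re z > 0 *)
Definition Gamma_integral (R : realType) (z : R[i]) : R[i] :=
  let f (t : R) := cpow t (z - 1) * (expR (- t))%:C in
  (\int[lebesgue_measure]_(t in `]0, +oo[) complex.Re (f t))
  +i* (\int[lebesgue_measure]_(t in `]0, +oo[) complex.Im (f t)).

(* Continuation by Gamma(z) = Gamma(z + m) / (z (z + 1) ... (z + m - 1)), where
   m is least such that Re (z + m) > 0. The value at a pole is 0. *)
Definition Gamma (R : realType) (z : R[i]) : R[i] :=
  let m := if 0 < complex.Re z then 0%N else (Num.truncn (- complex.Re z)).+1 in
  Gamma_integral (z + m%:R) / \prod_(j < m) (z + j%:R).

(* Unconditional convergence, along the finite subsets of D *)
Definition has_sum (R : realType) (I : choiceType) (D : set I) (a : I -> R[i])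
    (s : R[i]) : Prop :=
  forall e : R, 0 < e -> exists2 F : {fset I}, [set` F] `<=` D &
    forall G : {fset I}, [set` F] `<=` [set` G] -> [set` G] `<=` D ->
      `|\sum_(i <- G) a i - s| < e%:C.

Definition csum (R : realType) (I : choiceType) (D : set I) (a : I -> R[i]) :
    R[i] :=
  xget 0 [set s | has_sum D a s].

Definition beta (R : realType) : R := 2 * pi / ln 2.

Definition c1 (R : realType) : R :=
  (ln 2)^-1 * (4 - 2 * euler_gamma R - ln 2).

Definition c2 (R : realType) : R :=
  (ln 2)^-1 * (6^-1 * (6 - ln 2) ^+ 2 - (4 - ln 2) * euler_gamma R
               + pi ^+ 2 / 6 + euler_gamma R ^+ 2).

Definition pi_term (R : realType) (lambda : R) (k : int) : R[i] :=
  let ibk : R[i] := 'i%C * (beta R * k%:~R)%:C in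
  'i%C / (pi%:C * k%:~R * (-1 - ibk)) * Gamma (-1 - ibk) * cpow lambda ibk.

Definition pi_ (R : realType) (lambda : R) : R[i] :=
  csum [set k : int | k != 0] (pi_term lambda).

Definition main_terms (R : realType) (lambda : R) : R[i] :=
  (lambda * ln lambda * lg lambda)%:C - (c1 R * lambda * ln lambda)%:C
  + (c2 R * lambda)%:C + pi_ lambda * lambda%:C.

(* Main.v *)
Require Import Defs.
From HB Require Import structures.
From mathcomp Require Import all_boot all_order all_algebra finmap.
From mathcomp Require Import all_classical all_reals all_analysis.
From mathcomp Require Import measurable_realfun complex.
From mathcomp Require Import ring lra zify.

Set Implicit Arguments.
Unset Strict Implicit.
Unset Printing Implicit Defensive.

Import Order.TTheory GRing.Theory Num.Theory.
Import numFieldNormedType.Exports.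

Local Open Scope classical_set_scope.
Local Open Scope ring_scope.

(* Two keys of (0, 1) cost one bit comparison for each k such that their first k
   bits agree, i.e. such that they lie in the same dyadic interval of length 2^-k.
   Hence B is the sum, over all dyadic intervals I, of the number of comparisons
   between keys of I. A pivot outside the interval I does not separate the keys of
   I, so these comparisons have the same mean as those of Quicksort run on the keys
   of I alone: 2 (m + 1) H_m - 4 m if there are m of them. As the number of keys of
   I is Poisson with mean lambda |I|, E B is the sum over k of 2^k A(lambda / 2^k),
   with A(l) the Poisson average of 2 (m + 1) H_m - 4 m.
     In turn A(l) is the integral of t exp(-t) w(l / t) over t > 0, where
   w(r) = 2 (r + 1) ln r - 4 (r - 1) for r >= 1 and w(r) = 0 for r < 1. The sum over
   k of 2^k w(r / 2^k) is finite and explicit: r times a quadratic polynomial in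
   lg r plus a function of period 1 in lg r, up to O(ln r). Integrating it against
   t exp(-t) at r = lambda / t produces the moments of ln t under exp(-t), hence
   gamma and pi^2 / 6, while the Fourier series of the periodic function gives
   pi_lambda, the Gamma values being the integrals of exp(-t) t^(i beta k). *)

(** * Derivatives and integrals up to a singular endpoint *)

Section derivatives.
Context {R : realType}.
Implicit Types (f g : R -> R) (x a b : R).

(** The main obstacle is probabilistic: pivots are attached to nodes of the recursion tree, while
    the array found at a node depends on the keys. Conditioning on finite information about the keys
    (their number, their order, which of them lie in I) freezes the arrays and leaves every unread
    pivot uniform; the recursion can then be averaged node by node. The kernel w is the function
    whose moments against (m - t)^j are the Quicksort means: expanding exp(-t) = exp(-m) sum_j (m -
    t)^j / j! turns the Poisson average into an integral. All terms up to the exact formula for E B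
    are nonnegative, so sums and integrals are exchanged in the extended reals, and finiteness is
    read off at the end from the integrability of t V(lambda / t), where V(r) is the sum over k of
    2^k w(r / 2^k). The constants are found by real analysis. The moments of ln t come from Euler's
    limit (1 - t/n)^n, under which they are harmonic sums; pi^2 / 6 and pi_lambda both come from one
    theorem on Fourier series of Lipschitz functions. The error O(log lambda) arises only when V is
    replaced by its main part. *)

Lemma der_eq f x a b : is_derive x (1 : R) f a -> a = b -> is_derive x (1 : R) f b.
Proof. by move=> h <-. Qed.

Lemma der_cst (c x : R) : is_derive x (1 : R) (fun=> c) 0.
Proof. exact: is_derive_cst. Qed.

Lemma der_id x : is_derive x (1 : R) (fun t => t) 1.
Proof. exact: is_derive_id. Qed.

Lemma der_add f g x a b : is_derive x (1 : R) f a -> is_derive x (1 : R) g b ->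
  is_derive x (1 : R) (fun t => f t + g t) (a + b).
Proof. by move=> hf hg; have := is_deriveD hf hg. Qed.

Lemma der_opp f x a : is_derive x (1 : R) f a ->
  is_derive x (1 : R) (fun t => - f t) (- a).
Proof. by move=> hf; have := is_deriveN hf. Qed.

Lemma der_sub f g x a b : is_derive x (1 : R) f a -> is_derive x (1 : R) g b ->
  is_derive x (1 : R) (fun t => f t - g t) (a - b).
Proof. by move=> hf hg; apply: der_add => //; exact: der_opp. Qed.

Lemma der_mul f g x a b : is_derive x (1 : R) f a -> is_derive x (1 : R) g b ->
  is_derive x (1 : R) (fun t => f t * g t) (a * g x + f x * b).
Proof.
move=> hf hg; have := is_deriveM hf hg; rewrite /GRing.scale /=.
by move=> h; apply: (der_eq h); ring.
Qed.

Lemma der_comp f g x a b : is_derive (g x) (1 : R) f a ->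
  is_derive x (1 : R) g b -> is_derive x (1 : R) (fun t => f (g t)) (a * b).
Proof. by move=> hf hg; have := is_derive1_comp hf hg; rewrite mulrC. Qed.

Lemma der_exprn f x a n : is_derive x (1 : R) f a ->
  is_derive x (1 : R) (fun t => f t ^+ n.+1) (n.+1%:R * f x ^+ n * a).
Proof.
move=> hf; elim: n => [|n IH].
  by rewrite expr0 mulr1 mul1r.
have -> : (fun t => f t ^+ n.+2) = (fun t => f t * f t ^+ n.+1).
  by apply/funext => t; rewrite exprS.
apply: (der_eq (der_mul hf IH)).
by rewrite -[in RHS]natr1 !exprS; ring.
Qed.

Lemma der_sum (I : Type) (s : seq I) (F : I -> R -> R) (d : I -> R) x :
  (forall i, is_derive x (1 : R) (F i) (d i)) ->
  is_derive x (1 : R) (fun t => \sum_(i <- s) F i t) (\sum_(i <- s) d i).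
Proof.
move=> h; elim: s => [|i s IH].
  have -> : (fun t => \sum_(i <- [::]) F i t) = (fun=> 0).
    by apply/funext => t; rewrite big_nil.
  by rewrite big_nil; exact: der_cst.
have -> : (fun t => \sum_(j <- i :: s) F j t) =
    (fun t => F i t + \sum_(j <- s) F j t).
  by apply/funext => t; rewrite big_cons.
by rewrite big_cons; exact: der_add.
Qed.

Lemma der_continuous f x a : is_derive x (1 : R) f a -> {for x, continuous f}.
Proof.
move=> h; apply: differentiable_continuous; apply/derivable1_diffP.
by case: h.
Qed.

(* The integrand may be unbounded at the left endpoint. *)
Lemma ge0_FTC2_oc (f F : R -> R) (a b l : R) : a < b ->
  (forall x, a < x <= b -> 0 <= f x) ->
  (forall x, a < x <= b -> {for x, continuous f}) ->
  (forall x, a < x <= b -> is_derive x (1 : R) F (f x)) ->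
  F x @[x --> a^'+] --> l ->
  (\int[lebesgue_measure]_(x in `]a, b]) (f x)%:E = (F b - l)%:E)%E.
Proof.
move=> ab f0 cf dF Fl.
(* The integral over []a, b]] is the monotone limit of those over [[u n, b]]; the shift [n.+2] keeps
   [u n < b] already at n = 0. *)
pose u (n : nat) := a + (b - a) / n.+2%:R.
have ba0 : 0 < b - a by rewrite subr_gt0.
have u_gt n : a < u n by rewrite /u ltrDl divr_gt0.
have u_lt n : u n < b.
  rewrite /u -ltrBrDl ltr_pdivrMr// ltr_pMr// ltr1n//.
have u_dec m n : (m <= n)%N -> u n <= u m.
  move=> mn; rewrite /u lerD2l ler_pM2l// lef_pV2 ?posrE// ler_nat.
  by rewrite !ltnS.
have cwn n : {within `[u n, b], continuous f}.
  apply: continuous_in_subspaceT => x; rewrite inE/= in_itv/= => /andP[ux xb].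
  by apply: cf; rewrite xb (lt_le_trans (u_gt n)).
have FTC n : (\int[lebesgue_measure]_(x in `[u n, b]) (f x)%:E =
    (F b - F (u n))%:E)%E.
  rewrite EFinB; apply: continuous_FTC2 => //.
    have dF' x : u n <= x <= b -> is_derive x (1 : R) F (f x).
      by move=> /andP[ux xb]; apply: dF; rewrite xb (lt_le_trans (u_gt n)).
    split.
    - move=> x; rewrite in_itv/= => /andP[ux xb].
      by have [] := dF' x; rewrite ?(ltW ux) ?(ltW xb).
    - apply: cvg_at_right_filter; apply: der_continuous; apply: dF'.
      by rewrite lexx (ltW (u_lt n)).
    - apply: cvg_at_left_filter; apply: der_continuous; apply: dF'.
      by rewrite lexx (ltW (u_lt n)).
  move=> x; rewrite in_itv/= => /andP[ux xb].
  rewrite derive1E; apply: derive_val.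
  by apply: dF; rewrite (ltW xb) (lt_trans (u_gt n)).
have bigcupE : \bigcup_n `[u n, b]%classic = `]a, b]%classic.
  apply/seteqP; split => [x [n _]|x] /=; rewrite !in_itv/=.
    by move=> /andP[ux ->]; rewrite (lt_le_trans (u_gt n)).
  move=> /andP[ax xb].
  have [n hn] : exists n : nat, (b - a) / (x - a) < n%:R.
    have := archi_boundP (x := (b - a) / (x - a)); rewrite divr_ge0 ?subr_ge0 ?(ltW ab) ?(ltW ax)//.
    by move=> /(_ isT); eexists; eassumption.
  exists n => //=; rewrite in_itv/= xb andbT /u -lerBrDl ler_pdivrMr//.
  rewrite ltr_pdivrMr ?subr_gt0// in hn.
  apply: (le_trans (ltW hn)); rewrite mulrC ler_pM2l ?subr_gt0//.
  by rewrite ler_nat ltnW.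
have C1 : (fun n => \int[lebesgue_measure]_(x in `[u n, b]) (f x)%:E)%E @ \oo -->
   (\int[lebesgue_measure]_(x in `]a, b]) (f x)%:E)%E.
  rewrite -bigcupE; apply: ge0_nondecreasing_set_cvg_integral.
  - move=> m n mn; rewrite subsetEset => x /=; rewrite !in_itv/= => /andP[ux ->].
    by rewrite (le_trans (u_dec _ _ mn) ux).
  - by move=> n; exact: measurable_itv.
  - move=> n; apply/measurable_EFinP.
    by apply: subspace_continuous_measurable_fun => //; exact: measurable_itv.
  - move=> n x /=; rewrite in_itv/= => /andP[ux xb]; rewrite lee_fin f0// xb.
    by rewrite (lt_le_trans (u_gt n)).
have C2 : (fun n => \int[lebesgue_measure]_(x in `[u n, b]) (f x)%:E)%E @ \oo -->
   (F b - l)%:E.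
  rewrite (_ : (fun _ => _) = (EFin \o (fun n => F b - F (u n)))); last first.
    by apply/funext => n /=; rewrite FTC.
  apply: cvg_EFin; first exact: nearW.
  apply: cvgB; first exact: cvg_cst.
  have ua : u @ \oo --> a.
    rewrite /u -[X in _ --> X]addr0; apply: cvgD; first exact: cvg_cst.
    rewrite -(mulr0 (b - a)); apply: cvgM; first exact: cvg_cst.
    by have := @cvg_harmonic R; rewrite -cvg_shiftS.
  move/cvg_at_rightP : Fl; apply; split => //.
by apply: (cvg_unique _ C1 C2).
Qed.

End derivatives.

(** * Logarithmic integrals and harmonic numbers *)

Section log_integrals.
Context {R : realType}.
Implicit Types (u x t : R) (n : nat).

Lemma ge0_FTC2_scaled (f F : R -> R) (m l : R) : 0 < m ->
  (forall x, 0 < x <= 1 -> 0 <= f x) ->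
  (forall x, 0 < x <= 1 -> {for x, continuous f}) ->
  (forall x, 0 < x <= 1 -> is_derive x (1 : R) F (f x)) ->
  F x @[x --> 0^'+] --> l ->
  (\int[lebesgue_measure]_(x in `]0%R, m]) (f (x / m))%:E =
   (m * (F 1 - l))%:E)%E.
Proof.
move=> m0 f0 cf dF Fl.
have xm x : 0 < x <= m -> 0 < x / m <= 1.
  by move=> /andP[x0 xm]; rewrite divr_gt0//= ler_pdivrMr// mul1r.
suff -> : (\int[lebesgue_measure]_(x in `]0%R, m]) (f (x / m))%:E =
    (m * F (m / m) - m * l)%:E)%E by rewrite divff ?gt_eqF// mulrBr.
apply: (@ge0_FTC2_oc _ (fun x => f (x / m)) (fun x => m * F (x / m))) => //.
- by move=> x /xm; exact: f0.
- move=> x /xm /cf c; apply: (@continuous_comp _ _ _ (fun x => x / m) f) => //.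
  exact: (der_continuous (der_mul (der_id x) (der_cst m^-1 x))).
- move=> x /xm /dF h.
  have h1 := der_mul (der_id x) (der_cst m^-1 x).
  apply: (der_eq (der_mul (der_cst m x) (der_comp (g := fun t => t / m) h h1))).
  by rewrite mul0r add0r mulr0 addr0 mul1r mulrCA divff ?mulr1// gt_eqF.
- apply: cvgM; first exact: cvg_cst.
  apply/cvgrPdist_lt => e e0.
  move/cvgrPdist_lt : Fl => /(_ e e0) [/= d d0 hd].
  exists (d * m) => /=; first by rewrite mulr_gt0.
  move=> x; rewrite /ball_ /= sub0r normrN => xd x0.
  apply: hd => /=; last by rewrite divr_gt0.
  rewrite sub0r normrN normrM [X in _ * X]gtr0_norm ?invr_gt0//.
  by rewrite ltr_pdivrMr.
Qed.

Lemma der_ln u : 0 < u -> is_derive u (1 : R) (@ln R) u^-1.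
Proof. exact: is_derive1_ln. Qed.

(** With u = exp(-2y) the left side is 4 y^2 exp(-y) times the square root of u, and y^2 exp(-y) <=
    2 because exp y >= 1 + y^2 / 2. *)
Lemma ln_sq_bound u : 0 < u <= 1 -> u * ln u ^+ 2 <= 8 * u `^ (2^-1).
Proof.
move=> /andP[u0 u1].
have s0 : ln u <= 0 by rewrite ln_le0.
set y := - ln u / 2.
have y0 : 0 <= y by rewrite /y divr_ge0 ?oppr_ge0.
have e2 : 1 + y ^+ 2 / 2 <= expR y by have := expR_ge1Dxn 1 y0.
have pu : u `^ (2^-1) = expR (- y).
  by rewrite /powR gt_eqF// /y; congr expR; lra.
have eu : u = expR (- y) * expR (- y).
  rewrite -expRD -[LHS]lnK ?posrE//; congr expR; rewrite /y; lra.
rewrite pu {1}eu.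
have -> : ln u = - (2 * y) by rewrite /y; lra.
have ey : expR y * expR (- y) = 1 by exact: expRxMexpNx_1.
have e0 := expR_gt0 (- y).
rewrite sqrrN exprMn.
have : y ^+ 2 * expR (- y) <= 2.
  rewrite -(ler_pM2r e0) ey in e2 *; nra.
nra.
Qed.

Lemma ln_abs_le u : `|ln u| <= 1 + ln u ^+ 2.
Proof.
rewrite -real_normK ?num_real//; move: `|ln u| (normr_ge0 (ln u)) => a a0; nra.
Qed.

Lemma ln_abs_bound u : 0 < u <= 1 -> u * `|ln u| <= 9 * u `^ (2^-1).
Proof.
move=> u01; have [u0 u1] := andP u01.
have h1 := ln_sq_bound u01; have h2 := ln_abs_le u.
have h3 : u <= u `^ 2^-1.
  by rewrite -{1}(powRr1 (ltW u0)); apply: ger_powR; [rewrite u0 u1|lra].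
nra.
Qed.

Lemma cvg0_sqrt_bound (f : R -> R) (c : R) :
  (forall u, 0 < u <= 1 -> `|f u| <= c * u `^ 2^-1) -> f u @[u --> 0^'+] --> 0.
Proof.
move=> h.
have c0 : (fun u : R => c * u `^ 2^-1) @ 0^'+ --> 0.
  rewrite -[X in _ --> X](mulr0 c); apply: cvgM; first exact: cvg_cst.
  have h2 : (0 < 2^-1 :> R) by lra. exact: (@powR_cvg0 R _ h2).
apply: norm_cvg0; apply: (squeeze_cvgr _ (cvg_cst 0) c0).
near=> u; rewrite normr_ge0 h//.
apply/andP; split; first by near: u; exact: nbhs_right_gt.
by near: u; exact: nbhs_right_le.
Unshelve. all: by end_near. Qed.

Definition harm n : R := \sum_(i < n) i.+1%:R^-1.
Definition harm2 n : R := \sum_(i < n) (i.+1%:R ^+ 2)^-1.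

Lemma harmS n : harm n.+1 = harm n + n.+1%:R^-1.
Proof. by rewrite /harm big_ord_recr. Qed.

Lemma harm2S n : harm2 n.+1 = harm2 n + (n.+1%:R ^+ 2)^-1.
Proof. by rewrite /harm2 big_ord_recr. Qed.

(** Expanding the square of H_n, the pairs i < j occur twice and the diagonal once; [harm2] supplies
    the second copy of the diagonal. *)
Lemma sum_harm_div n :
  2 * (\sum_(i < n) harm i.+1 / i.+1%:R) = harm n ^+ 2 + harm2 n.
Proof.
elim: n => [|n IH]; first by rewrite /harm /harm2 !big_ord0; ring.
rewrite big_ord_recr/= mulrDr IH harmS harm2S.
by rewrite -exprVn; ring.
Qed.

(** The primitive of (1 - u)^n vanishing at 0. As 0 <= P <= u, its products with ln u and (ln u)^2
    tend to 0 at 0, so integrations by parts against it leave no boundary term there. *)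
Let P n u : R := (1 - (1 - u) ^+ n.+1) / n.+1%:R.

Let der_onem u : is_derive u (1 : R) (fun t => 1 - t) (-1).
Proof. by apply: (der_eq (der_sub (der_cst 1 u) (der_id u))); rewrite sub0r. Qed.

Let der_P n u : is_derive u (1 : R) (P n) ((1 - u) ^+ n).
Proof.
have h := der_sub (der_cst 1 u) (der_exprn n (der_onem u)).
apply: (der_eq (der_mul h (der_cst n.+1%:R^-1 u))).
rewrite mulr0 addr0 sub0r mulrN1 opprK mulrAC divff ?mul1r//.
Qed.

Let P_div n u : u != 0 -> P n u / u = (\sum_(i < n.+1) (1 - u) ^+ i) / n.+1%:R.
Proof.
move=> u0; rewrite /P -opprB subrX1 -mulNr.
rewrite (_ : - (1 - u - 1) = u); last by ring.
by rewrite mulrAC [u * _]mulrC mulfK.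
Qed.

Let P_bound n u : 0 < u <= 1 -> 0 <= P n u <= u.
Proof.
move=> /andP[u0 u1].
rewrite /P divr_ge0 ?subr_ge0 ?exprn_ile1 ?subr_ge0 ?ler0n//=; last lra.
rewrite ler_pdivrMr ?ltr0n//.
suff : 1 - n.+1%:R * u <= (1 - u) ^+ n.+1 by lra.
elim: n => [|n IH]; first by rewrite expr1 mul1r.
rewrite exprS -[n.+2%:R]natr1.
have n0 : 0 <= n.+1%:R :> R by rewrite ler0n.
move: IH n0; move: ((1 - u) ^+ n.+1) (n.+1%:R) => a b IH b0.
have : (1 - u) * (1 - b * u) <= (1 - u) * a by rewrite ler_wpM2l//; lra.
nra.
Qed.

(** The primitive of -(1 - u)^n ln u vanishing at 1, by parts: P(u) / u is a sum of powers of 1 - u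
    divided by n + 1, and integrating it gives the second term, which becomes H_{n+1} / (n + 1) at u
    = 0. *)
Let G n u : R := - (P n u * ln u)
  - (\sum_(i < n.+1) (1 - u) ^+ i.+1 / i.+1%:R) / n.+1%:R.

Let der_G n u : 0 < u -> is_derive u (1 : R) (G n) ((1 - u) ^+ n * - ln u).
Proof.
move=> u0.
have h1 := der_opp (der_mul (der_P n u) (der_ln u0)).
have h2 : is_derive u (1 : R)
    (fun u => \sum_(i < n.+1) (1 - u) ^+ i.+1 / i.+1%:R)
    (\sum_(i < n.+1) - (1 - u) ^+ i).
  apply: der_sum => i.
  apply: (der_eq (der_mul (der_exprn i (der_onem u)) (der_cst i.+1%:R^-1 u))).
  by rewrite mulr0 addr0 mulrN1 mulNr [_ * (1 - u) ^+ i]mulrC mulfK// pnatr_eq0.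
apply: (der_eq (der_sub h1 (der_mul h2 (der_cst n.+1%:R^-1 u)))).
rewrite P_div ?gt_eqF// sumrN; ring.
Qed.

Let P_ln_cvg n k : (0 < k <= 2)%N -> P n u * ln u ^+ k @[u --> 0^'+] --> 0.
Proof.
move=> k2; apply: (@cvg0_sqrt_bound _ 9) => u u01.
have /andP[P0 P1] := P_bound n u01.
rewrite normrM ger0_norm//.
apply: (@le_trans _ _ (u * `|ln u ^+ k|)); first by rewrite ler_wpM2r.
case: k k2 => [|[|[|]]]// _.
  by rewrite expr1 ln_abs_bound.
rewrite ger0_norm ?sqr_ge0// (le_trans (ln_sq_bound u01))//.
by rewrite ler_wpM2r ?powR_ge0//; lra.
Qed.

Let cvg_onemX n : (1 - u) ^+ n @[u --> 0^'+] --> (1 : R).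
Proof.
apply: cvg_at_right_filter; rewrite -[X in _ --> X](expr1n _ n) -{2}(subr0 1).
apply: (@continuous_comp _ _ _ (fun u : R => 1 - u) (fun u => u ^+ n)).
  exact: (der_continuous (der_onem 0)).
exact: exprn_continuous.
Qed.

Let G_cvg n : G n u @[u --> 0^'+] --> - (harm n.+1 / n.+1%:R).
Proof.
rewrite /G -[X in _ --> X]sub0r; apply: cvgB.
  rewrite -[X in _ --> X]oppr0; apply: cvgN.
  by have := @P_ln_cvg n 1 isT.
apply: cvgM; last exact: cvg_cst.
apply: cvg_big => //=; first exact: add_continuous.
move=> i _; rewrite -[X in _ --> X]mul1r; apply: cvgM; last exact: cvg_cst.
exact: cvg_onemX.
Qed.

Let G1 n : G n 1 = 0.
Proof.
rewrite /G ln1 mulr0 oppr0 sub0r big1 ?mul0r ?oppr0// => i _.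
by rewrite subrr expr0n mul0r.
Qed.

Let onem_cont n u : 0 < u <= 1 -> {for u, continuous (fun u => (1 - u) ^+ n)}.
Proof.
move=> _; apply: (@continuous_comp _ _ _ (fun u : R => 1 - u) (fun u => u ^+ n)).
  exact: (der_continuous (der_onem u)).
exact: exprn_continuous.
Qed.

Lemma integral_onem_ln n (m : R) : 0 < m ->
  (\int[lebesgue_measure]_(t in `]0%R, m]) ((1 - t / m) ^+ n * - ln (t / m))%:E =
   (m * (harm n.+1 / n.+1%:R))%:E)%E.
Proof.
move=> m0.
suff -> : (\int[lebesgue_measure]_(t in `]0%R, m])
      ((1 - t / m) ^+ n * - ln (t / m))%:E =
    (m * (G n 1 - - (harm n.+1 / n.+1%:R)))%:E)%E by rewrite G1 sub0r opprK.
apply: (@ge0_FTC2_scaled (fun u => (1 - u) ^+ n * - ln u)) => //.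
- move=> u /andP[u0 u1]; rewrite mulr_ge0 ?exprn_ge0 ?subr_ge0//.
  by rewrite oppr_ge0 ln_le0.
- move=> u u01; apply: continuousM; first exact: onem_cont.
  by apply: continuousN; apply: continuous_ln; case/andP: u01.
- by move=> u /andP[u0 _]; exact: der_G.
Qed.

Lemma integral_onem n (m : R) : 0 < m ->
  (\int[lebesgue_measure]_(t in `]0%R, m]) ((1 - t / m) ^+ n)%:E =
   (m / n.+1%:R)%:E)%E.
Proof.
move=> m0.
suff -> : (\int[lebesgue_measure]_(t in `]0%R, m]) ((1 - t / m) ^+ n)%:E =
    (m * (P n 1 - 0))%:E)%E.
  by rewrite /P subrr expr0n /= !subr0 mul1r.
apply: (@ge0_FTC2_scaled (fun u => (1 - u) ^+ n)) => //.
- by move=> u /andP[u0 u1]; rewrite exprn_ge0 ?subr_ge0.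
- by move=> u u01; exact: onem_cont.
- have : P n u @[u --> 0^'+] --> ((1 - 1) / n.+1%:R : R).
    rewrite /P; apply: cvgM; last exact: cvg_cst.
    by apply: cvgB; [exact: cvg_cst|exact: cvg_onemX].
  by rewrite subrr mul0r.
Qed.

(** The primitive of (1 - u)^n (ln u)^2, by parts once more: the remaining integrand -2 (P / u) ln u
    is 2 / (n + 1) times the sum of the derivatives of the [G i]. *)
Let K n u : R := P n u * ln u ^+ 2 + 2 * (\sum_(i < n.+1) G i u) / n.+1%:R.

Lemma integral_onem_ln2 n (m : R) : 0 < m ->
  (\int[lebesgue_measure]_(t in `]0%R, m]) ((1 - t / m) ^+ n * ln (t / m) ^+ 2)%:E =
   (m * ((harm n.+1 ^+ 2 + harm2 n.+1) / n.+1%:R))%:E)%E.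
Proof.
move=> m0.
have K1 : K n 1 = 0.
  rewrite /K ln1 expr0n mulr0 add0r big1; first by rewrite mulr0 mul0r.
  by move=> i _; exact: G1.
suff -> : (\int[lebesgue_measure]_(t in `]0%R, m])
      ((1 - t / m) ^+ n * ln (t / m) ^+ 2)%:E =
    (m * (K n 1 - - ((harm n.+1 ^+ 2 + harm2 n.+1) / n.+1%:R)))%:E)%E.
  by rewrite K1 sub0r opprK.
apply: (@ge0_FTC2_scaled (fun u => (1 - u) ^+ n * ln u ^+ 2)) => //.
- move=> u /andP[u0 u1]; apply: mulr_ge0; last exact: sqr_ge0.
  by rewrite exprn_ge0 ?subr_ge0.
- move=> u u01; apply: continuousM; first exact: onem_cont.
  apply: (@continuous_comp _ _ _ (@ln R) (fun u => u ^+ 2)).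
    by apply: continuous_ln; case/andP: u01.
  exact: exprn_continuous.
- move=> u /andP[u0 _]; rewrite /K.
  have h1 := der_mul (der_P n u) (der_exprn 1 (der_ln u0)).
  have h2 := der_sum (index_enum _) (fun i : 'I_n.+1 => der_G i u0).
  apply: (der_eq (der_add h1 (der_mul (der_mul (der_cst 2 u) h2)
    (der_cst n.+1%:R^-1 u)))).
  rewrite -mulr_suml !mul0r expr1.
  rewrite (_ : P n u * (2 * ln u / u) = 2 * ln u * (P n u / u)); last by ring.
  rewrite P_div ?gt_eqF//; ring.
- rewrite /K -sum_harm_div -[X in _ --> X]add0r; apply: cvgD.
    exact: P_ln_cvg.
  rewrite -mulNr -mulrN -sumrN; apply: cvgM; last exact: cvg_cst.
  apply: cvgM; first exact: cvg_cst.
  apply: cvg_big => //=; first exact: add_continuous.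
Qed.

End log_integrals.

(** * Integration against exp(-t) *)

Section exponential_weight.
Context {R : realType}.
Implicit Types (t c : R) (f g : R -> R).
Local Notation D := (`]0%R, +oo[%classic : set R).
Local Notation leb := (@lebesgue_measure R).

Definition eint f : R := \int[leb]_(t in D) (expR (- t) * f t).

Definition eintegrable f : Prop :=
  leb.-integrable D (fun t => (expR (- t) * f t)%:E).

Lemma mD : measurable (D : set (g_sigma_algebraType (R.-ocitv.-measurable))).
Proof. exact: measurable_itv. Qed.

Lemma measurable_expRN (E : set R) : measurable_fun E (fun t => expR (- t)).
Proof.
apply: measurable_funTS; apply: continuous_measurable_fun => t.
apply: continuous_comp; first exact: opp_continuous.
exact: continuous_expR.
Qed.

Lemma measurable_eweight f : measurable_fun D f ->
  measurable_fun D (fun t => (expR (- t) * f t)%:E).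
Proof.
move=> mf; apply/measurable_EFinP; apply: measurable_funM => //.
exact: measurable_expRN.
Qed.

Lemma eintegrable_le f g : measurable_fun D f ->
  (forall t, 0 < t -> `|f t| <= g t) -> eintegrable g -> eintegrable f.
Proof.
move=> mf fg ig; apply: (le_integrable mD _ _ ig).
  exact: measurable_eweight.
move=> t /=; rewrite in_itv/= andbT => t0; rewrite lee_fin !normrM ler_wpM2l//.
by rewrite (le_trans (fg t t0))// ler_norm.
Qed.

Lemma eq_eint f g : (forall t, 0 < t -> f t = g t) -> eint f = eint g.
Proof.
move=> fg; apply: eq_Rintegral => t; rewrite inE/= in_itv/= andbT => t0.
by rewrite fg.
Qed.

Lemma eintegrableD f g : eintegrable f -> eintegrable g ->
  eintegrable (fun t => f t + g t).
Proof.
move=> i1 i2; have := integrableD mD i1 i2; apply: eq_integrable => //.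
by move=> t _ /=; rewrite mulrDr.
Qed.

Lemma eintegrableZ c f : eintegrable f -> eintegrable (fun t => c * f t).
Proof.
move=> i1; have := integrableZl mD c i1; apply: eq_integrable => //.
by move=> t _ /=; rewrite mulrCA.
Qed.

Lemma eintD f g : eintegrable f -> eintegrable g ->
  eint (fun t => f t + g t) = eint f + eint g.
Proof.
move=> i1 i2; rewrite /eint -RintegralD //.
by apply: eq_Rintegral => t _; rewrite mulrDr.
Qed.

Lemma eintZ c f : eintegrable f -> eint (fun t => c * f t) = c * eint f.
Proof.
move=> i1; rewrite /eint -RintegralZl //.
by apply: eq_Rintegral => t _; rewrite mulrCA.
Qed.

Lemma le_eint f g : eintegrable f -> eintegrable g ->
  (forall t, 0 < t -> f t <= g t) -> eint f <= eint g.
Proof.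
move=> i1 i2 fg; apply: le_Rintegral => //.
by move=> t /=; rewrite in_itv/= andbT => t0; rewrite ler_wpM2l ?expR_ge0 ?fg.
Qed.

Lemma le_norm_eint f g : eintegrable f -> eintegrable g ->
  (forall t, 0 < t -> `|f t| <= g t) -> `|eint f| <= eint g.
Proof.
move=> i1 i2 fg.
have h : forall t, 0 < t -> - g t <= f t <= g t by move=> t /fg; rewrite ler_norml.
rewrite ler_norml -mulN1r -eintZ//; apply/andP; split; apply: le_eint => //.
- exact: eintegrableZ.
- by move=> t /h /andP[+ _]; rewrite mulN1r.
- by move=> t /h /andP[].
Qed.

Lemma integral_expRN c : 0 < c ->
  (\int[leb]_(t in D) (expR (- (t * c)))%:E = (c^-1)%:E)%E.
Proof.
move=> c0.
have dF (x : R) : is_derive x (1 : R) (fun t => - c^-1 * expR (- (t * c)))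
    (expR (- (x * c))).
  have h := der_opp (der_mul (der_id x) (der_cst c x)).
  have h2 := der_comp (g := fun t => - (t * c)) (is_derive_expR (- (x * c))) h.
  apply: (der_eq (der_mul (der_cst (- c^-1) x) h2)) => /=.
  by field; exact: lt0r_neq0.
have ce (x : R) : {for x, continuous (fun t : R => expR (- (t * c)))}.
  have h := der_opp (der_mul (der_id x) (der_cst c x)).
  have h2 := der_comp (g := fun t => - (t * c)) (is_derive_expR (- (x * c))) h.
  exact: (der_continuous h2).
rewrite integral_itv_obnd_cbnd; last first.
  apply/measurable_EFinP; apply: measurable_funTS.
  by apply: continuous_measurable_fun => t; exact: ce.
rewrite (@ge0_continuous_FTC2y _ _ (fun t => - c^-1 * expR (- (t * c))) 0 0).
- by rewrite mul0r oppr0 expR0 -EFinB; congr EFin; rewrite mulr1 sub0r opprK.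
- by move=> x _; rewrite expR_ge0.
- by apply: continuous_subspaceT => x; exact: ce.
- rewrite -[X in _ --> X](mulr0 (- c^-1)); apply: cvgM; first exact: cvg_cst.
  apply: (@cvg_comp _ _ _ (fun t : R => t * c) (fun t : R => expR (- t)) _ +oo%R).
    exact: gt0_cvgMly.
  exact: cvgr_expR.
- by move=> x _; have [] := dF x.
- by apply: cvg_at_right_filter; apply: der_continuous; exact: dF.
- by move=> x _; rewrite derive1E; apply: derive_val; exact: dF.
Qed.

(** The common majorant: constants, powers of t up to the second, and ln t away from 0 are all
    compared with exp(t / 2). *)
Lemma eintegrable_expR : eintegrable (fun t => expR (t / 2)).
Proof.
apply: (@eq_integrable _ _ _ _ _ mD (fun t => (expR (- (t / 2)))%:E)).
  by move=> t _ /=; rewrite -expRD; congr (expR _)%:E; lra.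
apply/integrableP; split.
  apply/measurable_EFinP; apply: measurable_funTS.
  apply: (@measurableT_comp _ _ _ _ _ _ expR); first exact: measurable_expR.
  apply: measurableT_comp => //; exact: mulrr_measurable.
under eq_integral do rewrite gee0_abs ?lee_fin ?expR_ge0//.
by rewrite integral_expRN ?ltry// invr_gt0.
Qed.

(** The sum of the bounds exp y >= 1 + y and exp y >= 1 + y^2 / 2 at y = t / 2. It bounds 1, t and
    t^2 at once, by 2, 4 and 32 times exp(t / 2). *)
Lemma expR_half_quad t : 0 < t -> 1 + t / 2 + t ^+ 2 / 16 <= 2 * expR (t / 2).
Proof.
move=> t0.
have y0 : 0 <= t / 2 by lra.
have := expR_ge1Dxn 1 y0; have := expR_ge1Dx (t / 2).
rewrite (_ : 2`! = 2%N)//.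
by nra.
Qed.

Lemma ln_le_self t : 0 < t -> ln t < t.
Proof. exact: ln_sublinear. Qed.

(** The majorant is cut at 1: below, the square itself, integrable by [integral_onem_ln2] with n = 0
    and m = 1; above, ln t < t and t^2 <= 32 exp(t / 2). *)
Lemma eintegrable_ln2 : eintegrable (fun t => ln t ^+ 2).
Proof.
have i0 : leb.-integrable `]0%R, 1] (fun t => (ln t ^+ 2)%:E).
  apply/integrableP; split.
    apply/measurable_EFinP; apply: measurable_funTS.
    by apply: measurable_funX; exact: measurable_ln.
  under eq_integral do rewrite gee0_abs ?lee_fin ?sqr_ge0//.
  rewrite (_ : (fun t => (ln t ^+ 2)%:E) =
      (fun t => ((1 - t / 1) ^+ 0 * ln (t / 1) ^+ 2)%:E)).
    by rewrite integral_onem_ln2// ltry.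
  by apply/funext => t; rewrite expr0 mul1r divr1.
have m01 : measurable (`]0%R, 1]%classic :
    set (g_sigma_algebraType (R.-ocitv.-measurable))) by exact: measurable_itv.
have i1 := (integrable_mkcond _ m01).1 i0.
have i2 : leb.-integrable D ((fun t => (ln t ^+ 2)%:E) \_ `]0%R, 1]).
  apply: integrableS i1 => //.
have i3 := integrableD mD i2 (eintegrableZ 32 eintegrable_expR).
apply: (le_integrable mD _ _ i3).
  apply: measurable_eweight; apply: measurable_funTS.
  by apply: measurable_funX; exact: measurable_ln.
move=> t /=; rewrite in_itv/= andbT => t0.
have e1 : 0 <= expR (- t) * (32 * expR (t / 2)) by rewrite !mulr_ge0 ?expR_ge0.
have e2 : expR (- t) <= 1 by rewrite expR_le1; lra.
have l0 : 0 <= ln t ^+ 2 by exact: sqr_ge0.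
have e3 : 0 <= expR (- t) * ln t ^+ 2 by exact: mulr_ge0 (expR_ge0 _) l0.
rewrite patchE; case: ifPn => [_|/negP h].
  rewrite -EFinD lee_fin (ger0_norm e3); apply: le_trans (ler_norm _).
  by have := expR_ge0 (- t); nra.
have t1 : 1 < t.
  by rewrite ltNge; apply/negP => t1; apply: h; rewrite inE/= in_itv/= t0.
rewrite (_ : point = 0%E)// add0e lee_fin (ger0_norm e3) (ger0_norm e1).
rewrite ler_wpM2l ?expR_ge0//.
have := expR_half_quad t0; have := ln_le_self t0; have := ln_gt0 t1.
by nra.
Qed.

Lemma eintegrable1 : eintegrable (fun=> 1).
Proof.
apply: (eintegrable_le _ _ eintegrable_expR) => //.
by move=> t t0; rewrite normr1; have := expR_ge1Dx (t / 2); lra.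
Qed.

Lemma eint1 : eint (fun=> 1) = 1.
Proof.
rewrite /eint /Rintegral; under eq_integral do rewrite mulr1 -[t in - t]mulr1.
by rewrite integral_expRN// invr1.
Qed.

Lemma eintegrable_cst c : eintegrable (fun=> c).
Proof.
have := eintegrableZ c eintegrable1; apply: eq_integrable => //.
by move=> t _; rewrite mulr1.
Qed.

Lemma eintegrable_ln : eintegrable (@ln R).
Proof.
apply: (eintegrable_le _ _ (eintegrableD eintegrable1 eintegrable_ln2)).
  by apply: measurable_funTS; exact: measurable_ln.
by move=> t t0; exact: ln_abs_le.
Qed.

Lemma eintegrable_bounded f (c : R) : measurable_fun D f ->
  (forall t, 0 < t -> `|f t| <= c) -> eintegrable f.
Proof. by move=> mf fc; apply: (eintegrable_le mf fc); exact: eintegrable_cst. Qed.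

End exponential_weight.

(** * Logarithmic moments of the exponential law *)

Section log_moments.
Context {R : realType}.
Implicit Types (t c : R) (f g h : R -> R).
Local Notation D := (`]0%R, +oo[%classic : set R).
Local Notation leb := (@lebesgue_measure R).

Lemma onemX_le_expR (n : nat) t : t <= n.+1%:R ->
  (1 - t / n.+1%:R) ^+ n.+1 <= expR (- t).
Proof.
move=> tn.
have e : expR (- t) = expR (- (t / n.+1%:R)) ^+ n.+1.
  by rewrite -expRM_natl mulrN mulrC divfK// pnatr_eq0.
rewrite e lerXn2r ?nnegrE ?expR_ge0//.
  by rewrite subr_ge0 ler_pdivrMr ?mul1r// ltr0n.
by have := expR_ge1Dx (- (t / n.+1%:R)).
Qed.

Lemma cvg_divn t : t / n.+1%:R @[n --> \oo] --> 0.
Proof.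
rewrite -[X in _ --> X](mulr0 t); apply: cvgM; first exact: cvg_cst.
exact: cvg_harmonic.
Qed.

(** A squeeze: with x = t / (n + 1), exp(x / (1 - x)) >= 1 / (1 - x) gives the lower bound exp(-t /
    (1 - x)), which tends to exp(-t). *)
Lemma cvg_onemX_expR t : 0 < t ->
  (1 - t / n.+1%:R) ^+ n.+1 @[n --> \oo] --> expR (- t).
Proof.
move=> t0.
have h1 : expR (- (t / (1 - t / n.+1%:R))) @[n --> \oo] --> expR (- t).
  apply: continuous_cvg; first exact: continuous_expR.
  apply: cvgN; rewrite -[X in _ --> X]mulr1; apply: cvgM; first exact: cvg_cst.
  rewrite -[X in _ --> X]invr1; apply: cvgV; first exact: oner_neq0.
  rewrite -[X in _ --> X]subr0; apply: cvgB; first exact: cvg_cst.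
  exact: cvg_divn.
apply: (squeeze_cvgr _ h1 (cvg_cst (expR (- t)))).
have hn : \forall n \near \oo, t < n.+1%:R.
  near=> n; apply: (@lt_le_trans _ _ (n%:R)); last by rewrite ler_nat.
  by near: n; exact: nbhs_infty_gtr.
near=> n.
have tn : t < n.+1%:R by near: n.
rewrite onemX_le_expR ?(ltW tn)// andbT.
set x := t / n.+1%:R.
have x1 : 0 < 1 - x by rewrite subr_gt0 /x ltr_pdivrMr ?mul1r// ltr0n.
have -> : - (t / (1 - x)) = n.+1%:R * - (x / (1 - x)).
  by rewrite mulrN mulrA /x [n.+1%:R * _]mulrC divfK// pnatr_eq0.
rewrite expRM_natl lerXn2r ?nnegrE ?expR_ge0 ?(ltW x1)//.
rewrite expRN -[leRHS]invrK lef_pV2 ?posrE ?expR_gt0 ?invr_gt0//.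
have := expR_ge1Dx (x / (1 - x)); rewrite (_ : 1 + x / (1 - x) = (1 - x)^-1)//.
by field; rewrite gt_eqF.
Unshelve. all: by end_near. Qed.

(** Euler's limit, by dominated convergence with majorant exp(-t) |h t|. For h a power of ln the
    truncated integrals are explicit harmonic sums, which yields the derivatives of Gamma at 1. *)
Lemma eint_cvg_onem h : measurable_fun setT h -> eintegrable h ->
  (\int[leb]_(t in `]0%R, n.+1%:R]) ((1 - t / n.+1%:R) ^+ n.+1 * h t))
    @[n --> \oo] --> eint h.
Proof.
move=> mh ih.
pose f_ (n : nat) : R -> \bar R :=
  (fun t => ((1 - t / n.+1%:R) ^+ n.+1 * h t)%:E) \_ `]0, n.+1%:R].
have mf0 (n : nat) : measurable_fun setT (fun t => ((1 - t / n.+1%:R) ^+ n.+1 * h t)%:E).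
  apply/measurable_EFinP; apply: measurable_funM => //.
  apply: measurable_funX; apply: measurable_funB => //.
  exact: mulrr_measurable.
have fE n : (\int[leb]_(t in D) f_ n t = \int[leb]_(t in `]0%R, n.+1%:R])
    ((1 - t / n.+1%:R) ^+ n.+1 * h t)%:E)%E.
  rewrite /f_ -integral_mkcondr; congr (integral _ _ _).
  apply/seteqP; split => [t [] //|t /=]; rewrite !in_itv/= => /andP[t0 tn].
  by rewrite t0.
rewrite /eint /Rintegral; apply: fine_cvg; rewrite fineK; last first.
  by apply: integrable_fin_num => //; exact: mD.
suff [_ _ cv] : [/\ leb.-integrable D (fun t => (expR (- t) * h t)%:E),
    [sequence \int[leb]_(t in D) `|f_ n t - (expR (- t) * h t)%:E|]_n @ \oo --> 0 &
    [sequence \int[leb]_(t in D) f_ n t]_n @ \oo -->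
      \int[leb]_(t in D) (expR (- t) * h t)%:E]%E.
  by under eq_fun do rewrite -fE; exact: cv.
apply: (@dominated_convergence _ _ R leb D mD f_
  (fun t => (expR (- t) * h t)%:E) (fun t => (expR (- t) * `|h t|)%:E)).
- move=> n; apply: measurable_funTS; rewrite /f_.
  have mI : measurable (`]0%R, n.+1%:R]%classic :
    set (g_sigma_algebraType (R.-ocitv.-measurable))) by exact: measurable_itv.
  by apply: (measurable_restrictT _ mI).1; apply: measurable_funTS; exact: mf0.
- by apply: measurable_eweight; exact: measurable_funTS.
- apply/aeW => t /=; rewrite in_itv/= andbT => t0.
  apply: (@cvg_trans _ (((1 - t / n.+1%:R) ^+ n.+1 * h t)%:E @[n --> \oo])); last first.
    apply: cvg_EFin; first exact: nearW.
    by apply: cvgM; [exact: cvg_onemX_expR|exact: cvg_cst].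
  apply: near_eq_cvg; near=> n.
  rewrite /f_ patchE ifT// inE/= in_itv/= t0/=.
  apply/ltW; apply: (@lt_le_trans _ _ (n%:R)); last by rewrite ler_nat.
  by near: n; exact: nbhs_infty_gtr.
- have ih' : leb.-integrable D (EFin \o (fun t => expR (- t) * h t)) by [].
  have := integrable_norm ih'; apply: eq_integrable; first exact: mD.
  by move=> t _ /=; rewrite normrM ger0_norm ?expR_ge0.
- apply/aeW => t n /=; rewrite in_itv/= andbT => t0.
  rewrite /f_ patchE; case: ifPn => [|_].
    rewrite inE/= in_itv/= t0/= => tn; rewrite lee_fin normrM.
    rewrite ler_wpM2r// ger0_norm; first exact: onemX_le_expR.
    by rewrite exprn_ge0// subr_ge0 ler_pdivrMr ?mul1r// ltr0n.
  by rewrite (_ : point = 0%E)// abse0 lee_fin mulr_ge0// expR_ge0.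
Unshelve. all: by end_near. Qed.

Let m_ (n : nat) : R := n.+1%:R.
Let itv (n : nat) : set R := `]0%R, m_ n]%classic.
Let mitv n : measurable (itv n : set (g_sigma_algebraType (R.-ocitv.-measurable))).
Proof. exact: measurable_itv. Qed.
Let m_gt0 n : 0 < m_ n. Proof. exact: ltr0n. Qed.

Let ge0_int n (f : R -> R) (v : R) : measurable_fun setT f ->
  (forall t, itv n t -> 0 <= f t) ->
  (\int[leb]_(t in itv n) (f t)%:E = v%:E)%E ->
  leb.-integrable (itv n) (EFin \o f) /\ \int[leb]_(t in itv n) f t = v.
Proof.
move=> mf f0 fv; split; last by rewrite /Rintegral fv.
apply/integrableP; split.
  by apply/measurable_EFinP; exact: measurable_funTS.
under eq_integral => t tn.
  rewrite gee0_abs; last by rewrite lee_fin f0// -inE.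
  over.
by rewrite /= fv ltry.
Qed.

Let mX n : measurable_fun setT (fun t => (1 - t / m_ n) ^+ n.+1).
Proof.
apply: measurable_funX; apply: measurable_funB => //.
exact: mulrr_measurable.
Qed.

Let ml n : measurable_fun setT (fun t => ln (t / m_ n)).
Proof.
apply: (@measurableT_comp _ _ _ _ _ _ (@ln R)); first exact: measurable_ln.
exact: mulrr_measurable.
Qed.

Let X_ge0 n t : itv n t -> 0 <= (1 - t / m_ n) ^+ n.+1.
Proof.
rewrite /itv/= in_itv/= => /andP[t0 tn].
by rewrite exprn_ge0// subr_ge0 ler_pdivrMr// mul1r.
Qed.

Let I0 n := ge0_int (mX n) (@X_ge0 n) (integral_onem n.+1 (m_gt0 n)).

Let I1 n : leb.-integrable (itv n) (EFin \o (fun t => (1 - t / m_ n) ^+ n.+1 * - ln (t / m_ n)))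
  /\ \int[leb]_(t in itv n) ((1 - t / m_ n) ^+ n.+1 * - ln (t / m_ n)) =
     m_ n * (harm n.+2 / n.+2%:R).
Proof.
apply: ge0_int; last exact: integral_onem_ln.
  apply: measurable_funM; first exact: mX.
  by apply: measurableT_comp => //; exact: ml.
move=> t tn; rewrite mulr_ge0 ?X_ge0// oppr_ge0 ln_le0//.
by move: tn; rewrite /itv/= in_itv/= => /andP[t0 tn]; rewrite ler_pdivrMr// mul1r.
Qed.

Let I2 n : leb.-integrable (itv n) (EFin \o (fun t => (1 - t / m_ n) ^+ n.+1 * ln (t / m_ n) ^+ 2))
  /\ \int[leb]_(t in itv n) ((1 - t / m_ n) ^+ n.+1 * ln (t / m_ n) ^+ 2) =
     m_ n * ((harm n.+2 ^+ 2 + harm2 n.+2) / n.+2%:R).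
Proof.
apply: ge0_int; last exact: integral_onem_ln2.
  apply: measurable_funM; first exact: mX.
  by apply: measurable_funX; exact: ml.
by move=> t tn; apply: mulr_ge0; [exact: X_ge0|exact: sqr_ge0].
Qed.

Let lnE n t : itv n t -> ln t = ln (t / m_ n) + ln (m_ n).
Proof.
rewrite /itv/= in_itv/= => /andP[t0 tn].
by rewrite -lnM ?posrE ?divr_gt0// divfK// gt_eqF.
Qed.

(** Writing ln t = ln (t / m) + ln m isolates ln m - H_{n+2}, which is Euler's sequence up to sign
    and a shift that disappears in the limit. *)
Let J1 n : \int[leb]_(t in itv n) ((1 - t / m_ n) ^+ n.+1 * ln t) =
  m_ n / n.+2%:R * (ln (m_ n) - harm n.+2).
Proof.
have [i0 v0] := I0 n; have [i1 v1] := I1 n.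
have i0' : leb.-integrable (itv n) (EFin \o (fun t => ln (m_ n) * (1 - t / m_ n) ^+ n.+1)).
  by have := integrableZl (mitv n) (ln (m_ n)) i0; apply: eq_integrable => //.
transitivity (\int[leb]_(t in itv n) (ln (m_ n) * (1 - t / m_ n) ^+ n.+1 -
    (1 - t / m_ n) ^+ n.+1 * - ln (t / m_ n))).
  by apply: eq_Rintegral => t; rewrite inE => /lnE ->; ring.
by rewrite RintegralB// RintegralZl// v0 v1; ring.
Qed.

Let J2 n : \int[leb]_(t in itv n) ((1 - t / m_ n) ^+ n.+1 * ln t ^+ 2) =
  m_ n / n.+2%:R * ((harm n.+2 - ln (m_ n)) ^+ 2 + harm2 n.+2).
Proof.
have [i0 v0] := I0 n; have [i1 v1] := I1 n; have [i2 v2] := I2 n.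
have i0' : leb.-integrable (itv n) (EFin \o (fun t => ln (m_ n) ^+ 2 * (1 - t / m_ n) ^+ n.+1)).
  by have := integrableZl (mitv n) (ln (m_ n) ^+ 2) i0; apply: eq_integrable => //.
have i1' : leb.-integrable (itv n) (EFin \o (fun t => 2 * ln (m_ n) *
    ((1 - t / m_ n) ^+ n.+1 * - ln (t / m_ n)))).
  by have := integrableZl (mitv n) (2 * ln (m_ n)) i1; apply: eq_integrable => //.
have i01 : leb.-integrable (itv n) (EFin \o (fun t => ln (m_ n) ^+ 2 * (1 - t / m_ n) ^+ n.+1 -
    2 * ln (m_ n) * ((1 - t / m_ n) ^+ n.+1 * - ln (t / m_ n)))).
  by have := integrableB (mitv n) i0' i1'; apply: eq_integrable => //.
transitivity (\int[leb]_(t in itv n) (ln (m_ n) ^+ 2 * (1 - t / m_ n) ^+ n.+1 -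
    2 * ln (m_ n) * ((1 - t / m_ n) ^+ n.+1 * - ln (t / m_ n)) +
    (1 - t / m_ n) ^+ n.+1 * ln (t / m_ n) ^+ 2)).
  by apply: eq_Rintegral => t; rewrite inE => /lnE ->; ring.
by rewrite RintegralD// RintegralB// !RintegralZl// v0 v1 v2; ring.
Qed.

Let cvg_ratio : (n.+2%:R / m_ n : R) @[n --> \oo] --> (1 : R).
Proof.
rewrite (_ : (fun n => _) = (fun n : nat => 1 + 1 / n.+1%:R :> R)).
  rewrite -[X in _ --> X]addr0; apply: cvgD; first exact: cvg_cst.
  exact: cvg_divn.
apply/funext => n; rewrite /m_ -natr1.
by rewrite mulrDl divff ?pnatr_eq0.
Qed.

Let cvg_H : (harm n.+2 - ln (m_ n)) @[n --> \oo] --> - eint (@ln R).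
Proof.
have c := eint_cvg_onem (@measurable_ln R) eintegrable_ln.
rewrite -[X in _ --> - X]mul1r.
rewrite (_ : (fun n => _) = (fun n => - (n.+2%:R / m_ n *
  \int[leb]_(t in `]0%R, n.+1%:R]) ((1 - t / n.+1%:R) ^+ n.+1 * ln t)))).
  by apply: cvgN; apply: cvgM; [exact: cvg_ratio|exact: c].
apply/funext => n /=.
rewrite -[X in n.+2%:R / m_ n * X]/(\int[leb]_(t in itv n) ((1 - t / m_ n) ^+ n.+1 * ln t)) J1.
have : m_ n != 0 by rewrite gt_eqF.
have : n.+2%:R != 0 :> R by rewrite pnatr_eq0.
by move: (m_ n) (n.+2%:R : R) => a b a0 b0; field; rewrite a0.
Qed.

Let cvg_H' : (harm n - ln n%:R) @[n --> \oo] --> - eint (@ln R).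
Proof.
rewrite -cvg_shiftS/=.
have h : (n.+2%:R^-1 : R) @[n --> \oo] --> (0 : R).
  by have := @cvg_harmonic R; rewrite -cvg_shiftS.
suff : (harm n.+1 - ln n.+1%:R) @[n --> \oo] --> - eint (@ln R) - 0.
  by rewrite subr0.
rewrite (_ : (fun n => _) = (fun n => harm n.+2 - ln (m_ n) - n.+2%:R^-1)).
  by apply: cvgB; [exact: cvg_H|exact: h].
apply/funext => n /=; rewrite [harm n.+2]harmS.
by rewrite [harm n.+1 + _ - _]addrAC addrK.
Qed.

(** [cvg_H'] gives the convergence of Euler's sequence together with the value of its limit. *)
Lemma eint_ln : eint (@ln R) = - euler_gamma R.
Proof.
apply/esym; rewrite -[RHS]opprK; congr (- _); apply: cvg_lim => //.
rewrite (_ : (fun n => _) = (fun n => harm n - ln n%:R)); first exact: cvg_H'.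
apply/funext => n; congr (_ - _).
by rewrite big_add1/= big_mkord.
Qed.

(** This is the second derivative of Gamma at 1. The limit z of the sums of inverse squares stays
    abstract here; [zeta2] evaluates it by a Fourier series. *)
Lemma eint_ln2 (z : R) : harm2 n @[n --> \oo] --> z ->
  eint (fun t => ln t ^+ 2) = euler_gamma R ^+ 2 + z.
Proof.
move=> hz.
have c := eint_cvg_onem (measurable_funX 2 (@measurable_ln R)) eintegrable_ln2.
have c1 := cvgM cvg_ratio c; rewrite mul1r in c1; have {}c1 := c1 _.
have c2 : ((harm n.+2 - ln (m_ n)) ^+ 2 + harm2 n.+2) @[n --> \oo] -->
    euler_gamma R ^+ 2 + z.
  apply: cvgD; last first.
    by move: hz; rewrite -2!cvg_shiftS.
  rewrite -[euler_gamma R]opprK -eint_ln expr2; under eq_fun do rewrite expr2.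
  by apply: cvgM; exact: cvg_H.
suff c1E : (fun n => (harm n.+2 - ln (m_ n)) ^+ 2 + harm2 n.+2) = (fun n =>
    n.+2%:R / m_ n * \int[leb]_(t in `]0%R, n.+1%:R])
    ((1 - t / n.+1%:R) ^+ n.+1 * ln t ^+ 2)).
  by rewrite c1E in c2; apply: (cvg_unique _ (c1 _) c2).
apply/funext => n /=.
rewrite -[X in n.+2%:R / m_ n * X]/(\int[leb]_(t in itv n) ((1 - t / m_ n) ^+ n.+1 * ln t ^+ 2)) J2.
have : m_ n != 0 by rewrite gt_eqF.
have : n.+2%:R != 0 :> R by rewrite pnatr_eq0.
by move: (m_ n) (n.+2%:R : R) => a b a0 b0; field; rewrite a0.
Qed.

End log_moments.

(** * Pointwise convergence of Fourier series *)

Section unit_interval.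
Context {R : realType}.
Implicit Types (t u x y c a b : R) (f g h : R -> R).
Local Notation leb := (@lebesgue_measure R).
Local Notation U := (`[0%R, 1%R]%classic : set R).
Local Notation uint g := (\int[leb]_(u in U) g u).

Lemma mU : measurable (U : set (g_sigma_algebraType (R.-ocitv.-measurable))).
Proof. exact: measurable_itv. Qed.

Definition bmf g : Prop := measurable_fun U g /\
  exists M, forall u, U u -> `|g u| <= M.

Lemma bmf_int g : bmf g -> leb.-integrable U (EFin \o g).
Proof.
move=> [mg [M gM]]; apply: measurable_bounded_integrable => //.
  by rewrite /= lebesgue_measure_itv/= lte_fin ltr01 sube0 ltry.
exists M; split; first by rewrite num_real.
by move=> x Mx u Uu /=; apply: le_trans (ltW Mx); exact: gM.
Qed.

Lemma bmf_continuous g : continuous g -> bmf g.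
Proof.
move=> cg; split.
  by apply: measurable_funTS; exact: continuous_measurable_fun.
have [|M [_ hM]] := @compact_bounded _ _ (g @` U).
  apply: continuous_compact; last exact: segment_compact.
  exact: continuous_subspaceT.
exists (M + 1) => u Uu; apply: hM; first by rewrite ltrDl.
by exists u.
Qed.

Lemma bmfD g h : bmf g -> bmf h -> bmf (fun u => g u + h u).
Proof.
move=> [mg [M gM]] [mh [N hN]]; split; first exact: measurable_funD.
exists (M + N) => u Uu; rewrite (le_trans (ler_normD _ _))//.
by rewrite lerD ?gM ?hN.
Qed.

Lemma bmfM g h : bmf g -> bmf h -> bmf (fun u => g u * h u).
Proof.
move=> [mg [M gM]] [mh [N hN]]; split; first exact: measurable_funM.
exists (M * N) => u Uu; rewrite normrM.
by rewrite ler_pM ?gM ?hN.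
Qed.

Lemma bmf_cst c : bmf (fun=> c).
Proof. by split => //; exists `|c|. Qed.

Lemma bmfZ c g : bmf g -> bmf (fun u => c * g u).
Proof. by move=> bg; apply: bmfM => //; exact: bmf_cst. Qed.

Lemma bmfB g h : bmf g -> bmf h -> bmf (fun u => g u - h u).
Proof.
move=> bg bh; rewrite (_ : (fun u => _) = (fun u => g u + (-1) * h u)).
  by apply: bmfD => //; exact: bmfZ.
by apply/funext => u; rewrite mulN1r.
Qed.

Lemma uintD g h : bmf g -> bmf h -> uint (fun u => g u + h u) = uint g + uint h.
Proof.
move=> bg bh.
by apply: RintegralD; [exact: mU|exact: bmf_int|exact: bmf_int].
Qed.

Lemma uintB g h : bmf g -> bmf h -> uint (fun u => g u - h u) = uint g - uint h.
Proof.
move=> bg bh.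
by apply: RintegralB; [exact: mU|exact: bmf_int|exact: bmf_int].
Qed.

Lemma uintZ c g : bmf g -> uint (fun u => c * g u) = c * uint g.
Proof. by move=> bg; apply: RintegralZl; [exact: mU|exact: bmf_int]. Qed.

Lemma eq_uint g h : (forall u, 0 <= u <= 1 -> g u = h u) -> uint g = uint h.
Proof.
by move=> gh; apply: eq_Rintegral => u; rewrite inE/= in_itv/= => /gh.
Qed.

Lemma uint_cst c : uint (fun=> c) = c.
Proof.
rewrite Rintegral_cst; last exact: mU.
by rewrite /= lebesgue_measure_itv/= lte_fin ltr01 sube0 /= mulr1.
Qed.

Lemma uint_ge0 g : (forall u, 0 <= g u) -> 0 <= uint g.
Proof. by move=> g0; apply: Rintegral_ge0. Qed.

Lemma uint_FTC g (G : R -> R) : continuous g ->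
  (forall u, is_derive u (1 : R) G (g u)) -> uint g = G 1 - G 0.
Proof.
move=> cg dG; rewrite /Rintegral (@continuous_FTC2 _ _ G)//.
- exact: continuous_subspaceT.
- split.
  + by move=> u _; have [] := dG u.
  + by apply: cvg_at_right_filter; exact: (der_continuous (dG 0)).
  + by apply: cvg_at_left_filter; exact: (der_continuous (dG 1)).
- by move=> u _; rewrite derive1E; apply: derive_val; exact: dG.
Qed.

Lemma der_affine a b u : is_derive u (1 : R) (fun u => a * u + b) a.
Proof.
have h := der_add (der_mul (der_cst a u) (der_id u)) (der_cst b u).
by apply: (der_eq h); ring.
Qed.

Lemma der_sin_affine a b u :
  is_derive u (1 : R) (fun u => sin (a * u + b)) (cos (a * u + b) * a).
Proof.
exact: (der_comp (g := fun u => a * u + b) (is_derive_sin _) (der_affine a b u)).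
Qed.

Lemma der_cos_affine a b u :
  is_derive u (1 : R) (fun u => cos (a * u + b)) (- sin (a * u + b) * a).
Proof.
exact: (der_comp (g := fun u => a * u + b) (is_derive_cos _) (der_affine a b u)).
Qed.

Lemma der_expR_linear c u :
  is_derive u (1 : R) (fun u => expR (c * u)) (expR (c * u) * c).
Proof.
have h : is_derive u (1 : R) (fun u => c * u) c.
  by apply: (der_eq (der_mul (der_cst c u) (der_id u))); ring.
exact: (der_comp (g := fun u => c * u) (is_derive_expR _) h).
Qed.

Lemma continuous_der (f df : R -> R) :
  (forall u, is_derive u (1 : R) f (df u)) -> continuous f.
Proof. by move=> d u; exact: (der_continuous (d u)). Qed.

Lemma continuous_sin_affine a b : continuous (fun u => sin (a * u + b)).
Proof. exact: continuous_der (der_sin_affine a b). Qed.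

Lemma continuous_cos_affine a b : continuous (fun u => cos (a * u + b)).
Proof. exact: continuous_der (der_cos_affine a b). Qed.

Lemma uint_cos_affine a b : a != 0 ->
  uint (fun u => cos (a * u + b)) = (sin (a + b) - sin b) / a.
Proof.
move=> a0; pose G u := sin (a * u + b) * a^-1.
transitivity (G 1 - G 0); last by rewrite /G mulr1 mulr0 add0r mulrBl.
apply: uint_FTC; first exact: continuous_cos_affine.
move=> u; apply: (der_eq (der_mul (der_sin_affine a b u) (der_cst a^-1 u))).
  by rewrite mulfK// mulr0 addr0.
Qed.

Definition freq (k : nat) : R := 2 * pi * k%:R.

Lemma sin_freqD k b : sin (freq k + b) = sin b.
Proof.
rewrite addrC /freq.
have -> : 2 * pi * k%:R = (pi *+ 2) *+ k :> R by rewrite mulr_natr mulr_natl.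
exact: (periodicn (@sinD2pi R)).
Qed.

Lemma cos_freqD k b : cos (freq k + b) = cos b.
Proof.
rewrite addrC /freq.
have -> : 2 * pi * k%:R = (pi *+ 2) *+ k :> R by rewrite mulr_natr mulr_natl.
exact: (periodicn (@cosD2pi R)).
Qed.

Lemma sin_freq k : sin (freq k) = 0.
Proof. by rewrite -[freq k]addr0 sin_freqD sin0. Qed.

Lemma cos_freq k : cos (freq k) = 1.
Proof. by rewrite -[freq k]addr0 cos_freqD cos0. Qed.

Lemma freq_gt0 k : (0 < k)%N -> 0 < freq k.
Proof. by move=> k0; rewrite /freq !mulr_gt0 ?pi_gt0 ?ltr0n. Qed.

Lemma uint_cos_freq k b : (0 < k)%N -> uint (fun u => cos (freq k * u + b)) = 0.
Proof.
by move=> k0; rewrite uint_cos_affine ?gt_eqF ?freq_gt0// sin_freqD subrr mul0r.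
Qed.

Lemma prod_sin x y : sin x * sin y = (cos (x - y) - cos (x + y)) / 2.
Proof. by rewrite cosB cosD; field. Qed.

Lemma prod_cos x y : cos x * cos y = (cos (x - y) + cos (x + y)) / 2.
Proof. by rewrite cosB cosD; field. Qed.

Lemma prod_cossin x y : cos x * sin y = (sin (y + x) + sin (y - x)) / 2.
Proof. by rewrite sinB sinD; field. Qed.

(* Orthogonal of square norm 1/2, as cosines and sines are *)
Definition orthohalf (phi : nat -> R -> R) : Prop :=
  (forall n, bmf (phi n)) /\
  (forall n m, (n <= m)%N -> uint (fun u => phi n u * phi m u) = (n == m)%:R / 2).

(** Induction on M: subtracting from h its component 2 c phi_M keeps the coefficients on the earlier
    functions and lowers the integral of the square by 2 c^2. *)
Lemma bessel phi : orthohalf phi -> forall h, bmf h -> forall M,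
  \sum_(n < M) 2 * (uint (fun u => h u * phi n u)) ^+ 2 <=
  uint (fun u => h u * h u).
Proof.
move=> [bphi ophi] h + M; elim: M h => [|M IH] h bh.
  by rewrite big_ord0; apply: uint_ge0 => u; rewrite -expr2 sqr_ge0.
set c := uint (fun u => h u * phi M u).
pose h' u := h u - 2 * c * phi M u.
have bh' : bmf h' by apply: bmfB => //; exact: bmfZ.
have bhp n : bmf (fun u => h u * phi n u) by exact: bmfM.
have bpp n m : bmf (fun u => phi n u * phi m u) by exact: bmfM.
have E1 (n : 'I_M) : uint (fun u => h' u * phi n u) = uint (fun u => h u * phi n u).
  rewrite (@eq_uint _ (fun u => h u * phi n u - 2 * c * (phi n u * phi M u))); last first.
    by move=> u _; rewrite /h'; ring.
  rewrite uintB ?uintZ//; last exact: bmfZ.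
  by rewrite ophi ?(ltnW (ltn_ord n))// ltn_eqF// mul0r mulr0 subr0.
have E2 : uint (fun u => h' u * h' u) = uint (fun u => h u * h u) - 2 * c ^+ 2.
  rewrite (@eq_uint _ (fun u => h u * h u - 4 * c * (h u * phi M u)
      + 4 * c ^+ 2 * (phi M u * phi M u))); last first.
    by move=> u _; rewrite /h'; ring.
  have bhh : bmf (fun u => h u * h u) by exact: bmfM.
  rewrite uintD ?uintB ?uintZ//; try exact: bmfZ; last first.
    by apply: bmfB => //; exact: bmfZ.
  by rewrite -/c ophi// eqxx /=; field.
rewrite big_ord_recr/= -lerBrDr -/c -E2.
apply: le_trans (IH _ bh').
by under [leRHS]eq_bigr do rewrite E1.
Qed.

(** The Riemann-Lebesgue lemma: by Bessel's inequality the squared coefficients form a convergent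
    series, so they tend to 0. *)
Lemma coef_cvg0 phi h : orthohalf phi -> bmf h ->
  uint (fun u => h u * phi n u) @[n --> \oo] --> 0.
Proof.
move=> op bh.
pose c n := uint (fun u => h u * phi n u).
have cs : cvgn (series (fun n => 2 * c n ^+ 2)).
  apply: nondecreasing_is_cvgn.
    apply/nondecreasing_seqP => n; rewrite seriesEnat/= big_nat_recr//= lerDl.
    by rewrite mulr_ge0// sqr_ge0.
  exists (uint (fun u => h u * h u)) => _ [n _ <-].
  by rewrite seriesEord; exact: bessel.
have {}cs := cvg_series_cvg_0 cs.
apply/cvgrPdist_lt => e e0.
have e20 : 0 < 2 * e ^+ 2 by rewrite mulr_gt0// exprn_gt0.
move/cvgrPdist_lt : cs => /(_ _ e20); apply: filterS => n /=.
rewrite !sub0r !normrN normrM (ger0_norm (ler0n _ 2)) ltr_pM2l// normrX.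
by rewrite ltr_sqr ?nnegrE// ltW.
Qed.

(** The frequency in the numerator of the Dirichlet kernel. Sums and differences of two of them are
    multiples of 2 pi, hence orthogonality on the unit interval. *)
Let half (n : nat) : R := (2 * n%:R + 1) * pi.

Let halfB n m : (n <= m)%N -> half m - half n = freq (m - n).
Proof. by move=> nm; rewrite /half /freq natrB//; ring. Qed.

Let halfD n m : half m + half n = freq (m + n).+1.
Proof. by rewrite /half /freq -[(m + n).+1%:R]natr1 natrD; ring. Qed.

Lemma orthohalf_sin : orthohalf (fun n u => sin (half n * u + 0)).
Proof.
split=> [n|n m nm]; first by apply: bmf_continuous; exact: continuous_sin_affine.
rewrite (@eq_uint _ (fun u => 2^-1 * (cos (freq (m - n) * u + 0)
    - cos (freq (m + n).+1 * u + 0)))); last first.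
  move=> u _; rewrite mulrC prod_sin -halfB// -halfD !addr0 mulrC.
  by congr (_ * (cos _ - cos _)); ring.
have bc k : bmf (fun u => cos (freq k * u + 0)).
  by apply: bmf_continuous; exact: continuous_cos_affine.
rewrite uintZ; last exact: bmfB.
rewrite uintB// [X in _ - X]uint_cos_freq// subr0.
case: eqVneq => [<-|nm'].
  rewrite subnn (@eq_uint _ (fun=> 1)) ?uint_cst /=; first by field.
  by move=> u _; rewrite /freq mulr0 mul0r add0r cos0.
by rewrite uint_cos_freq ?mulr0 ?mul0r// subn_gt0 ltn_neqAle nm'.
Qed.

Lemma orthohalf_cos : orthohalf (fun n u => cos (half n * u + 0)).
Proof.
split=> [n|n m nm]; first by apply: bmf_continuous; exact: continuous_cos_affine.
rewrite (@eq_uint _ (fun u => 2^-1 * (cos (freq (m - n) * u + 0)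
    + cos (freq (m + n).+1 * u + 0)))); last first.
  move=> u _; rewrite mulrC prod_cos -halfB// -halfD !addr0 mulrC.
  by congr (_ * (cos _ + cos _)); ring.
have bc k : bmf (fun u => cos (freq k * u + 0)).
  by apply: bmf_continuous; exact: continuous_cos_affine.
rewrite uintZ; last exact: bmfD.
rewrite uintD// [X in _ + X]uint_cos_freq// addr0.
case: eqVneq => [<-|nm'].
  rewrite subnn (@eq_uint _ (fun=> 1)) ?uint_cst /=; first by field.
  by move=> u _; rewrite /freq mulr0 mul0r add0r cos0.
by rewrite uint_cos_freq ?mulr0 ?mul0r// subn_gt0 ltn_neqAle nm'.
Qed.

Lemma sin_lower : exists2 c : R, 0 < c & forall z : R, 0 <= z <= pi / 2 -> c * z <= sin z.
Proof.
have p0 := @pi_gt0 R.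
have c0 : 0 < cos (pi / 4 : R) by apply: cos_gt0_pihalf; apply/andP; split; lra.
(* The duplication formula gives sin z = 2 sin(z/2) cos(z/2), the mean value theorem gives sin(z/2)
   = (z/2) cos x, and both cosines are at least cos(pi/4). *)
exists (cos (pi / 4) ^+ 2); first by rewrite exprn_gt0.
move=> z /andP[z0 z1].
have cosz x : 0 <= x <= pi / 4 -> cos (pi / 4) <= cos x.
  move=> /andP[x0 x1]; rewrite le_eqVlt; apply/orP.
  have [->|x2] := eqVneq x (pi / 4); [by left|right].
  rewrite ltr_cos ?in_itv/=; first by rewrite lt_neqAle x2 x1.
    by apply/andP; split; lra.
  by apply/andP; split; lra.
have [->|zn0] := eqVneq z 0; first by rewrite mulr0 sin0.
have z20 : 0 < z / 2 by rewrite divr_gt0// lt_neqAle eq_sym zn0.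
have [|x xz] := @MVT R (@sin R) (@cos R) 0 (z / 2) z20 (fun x _ => is_derive_sin x).
  by apply: continuous_subspaceT => x; exact: continuous_sin.
rewrite sin0 !subr0 => sz.
move: xz; rewrite in_itv/= => /andP[x0 xz].
have -> : z = (z / 2) *+ 2 by rewrite mulr2n; field.
rewrite sin_mulr2n sz.
have h1 : cos (pi / 4) <= cos x by apply: cosz; apply/andP; split; lra.
have h2 : cos (pi / 4) <= cos (z / 2) by apply: cosz; apply/andP; split; lra.
have h3 : cos (pi / 4) * cos (pi / 4) <= cos (z / 2) * cos x by nra.
rewrite expr2 !mulr2n; move: h3 z20.
move: (cos (pi / 4) * cos (pi / 4)) (z / 2) => A w.
rewrite mulrA; nra.
Qed.

(** The minimum is the distance from x to the nearest integer, i.e. the distance on the circle used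
    for f in [fourier_cvg]. *)
Lemma sinpi_lower : exists2 c : R, 0 < c & forall x : R, `|x| <= 1 ->
  c * Num.min `|x| (1 - `|x|) <= `|sin (pi * x)|.
Proof.
have p0 := @pi_gt0 R.
have [c c0 hc] := sin_lower.
exists (c * pi); first by rewrite mulr_gt0.
move=> x x1.
have -> : `|sin (pi * x)| = `|sin (pi * `|x|)|.
  have [x0|x0] := leP 0 x; first by rewrite (ger0_norm x0).
  by rewrite (ltr0_norm x0) mulrN sinN normrN.
move: `|x| (normr_ge0 x) x1 => {}x x0 x1.
apply: le_trans (ler_norm _).
rewrite -mulrA minEle; case: ifPn => [xl|]; first by apply: hc; nra.
rewrite -ltNge => xl.
have -> : sin (pi * x) = sin (pi * (1 - x)).
  by rewrite (_ : pi * (1 - x) = - (pi * x) + pi) ?sinDpi ?sinN ?opprK//; ring.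
by apply: hc; nra.
Qed.

Lemma dirichlet (N : nat) x :
  (1 + \sum_(k < N) 2 * cos (freq k.+1 * x)) * sin (pi * x) = sin (half N * x).
Proof.
elim: N => [|N IH]; first by rewrite big_ord0 /half addr0 mul1r; congr sin; ring.
rewrite big_ord_recr/= addrA mulrDl IH -mulrA prod_cossin.
have -> : pi * x + freq N.+1 * x = half N.+1 * x.
  by rewrite /freq /half -[N.+1%:R]natr1; ring.
have -> : pi * x - freq N.+1 * x = - (half N * x).
  by rewrite /freq /half -[N.+1%:R]natr1; ring.
by rewrite sinN; field.
Qed.

Definition fcoef_cos f k : R := 2 * uint (fun u => f u * cos (freq k * u)).
Definition fcoef_sin f k : R := 2 * uint (fun u => f u * sin (freq k * u)).

Definition fourier_sum f (N : nat) y : R := uint f +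
  \sum_(k < N) (fcoef_cos f k.+1 * cos (freq k.+1 * y)
              + fcoef_sin f k.+1 * sin (freq k.+1 * y)).

Let bmf_cosk k : bmf (fun u => cos (freq k * u)).
Proof.
apply: bmf_continuous; have := @continuous_cos_affine (freq k) 0.
by under eq_fun do rewrite addr0.
Qed.

Let bmf_sink k : bmf (fun u => sin (freq k * u)).
Proof.
apply: bmf_continuous; have := @continuous_sin_affine (freq k) 0.
by under eq_fun do rewrite addr0.
Qed.

Lemma fourier_sumE f N y : bmf f -> fourier_sum f N y =
  uint (fun u => f u * (1 + \sum_(k < N) 2 * cos (freq k.+1 * (u - y)))).
Proof.
move=> bf; rewrite /fourier_sum; elim: N => [|N IH].
  by rewrite !big_ord0 addr0; apply: eq_uint => u _; rewrite big_ord0; ring.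
have bD : bmf (fun u => 1 + \sum_(k < N) 2 * cos (freq k.+1 * (u - y))).
  apply: bmfD; first exact: bmf_cst.
  elim: N {IH} => [|N IH].
    by rewrite (_ : (fun u => _) = (fun=> 0)); [exact: bmf_cst|apply/funext => u; rewrite big_ord0].
  rewrite (_ : (fun u => _) = (fun u => \sum_(k < N) 2 * cos (freq k.+1 * (u - y))
       + 2 * cos (freq N.+1 * u + (- freq N.+1 * y)))).
    apply: bmfD => //; apply: bmfZ; apply: bmf_continuous.
    exact: continuous_cos_affine.
  by apply/funext => u; rewrite big_ord_recr/=; congr (_ + 2 * cos _); ring.
rewrite big_ord_recr/= addrA IH.
rewrite [RHS](@eq_uint _ (fun u => f u * (1 + \sum_(k < N) 2 * cos (freq k.+1 * (u - y)))
  + (2 * cos (freq N.+1 * y) * (f u * cos (freq N.+1 * u))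
   + 2 * sin (freq N.+1 * y) * (f u * sin (freq N.+1 * u))))); last first.
  by move=> u _; rewrite big_ord_recr/= [freq _ * (u - y)]mulrBr cosB; ring.
have b1 : bmf (fun u => f u * cos (freq N.+1 * u)) by exact: bmfM.
have b2 : bmf (fun u => f u * sin (freq N.+1 * u)) by exact: bmfM.
rewrite uintD; [|exact: bmfM|by apply: bmfD; exact: bmfZ].
rewrite uintD; [|exact: bmfZ|exact: bmfZ].
by rewrite !uintZ// /fcoef_cos /fcoef_sin; ring.
Qed.

Lemma measurable_inv : measurable_fun setT (@GRing.inv R).
Proof.
(* The square makes the base of [powR] nonnegative, where exponent -1 is the inverse; at 0 the outer
   factor gives the value 0 of the inverse. *)
rewrite (_ : @GRing.inv R = (fun x => x * (x ^+ 2) `^ (-1))).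
  apply: measurable_funM => //.
  apply: (@measurableT_comp _ _ _ _ _ _ (fun x => x `^ (-1))).
    exact: measurable_powR.
  exact: exprn_measurable.
apply/funext => x; rewrite powR_inv1 ?sqr_ge0//.
have [->|x0] := eqVneq x 0; first by rewrite invr0 mul0r.
by field.
Qed.

(** The Dirichlet kernel has integral 1, so the error is the integral of (f u - f y) times the
    kernel, which is h u times sin((2N + 1) pi (u - y)). As f is Lipschitz on the circle, h is
    bounded, and the Riemann-Lebesgue lemma applies to the sine and cosine parts. *)
Theorem fourier_cvg f (K : R) : continuous f -> f 0 = f 1 ->
  (forall u v, 0 <= u <= 1 -> 0 <= v <= 1 -> `|f u - f v| <= K * `|u - v|) ->
  forall y, 0 <= y <= 1 -> fourier_sum f N y @[N --> \oo] --> f y.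
Proof.
move=> cf f01 fK y y01; have /andP[y0 y1] := y01.
have K0 : 0 <= K.
  have := fK 0 1; rewrite sub0r normrN normr1 mulr1 !lexx !ler01 => /(_ isT isT).
  exact: le_trans.
have bf := bmf_continuous cf.
(* Where the sine vanishes its inverse is 0; this is consistent, since [fsin] forces f u = f y
   there. *)
pose h u := (f u - f y) * (sin (pi * u + - (pi * y)))^-1.
(* The bound by 1 - |u - y| goes around the circle through the endpoints, where f 0 = f 1. *)
have fmin u : 0 <= u <= 1 -> `|f u - f y| <= K * Num.min `|u - y| (1 - `|u - y|).
  move=> u01; have /andP[u0 u1] := u01.
  rewrite minEle; case: ifP => _; first exact: fK.
  have [uy|uy] := lerP u y.
    have -> : f u - f y = (f u - f 0) + (f 1 - f y) by rewrite f01; ring.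
    rewrite (le_trans (ler_normD _ _))//.
    have := fK u 0 u01; rewrite lexx ler01 => /(_ isT).
    have := fK 1 y; rewrite lexx ler01 y01 => /(_ isT isT).
    rewrite subr0 (ger0_norm u0) (@ger0_norm _ (1 - y)) ?subr_ge0//; lra.
  have -> : f u - f y = (f u - f 1) + (f 0 - f y) by rewrite f01; ring.
  rewrite (le_trans (ler_normD _ _))//.
  have := fK u 1 u01; rewrite lexx ler01 => /(_ isT).
  have := fK 0 y; rewrite lexx ler01 y01 => /(_ isT isT).
  rewrite sub0r normrN (ger0_norm y0) (@ler0_norm _ (u - 1)) ?subr_le0//; lra.
have [c c0 hc] := sinpi_lower.
have uy1 u : 0 <= u <= 1 -> `|u - y| <= 1.
  by move=> /andP[u0 u1]; rewrite ler_norml; apply/andP; split; lra.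
have fsin u : 0 <= u <= 1 -> `|f u - f y| <= K / c * `|sin (pi * u + - (pi * y))|.
  move=> u01; apply: (le_trans (fmin u u01)).
  rewrite -mulrA ler_wpM2l// -mulrBr mulrC ler_pdivlMr// mulrC.
  exact: hc (uy1 _ u01).
have bh : bmf h.
  split.
    apply: measurable_funM.
      apply: measurable_funB => //.
      by apply: measurable_funTS; exact: continuous_measurable_fun.
    apply: measurable_funTS.
    apply: (measurableT_comp measurable_inv).
    by apply: continuous_measurable_fun; exact: continuous_sin_affine.
  exists (K / c) => u; rewrite /= in_itv/= => u01; rewrite /h normrM normfV.
  have [->|s0] := eqVneq (sin (pi * u + - (pi * y))) 0.
    by rewrite normr0 invr0 mulr0 divr_ge0// ltW.
  by rewrite ler_pdivrMr ?normr_gt0// fsin.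
have h1 := coef_cvg0 orthohalf_sin bh.
have h2 := coef_cvg0 orthohalf_cos bh.
have E N : fourier_sum f N y = f y +
   (uint (fun u => h u * sin (half N * u + 0)) * cos (half N * y)
   - uint (fun u => h u * cos (half N * u + 0)) * sin (half N * y)).
  rewrite fourier_sumE//.
  pose Dk u := 1 + \sum_(k < N) 2 * cos (freq k.+1 * (u - y)).
  have cD : bmf Dk.
    apply: bmf_continuous; apply: (@continuous_der _
      (fun u => 0 + \sum_(k < N) 2 * (- sin (freq k.+1 * u + - (freq k.+1 * y)) * freq k.+1))) => u.
    have -> : Dk = fun u => 1 + \sum_(k < N) 2 * cos (freq k.+1 * u + - (freq k.+1 * y)).
      by apply/funext => v; rewrite /Dk; under eq_bigr do rewrite mulrBr.
    apply: (der_add (der_cst 1 u)); apply: der_sum => k.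
    have := der_mul (der_cst 2 u) (der_cos_affine (freq k.+1) (- (freq k.+1 * y)) u).
    by move=> hk; apply: (der_eq hk); ring.
  (* The integral of the kernel is the partial Fourier sum of the constant 1. *)
  have D1 : uint Dk = 1.
    have := @fourier_sumE (fun=> 1) N y (bmf_cst 1).
    rewrite /fourier_sum uint_cst big1.
      by rewrite addr0 => E; apply: etrans (esym E); apply: eq_uint => u _; rewrite mul1r.
    move=> k _; rewrite /fcoef_cos /fcoef_sin.
    rewrite (@eq_uint _ (fun u => cos (freq k.+1 * u + 0))); last first.
      by move=> u _; rewrite mul1r addr0.
    rewrite uint_cos_freq// mulr0 mul0r add0r.
    rewrite (@eq_uint _ (fun u => cos (freq k.+1 * u + - (pi / 2)))); last first.
      by move=> u _; rewrite mul1r cosBpihalf.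
    by rewrite uint_cos_freq// mulr0 mul0r.
  have -> : uint (fun u => f u * Dk u) = f y + uint (fun u => f u * Dk u - f y * Dk u).
    by rewrite uintB; [rewrite uintZ// D1; ring|exact: bmfM|exact: bmfZ].
  congr (_ + _).
  have bs : bmf (fun u => h u * sin (half N * u + 0)).
    by apply: bmfM => //; exact: orthohalf_sin.1.
  have bc : bmf (fun u => h u * cos (half N * u + 0)).
    by apply: bmfM => //; exact: orthohalf_cos.1.
  rewrite [X in X - _]mulrC [X in _ - X]mulrC -!uintZ// -uintB; try exact: bmfZ.
  apply: eq_uint => u u01.
  rewrite -mulrBl.
  have -> : cos (half N * y) * (h u * sin (half N * u + 0)) -
      sin (half N * y) * (h u * cos (half N * u + 0)) =
      h u * sin (half N * (u - y)).
    by rewrite !addr0 [half N * (u - y)]mulrBr sinB; ring.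
  rewrite -dirichlet -/(Dk u) /h.
  rewrite (_ : pi * u + - (pi * y) = pi * (u - y)); last by ring.
  have [s0|s0] := eqVneq (sin (pi * (u - y))) 0; last by field.
  have := fsin u u01; rewrite (_ : pi * u + - (pi * y) = pi * (u - y)); last by ring.
  by rewrite s0 normr0 mulr0 normr_le0 => /eqP ->; rewrite !mul0r.
rewrite (_ : (fun N => _) = (fun N => f y +
   (uint (fun u => h u * sin (half N * u + 0)) * cos (half N * y)
   - uint (fun u => h u * cos (half N * u + 0)) * sin (half N * y)))); last first.
  by apply/funext => N; exact: E.
apply/cvgrPdist_lt => e e0.
have e20 : 0 < e / 2 by rewrite divr_gt0.
move/cvgrPdist_lt : h1 => /(_ _ e20) h1; move/cvgrPdist_lt : h2 => /(_ _ e20) h2.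
near=> N.
have g1 : `|0 - uint (fun u => h u * sin (half N * u + 0))| < e / 2 by near: N.
have g2 : `|0 - uint (fun u => h u * cos (half N * u + 0))| < e / 2 by near: N.
rewrite sub0r normrN in g1; rewrite sub0r normrN in g2.
rewrite opprD addrA subrr sub0r normrN (le_lt_trans (ler_normB _ _))//.
rewrite !normrM (splitr e) ltrD//.
  by apply: le_lt_trans g1; rewrite ler_piMr// cos_max.
by apply: le_lt_trans g2; rewrite ler_piMr// sin_max.
Unshelve. all: by end_near. Qed.

End unit_interval.

(** * The periodic part and its Fourier series *)

Section periodic_part.
Context {R : realType}.
Implicit Types (t u x y c a b : R) (f g h : R -> R).
Local Notation leb := (@lebesgue_measure R).
Local Notation U := (`[0%R, 1%R]%classic : set R).
Local Notation uint g := (\int[leb]_(u in U) g u).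
Local Notation L := (ln 2 : R).

Lemma ln2_gt0 : 0 < L.
Proof. by rewrite ln_gt0// ltr1n. Qed.

Lemma expR_Nln2 : expR (- L) = 2^-1.
Proof. by rewrite expRN lnK// posrE. Qed.

Lemma der_cosk a u : is_derive u (1 : R) (fun u => cos (a * u)) (- sin (a * u) * a).
Proof.
have h : is_derive u (1 : R) (fun u => a * u) a.
  by apply: (der_eq (der_mul (der_cst a u) (der_id u))); ring.
exact: (der_comp (g := fun u => a * u) (is_derive_cos _) h).
Qed.

Lemma der_sink a u : is_derive u (1 : R) (fun u => sin (a * u)) (cos (a * u) * a).
Proof.
have h : is_derive u (1 : R) (fun u => a * u) a.
  by apply: (der_eq (der_mul (der_cst a u) (der_id u))); ring.
exact: (der_comp (g := fun u => a * u) (is_derive_sin _) h).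
Qed.

Lemma der_quad a b c u :
  is_derive u (1 : R) (fun u => a * u ^+ 2 + b * u + c) (2 * a * u + b).
Proof.
have h1 := der_mul (der_cst a u) (der_exprn 1 (der_id u)).
have h2 := der_mul (der_cst b u) (der_id u).
apply: (der_eq (der_add (der_add h1 h2) (der_cst c u))).
by rewrite expr1; ring.
Qed.

(* A trigonometric-quadratic-exponential primitive, with free coefficients. *)
Lemma der_trig_ansatz a b q2 q1 q0 r2 r1 r0 c0 c1 d0 d1 u :
  is_derive u (1 : R)
   (fun u => (q2 * u ^+ 2 + q1 * u + q0) * cos (a * u)
           + (r2 * u ^+ 2 + r1 * u + r0) * sin (a * u)
           + expR (b * u) * ((0 * u ^+ 2 + c1 * u + c0) * cos (a * u)
                           + (0 * u ^+ 2 + d1 * u + d0) * sin (a * u)))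
   ((2 * q2 * u + q1 + a * (r2 * u ^+ 2 + r1 * u + r0)) * cos (a * u)
    + (2 * r2 * u + r1 - a * (q2 * u ^+ 2 + q1 * u + q0)) * sin (a * u)
    + expR (b * u) *
       ((b * (c1 * u + c0) + c1 + a * (d1 * u + d0)) * cos (a * u)
      + (b * (d1 * u + d0) + d1 - a * (c1 * u + c0)) * sin (a * u))).
Proof.
have h1 := der_mul (der_quad q2 q1 q0 u) (der_cosk a u).
have h2 := der_mul (der_quad r2 r1 r0 u) (der_sink a u).
have h3 := der_mul (der_quad 0 c1 c0 u) (der_cosk a u).
have h4 := der_mul (der_quad 0 d1 d0 u) (der_sink a u).
have h5 := der_mul (der_expR_linear b u) (der_add h3 h4).
by apply: (der_eq (der_add (der_add h1 h2) h5)); ring.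
Qed.

Lemma continuous_cosk a : continuous (fun u => cos (a * u)).
Proof. exact: continuous_der (der_cosk a). Qed.

Lemma continuous_sink a : continuous (fun u => sin (a * u)).
Proof. exact: continuous_der (der_sink a). Qed.

(** The Fourier series of u - u^2 at u = 0: the mean is 1/6 and the k-th cosine coefficient is -1 /
    (pi k)^2. *)
Lemma zeta2 : @harm2 R n @[n --> \oo] --> (pi ^+ 2 / 6 : R).
Proof.
pose f u : R := -1 * u ^+ 2 + 1 * u + 0.
have df u : is_derive u (1 : R) f (2 * -1 * u + 1) by exact: der_quad.
have cf : continuous f := continuous_der df.
have bf := bmf_continuous cf.
have fK u v : 0 <= u <= 1 -> 0 <= v <= 1 -> `|f u - f v| <= 1 * `|u - v|.
  move=> /andP[u0 u1] /andP[v0 v1].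
  rewrite (_ : f u - f v = (1 - u - v) * (u - v)); last by rewrite /f; ring.
  by rewrite normrM ler_wpM2r// ler_norml; apply/andP; split; lra.
have f01 : f 0 = f 1 by rewrite /f; ring.
have := fourier_cvg cf f01 fK (y := 0); rewrite lexx ler01 => /(_ isT).
have f0 : f 0 = 0 by rewrite /f; ring.
have If : uint f = 6^-1.
  pose G u : R := -3^-1 * u ^+ 3 + 2^-1 * u ^+ 2.
  transitivity (G 1 - G 0); last by rewrite /G; field.
  apply: uint_FTC => // u.
  have h1 := der_mul (der_cst (-3^-1) u) (der_exprn 2 (der_id u)).
  have h2 := der_mul (der_cst (2^-1) u) (der_exprn 1 (der_id u)).
  by apply: (der_eq (der_add h1 h2)); rewrite /f expr1; field.
have Ifk k : (0 < k)%N -> uint (fun u => f u * cos (freq k * u)) = - 2 / freq k ^+ 2.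
  move=> k0; set a := freq k; have a0 : a != 0 by rewrite gt_eqF// freq_gt0.
  have dG u := der_trig_ansatz a 0 0 (-2 / a ^+ 2) (a ^- 2) (- a^-1) a^-1
    (2 / a ^+ 3) 0 0 0 0 u.
  set G := (X in forall u, is_derive u _ X _) in dG.
  transitivity (G 1 - G 0).
    apply: uint_FTC => [|u].
      by move=> u; apply: continuousM; [exact: cf|exact: continuous_cosk].
    apply: (der_eq (dG u)); rewrite /f.
    by move: (cos _) (sin _) (expR _) => C S E; field.
  rewrite /G !mulr1 !mulr0 sin_freq cos_freq sin0 cos0 expR0.
  by field.
rewrite /fourier_sum f0 If => cv.
have E N : fourier_sum f N 0 = 6^-1 - pi ^- 2 * harm2 N.
  rewrite /fourier_sum If; congr (_ + _).
  rewrite /harm2 mulr_sumr -sumrN; apply: eq_bigr => k _.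
  rewrite mulr0 cos0 sin0 mulr0 addr0 mulr1 /fcoef_cos Ifk// /freq.
  have p0 : pi != 0 :> R by rewrite gt_eqF// pi_gt0.
  have : k.+1%:R != 0 :> R by rewrite pnatr_eq0.
  by move: p0 (k.+1%:R); move: (pi : R) => q q0 b b0; field; rewrite ?b0 ?q0.
have p2 : pi ^+ 2 != 0 :> R by rewrite expf_neq0// gt_eqF// pi_gt0.
have -> : (@harm2 R) = (fun N => pi ^+ 2 * (6^-1 - fourier_sum f N 0)).
  by apply/funext => N; rewrite E opprB addrC subrK mulrA divff// mul1r.
have -> : pi ^+ 2 / 6 = pi ^+ 2 * (6^-1 - 0) :> R by rewrite subr0.
apply: cvgM; first exact: cvg_cst.
apply: cvgB; first exact: cvg_cst.
by rewrite /fourier_sum If; exact: cv.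
Qed.

(** Origin: for n = floor(lg r) and u = lg r - n, the sum over k <= n of 2^k w(r / 2^k) consists of
    arithmetic and geometric sums. Writing n = lg r - u in the former leaves the polynomial part,
    and 2^n = r 2^(-u) in the latter leaves the exponential part. *)
Definition pfun u : R := L * (u - u ^+ 2) + 4 * u - 4
  + 4 * expR (- L * u) * (L * (1 + u) + 2).

Lemma der_pfun u : is_derive u (1 : R) pfun
  (L * (1 - 2 * u) + 4 - 4 * expR (- L * u) * (L ^+ 2 * (1 + u) + L)).
Proof.
have h1 := der_quad (- L) (L + 4) (- 4) u.
have h2 := der_quad 0 (4 * L) (4 * L + 8) u.
have h := der_add h1 (der_mul (der_expR_linear (- L) u) h2).
have -> : pfun = (fun u => - L * u ^+ 2 + (L + 4) * u - 4
   + expR (- L * u) * (0 * u ^+ 2 + 4 * L * u + (4 * L + 8))).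
  by apply/funext => v; rewrite /pfun; ring.
by apply: (der_eq h); ring.
Qed.

Lemma continuous_pfun : continuous pfun.
Proof. exact: continuous_der der_pfun. Qed.

Lemma pfun01 : pfun 0 = pfun 1.
Proof. by rewrite /pfun !mulr0 !mulr1 expR0 expR_Nln2; field. Qed.

Lemma pfun_bound u : 0 <= u <= 1 -> `|pfun u| <= 10 * L + 16.
Proof.
move=> /andP[u0 u1]; have L0 := ln2_gt0.
have e0 := expR_gt0 (- L * u).
have e1 : expR (- L * u) <= 1 by rewrite expR_le1; nra.
rewrite /pfun ler_norml; move: e0 e1; move: (expR _) => e e0 e1.
have u2 : 0 <= u - u ^+ 2 <= 1 by apply/andP; split; nra.
have h1 : 0 <= L * (u - u ^+ 2) <= L.
  by case/andP: u2 => ? ?; rewrite mulr_ge0 ?(ltW L0)//= ler_piMr// ltW.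
have h3 : 0 <= L * (1 + u) + 2 <= 2 * L + 2 by apply/andP; split; nra.
have h2 : 0 <= e * (L * (1 + u) + 2) <= 2 * L + 2.
  case/andP: h3 => x0 x1; rewrite mulr_ge0 ?(ltW e0)//=.
  by apply: le_trans x1; rewrite ler_piMl.
by case/andP: h1 => ? ?; case/andP: h2 => ? ?; apply/andP; split; lra.
Qed.

Lemma pfun_lipschitz : exists K, forall u v, 0 <= u <= 1 -> 0 <= v <= 1 ->
  `|pfun u - pfun v| <= K * `|u - v|.
Proof.
have L0 := ln2_gt0.
exists (L + 4 + 4 * (L ^+ 2 * 2 + L)).
suff H : forall u v, 0 <= u <= 1 -> 0 <= v <= 1 -> v < u ->
    `|pfun u - pfun v| <= (L + 4 + 4 * (L ^+ 2 * 2 + L)) * `|u - v|.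
  move=> u v u01 v01; have [uv|uv|->] := ltgtP u v.
  - by rewrite (distrC (pfun u)) (distrC u); exact: H.
  - exact: H.
  - by rewrite !subrr normr0 mulr0.
move=> u v /andP[u0 u1] /andP[v0 v1] uv.
pose dp x := L * (1 - 2 * x) + 4 - 4 * expR (- L * x) * (L ^+ 2 * (1 + x) + L).
have [|x xv ->] := @MVT R pfun dp v u uv (fun x _ => der_pfun x).
  by apply: continuous_subspaceT; exact: continuous_pfun.
rewrite normrM ler_wpM2r// /dp.
move: xv; rewrite in_itv/= => /andP[vx xu].
have e0 := expR_gt0 (- L * x).
have e1 : expR (- L * x) <= 1 by rewrite expR_le1; nra.
rewrite ler_norml; move: e0 e1; move: (expR _) => e e0 e1.
have h1 : 0 <= e * (L ^+ 2 * (1 + x) + L) <= L ^+ 2 * 2 + L.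
  have l2 : 0 <= L ^+ 2 by exact: sqr_ge0.
  have h0 : 0 <= L ^+ 2 * (1 + x) + L <= L ^+ 2 * 2 + L by apply/andP; split; nra.
  case/andP: h0 => x0 x1; rewrite mulr_ge0 ?(ltW e0)//=.
  by apply: le_trans x1; rewrite ler_piMl.
case/andP: h1 => ? ?.
have h2 : - L <= L * (1 - 2 * x) <= L by apply/andP; split; nra.
case/andP: h2 => ? ?.
by apply/andP; split; nra.
Qed.

(** Equal to (6 - ln 2)^2 / (6 ln 2), the first term of [c2]. *)
Definition pmean : R := 6 / L - 2 + L / 6.
(** With b = a / ln 2, pcos k - i psin k = -4 / (ln 2 b^2 (1 + i b)^2). These are the denominators
    that appear when Gamma(-1 - i b) / (-1 - i b) is reduced to Gamma(1 - i b). *)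
Definition pcos k : R := let a := freq k in
  - 4 * L ^+ 3 * (L ^+ 2 - a ^+ 2) / (a ^+ 2 * (L ^+ 2 + a ^+ 2) ^+ 2).
Definition psin k : R := let a := freq k in
  - 8 * L ^+ 4 / (a * (L ^+ 2 + a ^+ 2) ^+ 2).

Lemma uint_pfun : uint pfun = pmean.
Proof.
have L0 := ln2_gt0.
(* c1 and c0 make exp(-L u) (c1 u + c0) a primitive of the exponential part of [pfun]. The ansatz,
   at frequency 0, covers all but the term -L u^2, whose cubic primitive is added in G. *)
pose c1 := - 4 : R.
pose c0 := (c1 - (4 * L + 8)) / L.
have dG u := der_trig_ansatz 0 (- L) (L / 2 + 2) (-4) 0 0 0 0 c0 c1 0 0 u.
pose G u := - (L / 3) * u ^+ 3 + ((L / 2 + 2) * u ^+ 2 + -4 * u + 0) * cos (0 * u)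
           + (0 * u ^+ 2 + 0 * u + 0) * sin (0 * u)
           + expR (- L * u) * ((0 * u ^+ 2 + c1 * u + c0) * cos (0 * u)
                           + (0 * u ^+ 2 + 0 * u + 0) * sin (0 * u)).
transitivity (G 1 - G 0).
  apply: uint_FTC => [|u]; first exact: continuous_pfun.
  have h := der_add (der_mul (der_cst (- (L / 3)) u) (der_exprn 2 (der_id u))) (dG u).
  have -> : G = (fun t => - (L / 3) * t ^+ 3 + (((L / 2 + 2) * t ^+ 2 + -4 * t + 0) * cos (0 * t)
           + (0 * t ^+ 2 + 0 * t + 0) * sin (0 * t)
           + expR (- L * t) * ((0 * t ^+ 2 + c1 * t + c0) * cos (0 * t)
                           + (0 * t ^+ 2 + 0 * t + 0) * sin (0 * t)))).
    by apply/funext => v; rewrite /G !addrA.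
  apply: (der_eq h); rewrite /pfun /c0 /c1 !mul0r cos0 sin0.
  move: (expR _) => e; field; exact: lt0r_neq0.
rewrite /G /pmean !mul0r cos0 sin0 !mulr1 !mulr0 expR0 expR_Nln2 /c0 /c1.
by field; exact: lt0r_neq0.
Qed.

Lemma fcoef_cos_pfun k : (0 < k)%N -> fcoef_cos pfun k = pcos k.
Proof.
move=> k0; rewrite /fcoef_cos /pcos; set a := freq k.
have a0 : 0 < a by exact: freq_gt0.
have L0 := ln2_gt0.
have D0 : 0 < L ^+ 2 + a ^+ 2 by rewrite addr_gt0// exprn_gt0.
(* The exponential part of [pfun] is exp(-L u) (A + B u). The constants c and d solve the linear
   system that makes the derivative of the ansatz equal to this times cos(a u), with no sine
   part. *)
pose A : R := 4 * L + 8; pose B : R := 4 * L.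
pose c1 := - B * L / (L ^+ 2 + a ^+ 2).
pose d1 := a * B / (L ^+ 2 + a ^+ 2).
pose c0 := (L * c1 + a * d1 - L * A) / (L ^+ 2 + a ^+ 2).
pose d0 := (d1 - a * c0) / L.
have dG u := der_trig_ansatz a (- L) 0 (-2 * L / a ^+ 2) ((L + 4) / a ^+ 2)
  (- L / a) ((L + 4) / a) (- 4 / a + 2 * L / a ^+ 3) c0 c1 d0 d1 u.
set G := (X in forall u, is_derive u _ X _) in dG.
suff -> : uint (fun u => pfun u * cos (a * u)) = G 1 - G 0.
  rewrite /G !mulr1 !mulr0 sin_freq cos_freq sin0 cos0 expR0 expR_Nln2.
  rewrite /d0 /c0 /d1 /c1 /A /B; field.
  by rewrite !lt0r_neq0.
apply: uint_FTC => [u|u].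
  by apply: continuousM; [exact: continuous_pfun|exact: continuous_cosk].
apply: (der_eq (dG u)); rewrite /pfun /d0 /c0 /d1 /c1 /A /B.
move: (cos _) (sin _) (expR _) => C S E; field.
by rewrite !lt0r_neq0.
Qed.

Lemma fcoef_sin_pfun k : (0 < k)%N -> fcoef_sin pfun k = psin k.
Proof.
move=> k0; rewrite /fcoef_sin /psin; set a := freq k.
have a0 : 0 < a by exact: freq_gt0.
have L0 := ln2_gt0.
have D0 : 0 < L ^+ 2 + a ^+ 2 by rewrite addr_gt0// exprn_gt0.
pose A : R := 4 * L + 8; pose B : R := 4 * L.
pose c1 := - a * B / (L ^+ 2 + a ^+ 2).
pose d1 := - L * B / (L ^+ 2 + a ^+ 2).
pose c0 := (L * c1 + a * d1 - a * A) / (L ^+ 2 + a ^+ 2).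
pose d0 := (L * c0 - c1) / a.
have dG u := der_trig_ansatz a (- L) (L / a) (- (L + 4) / a) (4 / a - 2 * L / a ^+ 3)
  0 (-2 * L / a ^+ 2) ((L + 4) / a ^+ 2) c0 c1 d0 d1 u.
set G := (X in forall u, is_derive u _ X _) in dG.
suff -> : uint (fun u => pfun u * sin (a * u)) = G 1 - G 0.
  rewrite /G !mulr1 !mulr0 sin_freq cos_freq sin0 cos0 expR0 expR_Nln2.
  rewrite /d0 /c0 /d1 /c1 /A /B; field.
  by rewrite !lt0r_neq0.
apply: uint_FTC => [u|u].
  by apply: continuousM; [exact: continuous_pfun|exact: continuous_sink].
apply: (der_eq (dG u)); rewrite /pfun /d0 /c0 /d1 /c1 /A /B.
move: (cos _) (sin _) (expR _) => C S E; field.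
by rewrite !lt0r_neq0.
Qed.

Definition pseries (N : nat) y : R := pmean +
  \sum_(k < N) (pcos k.+1 * cos (freq k.+1 * y) + psin k.+1 * sin (freq k.+1 * y)).

Lemma pseries_cvg y : 0 <= y <= 1 -> pseries N y @[N --> \oo] --> pfun y.
Proof.
move=> y01; have [K hK] := pfun_lipschitz.
have := fourier_cvg continuous_pfun pfun01 hK y01.
rewrite /fourier_sum uint_pfun.
rewrite (_ : (fun N => _) = (fun N => pseries N y))//.
apply/funext => N; rewrite /pseries; congr (_ + _).
by apply: eq_bigr => k _; rewrite fcoef_cos_pfun// fcoef_sin_pfun.
Qed.

Lemma ln2_lt1 : L < 1.
Proof.
have : L < ln (expR 1) by rewrite ltr_ln ?posrE ?expR_gt0//; exact: expR_gt1Dx.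
by rewrite expRK.
Qed.

Lemma freq_lower k : 4 * k%:R <= freq k :> R.
Proof. by rewrite /freq ler_wpM2r//; have := @pi_ge2 R; lra. Qed.

(** Inverse squares suffice for a bound of [pseries] uniform in N and y, as dominated convergence
    requires. *)
Lemma pcos_bound k : `|pcos k.+1| <= (k.+1%:R ^+ 2)^-1.
Proof.
rewrite /pcos; set a := freq k.+1; have a0 : 0 < a by exact: freq_gt0.
have L0 := ln2_gt0; have L1 := ln2_lt1; have ka := freq_lower k.+1.
have k0 : 1 <= k.+1%:R :> R by rewrite ler1n.
move: ka k0; rewrite -/a; move: (k.+1%:R) => b ka b1.
have b0 : 0 < b by lra.
have D0 : 0 < L ^+ 2 + a ^+ 2 by rewrite addr_gt0// exprn_gt0.
have L2 : 0 < L ^+ 2 by rewrite exprn_gt0.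
have a2 : 0 < a ^+ 2 by rewrite exprn_gt0.
rewrite normrM normfV ler_pdivrMr ?normr_gt0; last first.
  by rewrite mulf_neq0 ?expf_neq0 ?lt0r_neq0.
rewrite (gtr0_norm (mulr_gt0 a2 (exprn_gt0 2 D0))).
rewrite [_^-1 * _]mulrC ler_pdivlMr ?exprn_gt0//.
have h1 : `|L ^+ 2 - a ^+ 2| <= L ^+ 2 + a ^+ 2.
  by rewrite ler_norml; apply/andP; split; lra.
rewrite (normrM (-4 * L ^+ 3)) (normrM (-4)) (@ler0_norm _ (-4)) ?opprK; last by lra.
rewrite (@gtr0_norm _ (L ^+ 3)) ?exprn_gt0//.
have h2 : L ^+ 3 <= 1 by rewrite exprn_ile1// ltW.
have h3 : 4 * b ^+ 2 <= a ^+ 2 by nra.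
have h4 : 1 <= L ^+ 2 + a ^+ 2 \/ True by right.
have L3 : 0 < L ^+ 3 by rewrite exprn_gt0.
have L32 : L ^+ 3 = L ^+ 2 * L by ring.
have h5 : L ^+ 3 <= L ^+ 2 + a ^+ 2 by nra.
move: h1; move: (`|L ^+ 2 - a ^+ 2|) (normr_ge0 (L ^+ 2 - a ^+ 2)) => w w0 h1.
have h6 : L ^+ 3 * w <= (L ^+ 2 + a ^+ 2) ^+ 2 by rewrite [_ ^+ 2]expr2 ler_pM// ltW.
have h7 : 0 <= L ^+ 3 * w by rewrite mulr_ge0// ltW.
have h8 : 0 < (L ^+ 2 + a ^+ 2) ^+ 2 by rewrite exprn_gt0.
have := ler_pM h7 (ltW (mulr_gt0 (ltr0n _ 4) (exprn_gt0 2 b0))) h6 h3.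
lra.
Qed.

Lemma psin_bound k : `|psin k.+1| <= (k.+1%:R ^+ 2)^-1.
Proof.
rewrite /psin; set a := freq k.+1; have a0 : 0 < a by exact: freq_gt0.
have L0 := ln2_gt0; have L1 := ln2_lt1; have ka := freq_lower k.+1.
have k0 : 1 <= k.+1%:R :> R by rewrite ler1n.
move: ka k0; rewrite -/a; move: (k.+1%:R) => b ka b1.
have b0 : 0 < b by lra.
have D0 : 0 < L ^+ 2 + a ^+ 2 by rewrite addr_gt0// exprn_gt0.
have L2 : 0 < L ^+ 2 by rewrite exprn_gt0.
have a2 : 0 < a ^+ 2 by rewrite exprn_gt0.
rewrite normrM normfV ler_pdivrMr ?normr_gt0; last first.
  by rewrite mulf_neq0 ?expf_neq0 ?lt0r_neq0.
rewrite (gtr0_norm (mulr_gt0 a0 (exprn_gt0 2 D0))).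
rewrite [_^-1 * _]mulrC ler_pdivlMr ?exprn_gt0//.
rewrite (normrM (-8)) (@ler0_norm _ (-8)) ?opprK; last by lra.
rewrite (@gtr0_norm _ (L ^+ 4)) ?exprn_gt0//.
have h1 : 2 * L * a <= L ^+ 2 + a ^+ 2 by nra.
have h2 : 0 <= 2 * L * a := mulr_ge0 (mulr_ge0 (ler0n _ 2) (ltW L0)) (ltW a0).
have h3 : (2 * L * a) ^+ 2 <= (L ^+ 2 + a ^+ 2) ^+ 2 by rewrite lerXn2r ?nnegrE// ltW.
have h4 : 4 * b ^+ 2 <= a ^+ 2 by nra.
have h5 : L ^+ 4 <= L ^+ 2 * 1.
  rewrite (_ : L ^+ 4 = L ^+ 2 * L ^+ 2); last by ring.
  by rewrite ler_wpM2l ?(ltW L2)// exprn_ile1// ltW.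
have a1 : 4 <= a by lra.
have h6 : (2 * L * a) ^+ 2 = 4 * (L ^+ 2 * a ^+ 2) by ring.
have h7 : 0 < L ^+ 2 * a ^+ 2 by rewrite mulr_gt0.
have h8 : 8 * L ^+ 4 * b ^+ 2 <= 8 * L ^+ 2 * b ^+ 2.
  by rewrite ler_pM2r ?exprn_gt0// ler_pM2l// -[leRHS]mulr1.
have h9 : 8 * L ^+ 2 * b ^+ 2 <= 2 * (L ^+ 2 * a ^+ 2).
  rewrite (_ : 8 * L ^+ 2 * b ^+ 2 = 2 * (L ^+ 2 * (4 * b ^+ 2))); last by ring.
  by rewrite ler_pM2l// ler_pM2l.
have h10 : 4 * (4 * (L ^+ 2 * a ^+ 2)) <= a * (L ^+ 2 + a ^+ 2) ^+ 2.
  by rewrite h6 in h3; apply: ler_pM => //; exact: mulr_ge0 (ler0n _ 4) (ltW h7).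
lra.
Qed.

End periodic_part.

(** * Poisson averages of Quicksort costs *)

Section quicksort_transform.
Context {R : realType}.
Implicit Types (t u x y r m : R).
Local Notation leb := (@lebesgue_measure R).
Local Notation D := (`]0%R, +oo[%classic : set R).
Local Notation L := (ln 2 : R).

Definition frac y : R := y - (Num.floor y)%:~R.

Lemma frac_itv y : 0 <= frac y < 1.
Proof.
by rewrite /frac subr_ge0 ge_floor /= ltrBlDr addrC -intrD1 lt_succ_floor.
Qed.

Lemma frac_subn1 y : frac (y - 1) = frac y.
Proof.
rewrite /frac; suff -> : Num.floor (y - 1) = Num.floor y - 1 :> int.
  by rewrite intrB; ring.
apply: floor_def; rewrite subrK intrB.
have := ge_floor y; have := lt_succ_floor y; rewrite intrD1.
by move=> h1 h2; apply/andP; split; lra.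
Qed.

Definition wq r : R := if 1 <= r then 2 * (r + 1) * ln r - 4 * (r - 1) else 0.

Definition Vmain r : R := r * (L * lg r ^+ 2 + (L - 4) * lg r + pfun (frac (lg r))).

(* The closed form of the sum over k of 2^k [wq (r / 2^k)]; [Vq_rec] and its
   vanishing below 1 characterize it. *)
Definition Vq r : R :=
  if 1 <= r then Vmain r - 2 * ln r - 4 * L - 4 else 0.

Lemma lg_half r : 0 < r -> lg (r / 2) = lg r - 1.
Proof.
move=> r0; rewrite /lg ln_div ?posrE// mulrBl divff//.
by rewrite gt_eqF// ln2_gt0.
Qed.

Lemma lgE r : ln r = L * lg r.
Proof. by rewrite /lg mulrC divfK// gt_eqF// ln2_gt0. Qed.

(** For r >= 2, halving keeps the fractional part of lg r, and a polynomial identity in lg r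
    remains. For 1 <= r < 2 the claim is Vq = wq: there frac (lg r) = lg r and 2^(- lg r) = 1 /
    r. *)
Lemma Vq_rec r : 0 < r -> Vq r = wq r + 2 * Vq (r / 2).
Proof.
move=> r0; have L0 := @ln2_gt0 R.
have [r1|r1] := ltP r 1.
  rewrite /Vq /wq !leNgt r1 /=.
  have -> : r / 2 < 1 by lra.
  by rewrite /= mulr0 addr0.
have [r2|r2] := ltP r 2.
  rewrite {2}/Vq /wq r1 leNgt.
  have -> : r / 2 < 1 by lra.
  rewrite /= mulr0 addr0 /Vq r1 /Vmain.
  have -> : frac (lg r) = lg r.
    rewrite /frac; suff -> : Num.floor (lg r) = 0 by rewrite subr0.
    apply: floor_def; rewrite /lg divr_ge0 ?(ltW L0) ?ln_ge0//=.
    by rewrite add0r ltr_pdivrMr// mul1r ltr_ln ?posrE.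
  have e : expR (- L * lg r) = r^-1.
    by rewrite mulNr -lgE expRN lnK.
  rewrite /pfun e (lgE r); field; exact: lt0r_neq0.
have r21 : 1 <= r / 2 by lra.
rewrite /Vq /wq r1 r21 /Vmain lg_half// frac_subn1 (lgE (r / 2)) (lgE r) lg_half//.
by field.
Qed.

Lemma Vq_sum n r : 0 < r ->
  Vq r = \sum_(k < n) 2 ^+ k * wq (r / 2 ^+ k) + 2 ^+ n * Vq (r / 2 ^+ n).
Proof.
move=> r0; elim: n => [|n IH]; first by rewrite big_ord0 expr0 divr1; ring.
rewrite IH big_ord_recr/= -addrA; congr (_ + _).
rewrite {1}Vq_rec ?divr_gt0 ?exprn_gt0//.
rewrite -mulrA -invfM -exprSr exprS; ring.
Qed.

Lemma Vq_fin n r : 0 < r -> r < 2 ^+ n ->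
  Vq r = \sum_(k < n) 2 ^+ k * wq (r / 2 ^+ k).
Proof.
move=> r0 rn; rewrite (Vq_sum n r0) [Vq (_ / _)]/Vq leNgt.
by rewrite ltr_pdivrMr ?exprn_gt0// mul1r rn mulr0 addr0.
Qed.

(** By the mean value theorem for g = w / 2, which vanishes at 1 and has derivative ln x + 1/x - 1
    >= 0. Nonnegativity is what permits the later exchanges of sums and integrals. *)
Lemma wq_ge0 r : 0 <= wq r.
Proof.
rewrite /wq; case: ifPn => // r1.
pose g x := (x + 1) * ln x - 2 * (x - 1).
suff : 0 <= g r by rewrite /g; lra.
have g1 : g 1 = 0 by rewrite /g ln1; ring.
have [<-|rn1] := eqVneq 1 r; first by rewrite g1.
have lt1r : 1 < r by rewrite lt_neqAle rn1.
have dg x : 0 < x -> is_derive x (1 : R) g (ln x + x^-1 - 1).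
  move=> x0.
  have h1 := der_mul (der_add (der_id x) (der_cst 1 x)) (der_ln x0).
  have h2 := der_mul (der_cst 2 x) (der_sub (der_id x) (der_cst 1 x)).
  by apply: (der_eq (der_sub h1 h2)); field; exact: lt0r_neq0.
have dg' x : x \in `]1, r[ -> is_derive x (1 : R) g (ln x + x^-1 - 1).
  by rewrite in_itv/= => /andP[x1 _]; apply: dg; lra.
have cg : {within `[1, r], continuous g}.
  apply: continuous_in_subspaceT => x; rewrite inE/= in_itv/= => /andP[x1 _].
  have x0 : 0 < x by lra.
  exact: (der_continuous (dg x x0)).
have [x xr gx] := MVT lt1r dg' cg.
have -> : g r = (ln x + x^-1 - 1) * (r - 1) by rewrite -gx g1 subr0.
rewrite mulr_ge0//; last by lra.
move: xr; rewrite in_itv/= => /andP[x1 _].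
have x0 : 0 < x by lra.
have xV : 0 < x^-1 by rewrite invr_gt0.
have h : -1 < x^-1 - 1 by lra.
have := le_ln1Dx h; rewrite addrCA subrr addr0 lnV ?posrE//; lra.
Qed.

Lemma measurable_wq : measurable_fun setT wq.
Proof.
apply: measurable_fun_ifT => //.
- by apply: measurable_fun_ler.
- apply: measurable_funB; last first.
    by apply: measurable_funM => //; exact: measurable_funB.
  apply: measurable_funM; last exact: measurable_ln.
  by apply: measurable_funM => //; exact: measurable_funD.
Qed.

Definition qcmp (n : nat) : R := 2 * n.+1%:R * harm n - 4 * n%:R.

Lemma ge0_Rintegral_itv (m : R) (f : R -> R) (v : R) : measurable_fun setT f ->
  (forall t, 0 < t <= m -> 0 <= f t) ->
  (\int[leb]_(t in `]0%R, m]) (f t)%:E = v%:E)%E ->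
  leb.-integrable `]0%R, m] (EFin \o f) /\ \int[leb]_(t in `]0%R, m]) f t = v.
Proof.
move=> mf f0 fv; split; last by rewrite /Rintegral fv.
apply/integrableP; split.
  by apply/measurable_EFinP; exact: measurable_funTS.
under eq_integral => t tn.
  rewrite gee0_abs; last first.
    by rewrite lee_fin f0//; move: tn; rewrite inE/= in_itv.
  over.
by rewrite /= fv ltry.
Qed.

Lemma mIoc (m : R) : measurable (`]0%R, m]%classic :
  set (g_sigma_algebraType (R.-ocitv.-measurable))).
Proof. exact: measurable_itv. Qed.

Let mfdiv m : measurable_fun setT (fun t => t / m).
Proof. exact: mulrr_measurable. Qed.

Let mfX m j : measurable_fun setT (fun t => (1 - t / m) ^+ j).
Proof. by apply: measurable_funX; apply: measurable_funB. Qed.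

Let mfln m : measurable_fun setT (fun t => ln (t / m)).
Proof. by apply: (measurableT_comp (@measurable_ln R)). Qed.

Let I0 m j : 0 < m ->
  leb.-integrable `]0%R, m] (EFin \o (fun t => (1 - t / m) ^+ j)) /\
  \int[leb]_(t in `]0%R, m]) (1 - t / m) ^+ j = m / j.+1%:R.
Proof.
move=> m0; apply: ge0_Rintegral_itv => //; last exact: integral_onem.
by move=> t /andP[t0 tm]; rewrite exprn_ge0// subr_ge0 ler_pdivrMr// mul1r.
Qed.

Let I1 m j : 0 < m ->
  leb.-integrable `]0%R, m] (EFin \o (fun t => (1 - t / m) ^+ j * - ln (t / m))) /\
  \int[leb]_(t in `]0%R, m]) ((1 - t / m) ^+ j * - ln (t / m)) =
    m * (harm j.+1 / j.+1%:R).
Proof.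
move=> m0; apply: ge0_Rintegral_itv => //; last exact: integral_onem_ln.
  by apply: measurable_funM => //; apply: measurableT_comp => //; exact: mfln.
move=> t /andP[t0 tm]; rewrite mulr_ge0 ?exprn_ge0//.
  by rewrite subr_ge0 ler_pdivrMr// mul1r.
by rewrite oppr_ge0 ln_le0// ler_pdivrMr// mul1r.
Qed.

Lemma twqE m t : 0 < t -> t <= m ->
  t * wq (m / t) = 2 * (m + t) * - ln (t / m) - 4 * (m - t).
Proof.
move=> t0 tm; have m0 := lt_le_trans t0 tm.
rewrite /wq ler_pdivlMr// mul1r tm -(invrK (m / t)) invf_div lnV ?posrE ?divr_gt0//.
by field; rewrite !lt0r_neq0.
Qed.

Lemma twq_eq0 m t : 0 < t -> m < t -> t * wq (m / t) = 0.
Proof.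
by move=> t0 mt; rewrite /wq ler_pdivlMr// mul1r leNgt mt mulr0.
Qed.

Lemma measurable_twq m : measurable_fun setT (fun t => t * wq (m / t)).
Proof.
apply: measurable_funM => //; apply: (measurableT_comp measurable_wq).
by apply: measurable_funM => //; exact: measurable_inv.
Qed.

(** These moments explain the choice of w. On the interval, t w(m / t) = -2 (m + t) ln (t / m) - 4
    (m - t); writing 2 (m + t) = 4 m - 2 (m - t) reduces everything to integrals of powers of 1 - t
    / m, with or without a logarithm. *)
Lemma integral_twq m j : 0 < m ->
  (\int[leb]_(t in `]0%R, m]) ((m - t) ^+ j * (t * wq (m / t)))%:E =
  (qcmp j.+2 * m ^+ j.+2 / (j.+1%:R * j.+2%:R))%:E)%E.
Proof.
move=> m0.
have [i1 v1] := I1 j m0; have [i2 v2] := I1 j.+1 m0; have [i3 v3] := I0 j.+1 m0.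
pose g t := m ^+ j.+1 * (4 * ((1 - t / m) ^+ j * - ln (t / m)) -
   (2 * ((1 - t / m) ^+ j.+1 * - ln (t / m)) + 4 * (1 - t / m) ^+ j.+1)).
have fg t : `]0%R, m]%classic t -> (m - t) ^+ j * (t * wq (m / t)) = g t.
  rewrite /= in_itv/= => /andP[t0 tm]; rewrite twqE// /g !exprS.
  have -> : (m - t) ^+ j = m ^+ j * (1 - t / m) ^+ j.
    by rewrite -exprMn; congr (_ ^+ _); field; exact: lt0r_neq0.
  by field; exact: lt0r_neq0.
have mI := mIoc m.
have z1 := integrableZl mI 4 i1; have z2 := integrableZl mI 2 i2.
have z3 := integrableZl mI 4 i3.
have z23 := integrableD mI z2 z3.
have z := integrableB mI z1 z23.
have ig := integrableZl mI (m ^+ j.+1) z.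
transitivity (\int[leb]_(t in `]0%R, m]) (g t)%:E)%E.
  by apply: eq_integral => t; rewrite inE => /fg ->.
rewrite -[LHS]fineK; last exact: integrable_fin_num.
congr EFin.
rewrite -/(Rintegral leb `]0%R, m] g) /g RintegralZl// RintegralB//.
rewrite RintegralZl// RintegralD// !RintegralZl// v1 v2 v3 /qcmp !harmS.
have n1 : j.+1%:R != 0 :> R by rewrite pnatr_eq0.
have n2 : j.+2%:R != 0 :> R by rewrite pnatr_eq0.
have e2 : j.+2%:R = j.+1%:R + 1 :> R by rewrite natr1.
have e3 : j.+3%:R = j.+1%:R + 2 :> R by rewrite -(natr1 j.+2) -(natr1 j.+1); ring.
have -> : m ^+ j.+2 = m ^+ j.+1 * m by rewrite exprSr.
move: n1 n2 e2 e3.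
move: (j.+1%:R : R) (j.+2%:R : R) (j.+3%:R : R) (harm j) (m ^+ j.+1) => a b c h M.
by move=> a0 b0 eb ec; rewrite ec eb; field; rewrite -eb a0 b0.
Qed.

(** From n = 2 on, the value is a positive multiple of the moment at m = 1, whose integrand is
    nonnegative. *)
Lemma qcmp_ge0 n : 0 <= qcmp n.
Proof.
case: n => [|[|j]].
- by rewrite /qcmp /harm big_ord0 !mulr0 subr0.
- by rewrite /qcmp /harm big_ord1 invr1; lra.
have e := integral_twq j (@ltr01 R).
have : (0 <= \int[leb]_(t in `]0%R, 1%R]) ((1 - t) ^+ j * (t * wq (1 / t)))%:E)%E.
  apply: integral_ge0 => t /=; rewrite in_itv/= => /andP[t0 t1].
  by rewrite lee_fin !mulr_ge0 ?exprn_ge0 ?subr_ge0 ?(ltW t0)// wq_ge0.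
rewrite e lee_fin expr1n mulr1 => h.
by move: h; rewrite pmulr_lge0// invr_gt0 mulr_gt0.
Qed.

Lemma exp_eseries x : 0 <= x -> (\sum_(j <oo) (x ^+ j / j`!%:R)%:E = (expR x)%:E)%E.
Proof.
move=> x0; apply/cvg_lim => //.
have := is_cvg_series_exp_coeff x; rewrite /expR => c.
rewrite (_ : (fun n => _) = EFin \o series (exp_coeff x)).
  by apply: cvg_EFin => //; exact: nearW.
by apply/funext => n /=; rewrite seriesEnat/= sumEFin.
Qed.

(** The terms n = 0, 1 vanish. For n = j + 2 the moment identity applies, with (j + 1)(j + 2) j! =
    (j + 2)!, and summing exp(-m) (m - t)^j / j! under the integral gives exp(-t). Beyond m the
    kernel is 0. *)
Lemma poisson_qcmp m : 0 < m ->
  (\sum_(n <oo) (poisson_pmf m n * qcmp n)%:E =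
   \int[leb]_(t in D) (expR (- t) * (t * wq (m / t)))%:E)%E.
Proof.
move=> m0.
have q0 : qcmp 0 = 0 by rewrite /qcmp /harm big_ord0; ring.
have q1 : qcmp 1 = 0 by rewrite /qcmp /harm big_ord1 invr1; ring.
have pq0 n : (0 <= (poisson_pmf m n * qcmp n)%:E)%E.
  by rewrite lee_fin mulr_ge0 ?poisson_pmf_ge0 ?qcmp_ge0.
rewrite (@nneseries_split _ _ 0 2)// add0n big_mkord big_ord_recr big_ord1/=.
rewrite q0 q1 !mulr0 !add0e -nneseries_addn//.
transitivity (\sum_(j <oo) \int[leb]_(t in `]0%R, m])
    (expR (- m) / j`!%:R * ((m - t) ^+ j * (t * wq (m / t))))%:E)%E.
  apply: eq_eseriesr => j _.
  under eq_integral do rewrite EFinM.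
  rewrite ge0_integralZl_EFin; last 4 first.
  - exact: mIoc.
  - move=> t /=; rewrite in_itv/= => /andP[t0 tm].
    by rewrite lee_fin !mulr_ge0 ?exprn_ge0 ?subr_ge0 ?(ltW t0)// wq_ge0.
  - apply: measurable_funTS; apply/measurable_EFinP; apply: measurable_funM.
      by apply: measurable_funX; exact: measurable_funB.
    exact: measurable_twq.
  - by rewrite divr_ge0 ?expR_ge0.
  rewrite integral_twq// -EFinM addn2 /poisson_pmf m0; congr EFin.
  have f0 : j`!%:R != 0 :> R by rewrite pnatr_eq0 -lt0n fact_gt0.
  have n1 : j.+1%:R != 0 :> R by rewrite pnatr_eq0.
  have n2 : j.+2%:R != 0 :> R by rewrite pnatr_eq0.
  rewrite !factS !natrM; move: f0 n1 n2.
  move: (j`!%:R) (j.+1%:R) (j.+2%:R) (qcmp _) (m ^+ _) (expR _) => a b c q M E.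
  by move=> a0 b0 c0; field; rewrite a0 b0 c0.
rewrite -integral_nneseries//; last 2 first.
- move=> j; apply: measurable_funTS; apply/measurable_EFinP; apply: measurable_funM => //.
  apply: measurable_funM.
    by apply: measurable_funX; exact: measurable_funB.
  exact: measurable_twq.
- move=> j t /=; rewrite in_itv/= => /andP[t0 tm].
  rewrite lee_fin mulr_ge0 ?divr_ge0 ?expR_ge0//.
  by rewrite !mulr_ge0 ?exprn_ge0 ?subr_ge0 ?(ltW t0)// wq_ge0.
transitivity (\int[leb]_(t in `]0%R, m]) (expR (- t) * (t * wq (m / t)))%:E)%E.
  apply: eq_integral => t; rewrite inE/= in_itv/= => /andP[t0 tm].
  transitivity (\sum_(j <oo) (expR (- m) * (t * wq (m / t)))%:E *
     ((m - t) ^+ j / j`!%:R)%:E)%E.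
    by apply: eq_eseriesr => j _; rewrite -EFinM; congr EFin; ring.
  rewrite nneseriesZl; last first.
    by move=> j _; rewrite lee_fin divr_ge0// exprn_ge0// subr_ge0.
  rewrite exp_eseries ?subr_ge0// -EFinM; congr EFin.
  by rewrite expRD expRN; field; rewrite gt_eqF// expR_gt0.
rewrite [RHS]integral_mkcond [LHS]integral_mkcond; apply: eq_integral => t _.
rewrite !patchE !mem_setE !in_itv/= andbT.
have [t0|t0]//= := ltP 0 t.
by have [tm|tm]//= := leP t m; rewrite twq_eq0// mulr0.
Qed.

Lemma twq_series (l t : R) : 0 < l -> 0 < t ->
  (\sum_(k <oo) (2 ^+ k * (t * wq (l / 2 ^+ k / t)))%:E = (t * Vq (l / t))%:E)%E.
Proof.
move=> l0 t0.
have r0 : 0 < l / t by rewrite divr_gt0.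
have [n hn] : exists n, l / t < 2 ^+ n.
  exists (Num.bound (l / t)).
  have h := archi_boundP (ltW r0); apply: (lt_le_trans h).
  by rewrite -natrX ler_nat ltnW// ltn_expl.
rewrite (@nneseries_split _ _ 0 n); last first.
  move=> k _; rewrite lee_fin !mulr_ge0 ?exprn_ge0 ?(ltW t0)//; exact: wq_ge0.
rewrite add0n big_mkord eseries0 ?adde0; last first.
  move=> k nk _; rewrite /wq leNgt.
  have -> : l / 2 ^+ k / t < 1.
    rewrite mulrAC ltr_pdivrMr ?exprn_gt0// mul1r (lt_le_trans hn)//.
    by rewrite ler_weXn2l//; lra.
  by rewrite !mulr0.
rewrite sumEFin (Vq_fin r0 hn) mulr_sumr; congr EFin; apply: eq_bigr => k _.
by rewrite mulrCA; congr (_ * (_ * wq _)); rewrite mulrAC.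
Qed.

Lemma poisson_qcmp_series (l : R) : 0 < l ->
  (\sum_(k <oo) ((2 ^+ k)%:E *
      \sum_(n <oo) (poisson_pmf (l / 2 ^+ k) n * qcmp n)%:E) =
   \int[leb]_(t in D) (expR (- t) * (t * Vq (l / t)))%:E)%E.
Proof.
move=> l0.
transitivity (\sum_(k <oo) \int[leb]_(t in D)
   (2 ^+ k * (expR (- t) * (t * wq (l / 2 ^+ k / t))))%:E)%E.
  apply: eq_eseriesr => k _; rewrite poisson_qcmp ?divr_gt0 ?exprn_gt0//.
  under [RHS]eq_integral do rewrite EFinM.
  rewrite ge0_integralZl_EFin; first by [].
  - exact: mD.
  - move=> t /=; rewrite in_itv/= andbT => t0.
    by rewrite lee_fin !mulr_ge0 ?expR_ge0 ?(ltW t0) ?wq_ge0.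
  - by apply: measurable_eweight; apply: measurable_funTS; exact: measurable_twq.
  - by rewrite exprn_ge0.
rewrite -integral_nneseries//; last 2 first.
- move=> k; apply/measurable_EFinP; apply: measurable_funM => //.
  apply: measurable_funM; first exact: measurable_expRN.
  by apply: measurable_funTS; exact: measurable_twq.
- move=> k t /=; rewrite in_itv/= andbT => t0.
  by rewrite lee_fin !mulr_ge0 ?expR_ge0 ?(ltW t0) ?wq_ge0 ?exprn_ge0.
apply: eq_integral => t; rewrite inE/= in_itv/= andbT => t0.
rewrite EFinM -twq_series// -nneseriesZl; last first.
  by move=> k _; rewrite lee_fin !mulr_ge0 ?exprn_ge0 ?(ltW t0)//; exact: wq_ge0.
by apply: eq_eseriesr => k _; rewrite -EFinM; congr EFin; ring.
Qed.

(** Measurability is inherited from the series of [wq], which avoids treating the floor function in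
    [Vq]. *)
Lemma measurable_tVq (l : R) : 0 < l ->
  measurable_fun D (fun t => t * Vq (l / t)).
Proof.
move=> l0; apply/measurable_EFinP.
apply: (@eq_measurable_fun _ _ _ _ _ (fun t =>
    \sum_(k <oo) (2 ^+ k * (t * wq (l / 2 ^+ k / t)))%:E)%E).
  by move=> t; rewrite inE/= in_itv/= andbT => t0; rewrite twq_series.
apply: ge0_emeasurable_sum.
  move=> k t /=; rewrite in_itv/= andbT => t0 _.
  by rewrite lee_fin !mulr_ge0 ?exprn_ge0 ?(ltW t0)//; exact: wq_ge0.
move=> k _; apply/measurable_EFinP; apply: measurable_funM => //.
by apply: measurable_funTS; exact: measurable_twq.
Qed.

End quicksort_transform.

(** * Asymptotics of the integral *)

Section asymptotics.
Context {R : realType}.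
Implicit Types (t u x y r l : R).
Local Notation leb := (@lebesgue_measure R).
Local Notation D := (`]0%R, +oo[%classic : set R).
Local Notation L := (ln 2 : R).

Lemma eint_bounded_cvg (f_ : nat -> R -> R) (f : R -> R) (c : R) :
  (forall n, measurable_fun D (f_ n)) ->
  (forall n t, 0 < t -> `|f_ n t| <= c) ->
  (forall t, 0 < t -> f_ n t @[n --> \oo] --> f t) ->
  measurable_fun D f /\ eint (f_ n) @[n --> \oo] --> eint f.
Proof.
move=> mf_ fc ff.
have mf : measurable_fun D f.
  apply: (measurable_fun_cvg mf_) => t /=; rewrite in_itv/= andbT; exact: ff.
split => //.
suff [i _ cv] : [/\ leb.-integrable D (fun t => (expR (- t) * f t)%:E),
    [sequence \int[leb]_(t in D) `|(expR (- t) * f_ n t)%:E - (expR (- t) * f t)%:E|]_n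
      @ \oo --> 0 &
    [sequence \int[leb]_(t in D) (expR (- t) * f_ n t)%:E]_n @ \oo -->
      \int[leb]_(t in D) (expR (- t) * f t)%:E]%E.
  rewrite /eint /Rintegral; apply: fine_cvg; rewrite fineK; first exact: cv.
  by apply: integrable_fin_num => //; exact: mD.
apply: (@dominated_convergence _ _ R leb D mD _ _
  (fun t => (expR (- t) * c)%:E)) => //.
- by move=> n; exact: measurable_eweight.
- exact: measurable_eweight.
- apply/aeW => t /=; rewrite in_itv/= andbT => t0.
  apply: cvg_EFin; first exact: nearW.
  by apply: cvgM; [exact: cvg_cst|exact: ff].
- exact: eintegrable_cst.
- apply/aeW => t n /=; rewrite in_itv/= andbT => t0.
  by rewrite lee_fin normrM ger0_norm ?expR_ge0// ler_wpM2l ?expR_ge0// fc.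
Qed.

Lemma freqM k n : freq k * n%:R = freq (k * n) :> R.
Proof. by rewrite /freq natrM mulrA. Qed.

Lemma cosDfreqz k (z : int) y : cos (y + freq k * z%:~R) = cos y.
Proof.
case: z => n; first by rewrite -pmulrn freqM addrC cos_freqD.
rewrite NegzE mulrNz -pmulrn mulrN freqM.
by rewrite -[in RHS](subrK (freq (k * n.+1)) y) [in RHS]addrC cos_freqD.
Qed.

Lemma sinDfreqz k (z : int) y : sin (y + freq k * z%:~R) = sin y.
Proof.
case: z => n; first by rewrite -pmulrn freqM addrC sin_freqD.
rewrite NegzE mulrNz -pmulrn mulrN freqM.
by rewrite -[in RHS](subrK (freq (k * n.+1)) y) [in RHS]addrC sin_freqD.
Qed.

Lemma pseries_frac N y : pseries N (frac y) = pseries N y.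
Proof.
rewrite /pseries; congr (_ + _); apply: eq_bigr => k _.
rewrite -(cosDfreqz k.+1 (Num.floor y) (freq k.+1 * frac y)).
rewrite -(sinDfreqz k.+1 (Num.floor y) (freq k.+1 * frac y)).
by rewrite -mulrDr /frac subrK.
Qed.

Lemma pseries_cvg_frac y : pseries N y @[N --> \oo] --> pfun (frac y).
Proof.
under eq_fun do rewrite -pseries_frac.
by apply: pseries_cvg; have /andP[-> /ltW ->] := frac_itv y.
Qed.

Lemma harm2_le2 n : @harm2 R n <= 2.
Proof.
suff : @harm2 R n.+1 <= 2 - n.+1%:R^-1.
  rewrite harm2S => h; have : 0 <= (n.+1%:R ^+ 2)^-1 :> R by rewrite invr_ge0 exprn_ge0.
  have : 0 <= n.+1%:R^-1 :> R by rewrite invr_ge0.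
  move: h; move: (_^-1) (harm2 n) (_^-1) => a b c; lra.
elim: n => [|n IH].
  by rewrite /harm2 big_ord1 expr1n invr1; lra.
rewrite harm2S.
suff X : n.+1%:R^-1 - n.+2%:R^-1 >= (n.+2%:R ^+ 2)^-1 :> R.
  by apply: (le_trans (lerD IH X)); rewrite addrA subrK.
have n1 : 0 < n.+1%:R :> R by rewrite ltr0n.
have -> : n.+2%:R = n.+1%:R + 1 :> R by rewrite natr1.
move: (n.+1%:R : R) n1 => a a0.
have -> : a^-1 - (a + 1)^-1 = (a * (a + 1))^-1.
  by field; apply/andP; split; apply: lt0r_neq0; lra.
have p1 : 0 < a * (a + 1) by nra.
have p2 : 0 < (a + 1) ^+ 2 by rewrite exprn_gt0//; lra.
by rewrite lef_pV2 ?posrE//; nra.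
Qed.

Lemma pseries_bound N y : `|pseries N y| <= `|@pmean R| + 4.
Proof.
rewrite (le_trans (ler_normD _ _))// lerD2l.
rewrite (le_trans (ler_norm_sum _ _ _))//.
apply: (@le_trans _ _ (2 * harm2 N)); last by have := harm2_le2 N; lra.
rewrite /harm2 mulr_sumr; apply: ler_sum => k _.
rewrite (le_trans (ler_normD _ _))// (normrM (pcos _)) (normrM (psin _)).
  rewrite [leRHS]mulr_natl mulr2n lerD//.
  by apply: le_trans (pcos_bound k); rewrite ler_piMr// cos_max.
by apply: le_trans (psin_bound k); rewrite ler_piMr// sin_max.
Qed.

(** This is beta times k, and gcos k - i gsin k is Gamma(1 - i beta k). *)
Definition bfreq k : R := freq k / L.
Definition gcos k : R := eint (fun t => cos (bfreq k * ln t)).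
Definition gsin k : R := eint (fun t => sin (bfreq k * ln t)).

Lemma eintegrable_cos a : eintegrable (fun t => cos (a * ln t)).
Proof.
apply: (@eintegrable_bounded _ _ 1); last by move=> t _; rewrite cos_max.
apply: measurable_funTS.
apply: (@measurableT_comp _ _ _ _ _ _ (fun u => cos (a * u)) _ (@ln R)).
  by apply: continuous_measurable_fun; exact: continuous_cosk.
exact: measurable_ln.
Qed.

Lemma eintegrable_sin a : eintegrable (fun t => sin (a * ln t)).
Proof.
apply: (@eintegrable_bounded _ _ 1); last by move=> t _; rewrite sin_max.
apply: measurable_funTS.
apply: (@measurableT_comp _ _ _ _ _ _ (fun u => sin (a * u)) _ (@ln R)).
  by apply: continuous_measurable_fun; exact: continuous_sink.
exact: measurable_ln.
Qed.

(* The sum of the terms of [pi_] at k and - k, which is real *)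
Definition pi_real_term l k : R :=
  pcos k * (cos (bfreq k * ln l) * gcos k + sin (bfreq k * ln l) * gsin k)
+ psin k * (sin (bfreq k * ln l) * gcos k - cos (bfreq k * ln l) * gsin k).

Lemma lg_div l t : 0 < l -> 0 < t -> lg (l / t) = (ln l - ln t) / L.
Proof. by move=> l0 t0; rewrite /lg ln_div. Qed.

Lemma eint_pseries l N : 0 < l ->
  eintegrable (fun t => pseries N ((ln l - ln t) / L)) /\
  eint (fun t => pseries N ((ln l - ln t) / L)) =
  pmean + \sum_(k < N) pi_real_term l k.+1.
Proof.
move=> l0; elim: N => [|N [IHi IH]].
  have -> : (fun t => pseries 0 ((ln l - ln t) / L)) = (fun=> pmean * 1).
    by apply/funext => t; rewrite /pseries big_ord0 addr0 mulr1.
  split; first exact: eintegrable_cst.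
  by rewrite big_ord0 eintZ ?eint1 ?addr0 ?mulr1//; exact: eintegrable1.
have ic := eintegrable_cos (bfreq N.+1); have js := eintegrable_sin (bfreq N.+1).
pose A := pcos N.+1 * cos (bfreq N.+1 * ln l) + psin N.+1 * sin (bfreq N.+1 * ln l).
pose B := pcos N.+1 * sin (bfreq N.+1 * ln l) - psin N.+1 * cos (bfreq N.+1 * ln l).
have E t : pseries N.+1 ((ln l - ln t) / L) = pseries N ((ln l - ln t) / L) +
   (A * cos (bfreq N.+1 * ln t) + B * sin (bfreq N.+1 * ln t)).
  rewrite /pseries big_ord_recr/= -!addrA; congr (_ + (_ + _)).
  have -> : freq N.+1 * ((ln l - ln t) / L) = bfreq N.+1 * ln l - bfreq N.+1 * ln t.
    by rewrite /bfreq; ring.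
  by rewrite cosB sinB /A /B; ring.
have -> : (fun t => pseries N.+1 ((ln l - ln t) / L)) =
  (fun t => pseries N ((ln l - ln t) / L) +
   (A * cos (bfreq N.+1 * ln t) + B * sin (bfreq N.+1 * ln t))).
  by apply/funext => t; exact: E.
have i1 := eintegrableD (eintegrableZ A ic) (eintegrableZ B js).
split; first exact: eintegrableD.
rewrite eintD// IH (eintD (eintegrableZ A ic) (eintegrableZ B js)).
rewrite (eintZ A ic) (eintZ B js) -/(gcos _) -/(gsin _).
by rewrite big_ord_recr/= -addrA /pi_real_term /A /B; congr (_ + (_ + _)); ring.
Qed.

Definition pfrac l t : R := pfun (frac ((ln l - ln t) / L)).

(** The partial Fourier sums converge pointwise and are uniformly bounded, so the series may be
    integrated term by term; its constant term is [pmean]. *)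
Lemma eint_pfrac l : 0 < l -> eintegrable (pfrac l) /\
  \sum_(k < N) pi_real_term l k.+1 @[N --> \oo] --> eint (pfrac l) - pmean.
Proof.
move=> l0.
have [m cv] : measurable_fun D (pfrac l) /\
    eint (fun t => pseries n ((ln l - ln t) / L)) @[n --> \oo] --> eint (pfrac l).
  apply: (@eint_bounded_cvg _ _ (`|pmean| + 4)).
  - move=> n; have mc (f : R -> R) k : continuous f ->
        measurable_fun D (fun t => f (freq k * ((ln l - ln t) / L))).
      move=> cf; apply: measurable_funTS.
      apply: (@measurableT_comp _ _ _ _ _ _ f); first exact: continuous_measurable_fun.
      apply: measurable_funM => //; apply: measurable_funM => //.
      by apply: measurable_funB => //; exact: measurable_ln.
    apply: measurable_funD => //; apply: measurable_sum => k.
    apply: measurable_funD; apply: measurable_funM => //; apply: mc.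
      exact: continuous_cos.
    exact: continuous_sin.
  - by move=> n t _; exact: pseries_bound.
  - by move=> t _; exact: pseries_cvg_frac.
have pb t : 0 < t -> `|pfrac l t| <= 10 * L + 16.
  by move=> _; apply: pfun_bound; have /andP[-> /ltW ->] := frac_itv ((ln l - ln t) / L).
split; first exact: (eintegrable_bounded m pb).
rewrite (_ : (fun N => _) = (fun N => eint (fun t => pseries N ((ln l - ln t) / L)) - pmean)).
  by apply: cvgB => //; exact: cvg_cst.
by apply/funext => N; rewrite (eint_pseries N l0).2 addrC addKr.
Qed.

(** The only source of the error term. For r >= 1 the difference is explicit; for r < 1 the function
    [Vq] is 0 and [Vmain] is bounded because r (ln r)^2 and r ln r are. *)
Lemma Vq_Vmain_bound : exists2 C : R, 0 <= C & forall r, 0 < r ->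
  `|Vq r - Vmain r| <= 2 * `|ln r| + C.
Proof.
have L0 := @ln2_gt0 R; have L1 := @ln2_lt1 R.
have LV : 0 < L^-1 by rewrite invr_gt0.
(* For r < 1 the three parts of [Vmain] are at most 8 / L, 36 / L and 10 L + 16; for r >= 1 the
   constant is 4 L + 4. The last 16 is slack. *)
exists (44 / L + 14 * L + 20 + 16); first by lra.
move=> r r0; rewrite /Vq; case: ifPn => [r1|].
  have l0 : 0 <= ln r by rewrite ln_ge0.
  rewrite (_ : Vmain r - 2 * ln r - 4 * L - 4 - Vmain r = - (2 * ln r + 4 * L + 4)); last by ring.
  rewrite normrN !ger0_norm//; last first.
    by rewrite !addr_ge0 ?mulr_ge0 ?(ltW L0).
  lra.
rewrite -ltNge => r1; rewrite sub0r normrN /Vmain.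
have r01 : 0 < r <= 1 by rewrite r0 ltW.
have sq1 : r `^ 2^-1 <= 1.
  rewrite -[leRHS](powRr0 r); apply: ger_powR => //; lra.
have b1 : `|ln r| * r <= 9.
  rewrite mulrC; apply: (le_trans (ln_abs_bound r01)); lra.
have b2 : r * ln r ^+ 2 <= 8.
  apply: (le_trans (ln_sq_bound r01)); lra.
have b20 : 0 <= r * ln r ^+ 2 by rewrite mulr_ge0 ?sqr_ge0// ltW.
have pb : `|pfun (frac (lg r))| <= 10 * L + 16.
  by apply: pfun_bound; have /andP[-> /ltW ->] := frac_itv (lg r).
have -> : r * (L * lg r ^+ 2 + (L - 4) * lg r + pfun (frac (lg r))) =
   r * ln r ^+ 2 / L + (L - 4) / L * (ln r * r) + r * pfun (frac (lg r)).
  by rewrite /lg; field; exact: lt0r_neq0.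
rewrite (le_trans (ler_normD _ _))//.
rewrite (le_trans (lerD (ler_normD _ _) (lexx _)))//.
have c1 : `|r * ln r ^+ 2 / L| <= 8 / L.
  by rewrite ger0_norm ?divr_ge0 ?(ltW L0)// ler_wpM2r// ltW.
have c2 : `|(L - 4) / L * (ln r * r)| <= 36 / L.
  rewrite normrM (@ler0_norm _ ((L - 4) / L)); last by rewrite pmulr_lle0//; lra.
  rewrite normrM (gtr0_norm r0).
  have : 0 <= - ((L - 4) / L) <= 4 / L.
    by rewrite -mulNr; apply/andP; split; [rewrite divr_ge0//; lra|rewrite ler_pM2r//; lra].
  move=> /andP[h1 h2]; have h3 : 0 <= `|ln r| * r by rewrite mulr_ge0// ltW.
  by apply: (le_trans (ler_pM h1 h3 h2 b1)); rewrite mulrAC; lra.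
have c3 : `|r * pfun (frac (lg r))| <= 10 * L + 16.
  rewrite normrM (gtr0_norm r0); apply: le_trans pb.
  by rewrite ler_piMl// ltW.
have := normr_ge0 (ln r); lra.
Qed.

Lemma t_ln_bound t : 0 < t -> t * `|ln t| <= t ^+ 2 + 1.
Proof.
move=> t0; have tV : 0 < t^-1 by rewrite invr_gt0.
have h1 := ln_sublinear t0; have h2 := ln_sublinear tV.
rewrite lnV ?posrE// in h2.
have h3 : `|ln t| <= t + t^-1 by rewrite ler_norml; apply/andP; split; lra.
have -> : t ^+ 2 + 1 = t * (t + t^-1) by field; exact: lt0r_neq0.
by rewrite ler_wpM2l// ltW.
Qed.

(** The real form of the expansion. t Vmain(l / t) is l times a quadratic polynomial in ln t plus
    the periodic part, so its integral follows from the moments 1, -gamma and gamma^2 + pi^2 / 6.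
    The periodic sum enters only through its limit s, to be matched later with [pi_]. *)
Theorem eint_tVq : exists K : R, forall l, expR 1 <= l ->
  eintegrable (fun t => t * Vq (l / t)) /\
  forall s : R, \sum_(k < N) pi_real_term l k.+1 @[N --> \oo] --> s ->
  `|eint (fun t => t * Vq (l / t)) -
    (l * ln l * lg l - c1 R * l * ln l + c2 R * l + s * l)| <= K * ln l.
Proof.
have L0 := @ln2_gt0 R.
have [C C0 hC] := Vq_Vmain_bound.
pose e2 : R := eint (fun t => expR (t / 2)).
(* The factor collects t (2 ln l + C) <= (8 ln l + 4 C) E and 2 (t^2 + 1) <= 68 E, where E = exp(t /
   2); l >= e gives ln l >= 1, which absorbs the constants. *)
exists ((8 + 4 * C + 68) * e2) => l le1.
have l0 : 0 < l := lt_le_trans (expR_gt0 1) le1.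
have lnl1 : 1 <= ln l.
  by rewrite -(expRK 1) ler_ln ?posrE ?expR_gt0.
have err t : 0 < t ->
    `|t * Vq (l / t) - t * Vmain (l / t)| <= (8 + 4 * C + 68) * ln l * expR (t / 2).
  move=> t0; rewrite -mulrBr normrM gtr0_norm//.
  have h1 := hC _ (divr_gt0 l0 t0); rewrite ln_div ?posrE// in h1.
  have h2 : `|ln l - ln t| <= ln l + `|ln t|.
    by rewrite (le_trans (ler_normB _ _))// (ger0_norm (le_trans ler01 lnl1)).
  have h3 := t_ln_bound t0.
  have h4 := expR_half_quad t0.
  have t2 : 0 < t ^+ 2 by rewrite exprn_gt0.
  apply: (@le_trans _ _ (t * (2 * ln l + C) + 2 * (t * `|ln t|))).
    rewrite (_ : t * (2 * ln l + C) + 2 * (t * `|ln t|) = t * (2 * (ln l + `|ln t|) + C)); last by ring.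
    by rewrite ler_wpM2l ?(ltW t0)//; lra.
  have ht : t <= 4 * expR (t / 2) by lra.
  have ht2 : t ^+ 2 <= 32 * expR (t / 2) by lra.
  have h1e : 1 <= 2 * expR (t / 2) by lra.
  have a0 : 0 <= 2 * ln l + C by lra.
  have h5 : t * (2 * ln l + C) <= 4 * expR (t / 2) * (2 * ln l + C) by rewrite ler_wpM2r.
  have e0 := expR_gt0 (t / 2).
  have h6 : expR (t / 2) <= ln l * expR (t / 2) by rewrite ler_peMl// ltW.
  have h7 : C * expR (t / 2) <= C * (ln l * expR (t / 2)) by rewrite ler_wpM2l.
  have : t * (2 * ln l + C) + 2 * (t * `|ln t|) <=
     4 * expR (t / 2) * (2 * ln l + C) + 2 * (32 * expR (t / 2) + 2 * expR (t / 2)) by lra.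
  move/le_trans; apply.
  rewrite (_ : 4 * expR (t / 2) * (2 * ln l + C) + _ = 8 * (ln l * expR (t / 2)) +
     4 * (C * expR (t / 2)) + 68 * expR (t / 2)); last by ring.
  rewrite (_ : (8 + 4 * C + 68) * ln l * expR (t / 2) = 8 * (ln l * expR (t / 2)) +
     4 * (C * (ln l * expR (t / 2))) + 68 * (ln l * expR (t / 2))); last by ring.
  lra.
have [ip cp] := eint_pfrac l0.
(* The coefficients in powers of ln t of L y^2 + (L - 4) y at y = (ln l - ln t) / L. *)
pose a0 := ln l ^+ 2 / L + (1 - 4 / L) * ln l.
pose a1 := - (2 * ln l / L + (1 - 4 / L)).
have mainE t : 0 < t -> t * Vmain (l / t) =
    l * (a0 * 1 + (a1 * ln t + (L^-1 * ln t ^+ 2 + pfrac l t))).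
  move=> t0; rewrite /Vmain lg_div// -/(pfrac l t) /a0 /a1.
  by field; rewrite !lt0r_neq0.
have i0 := eintegrableZ a0 (@eintegrable1 R).
have i1 := eintegrableZ a1 (@eintegrable_ln R).
have i2 := eintegrableZ L^-1 (@eintegrable_ln2 R).
have i23 := eintegrableD i2 ip.
have i123 := eintegrableD i1 i23.
have i0123 := eintegrableD i0 i123.
have iM : eintegrable (fun t => t * Vmain (l / t)).
  have := eintegrableZ l i0123; apply: eq_integrable; first exact: mD.
  by move=> t; rewrite inE/= in_itv/= andbT => t0 /=; rewrite mainE.
have mM : measurable_fun D (fun t => t * Vmain (l / t)).
  have m0 : measurable_fun D (fun t => l * (a0 * 1 + (a1 * ln t + (L^-1 * ln t ^+ 2 + pfrac l t)))).
    have [mp _] : measurable_fun D (pfrac l) /\ True.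
      split => //; have := measurable_int _ ip; move=> /measurable_EFinP mp.
      apply: (@eq_measurable_fun _ _ _ _ _ (fun t => expR t * (expR (- t) * pfrac l t))).
        by move=> t _; rewrite mulrA -expRD subrr expR0 mul1r.
      by apply: measurable_funM => //; apply: measurable_funTS; exact: measurable_expR.
    have ml : measurable_fun D (@ln R) by apply: measurable_funTS; exact: measurable_ln.
    apply: measurable_funM => //; apply: measurable_funD => //.
    apply: measurable_funD; first exact: measurable_funM.
    apply: measurable_funD => //; apply: measurable_funM => //.
    exact: measurable_funX.
  apply: eq_measurable_fun m0 => t; rewrite inE/= in_itv/= andbT => t0.
  by rewrite mainE.
have ie := eintegrableZ ((8 + 4 * C + 68) * ln l) (@eintegrable_expR R).
have mE : measurable_fun D (fun t => t * Vq (l / t) - t * Vmain (l / t)).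
  by apply: measurable_funB => //; exact: measurable_tVq.
have iE := eintegrable_le mE err ie.
have iV : eintegrable (fun t => t * Vq (l / t)).
  have := eintegrableD iM iE; apply: eq_integrable; first exact: mD.
  by move=> t _ /=; rewrite addrC subrK.
split => // s cs.
have -> : s = eint (pfrac l) - pmean by apply: (cvg_unique _ cs cp).
have -> : l * ln l * lg l - c1 R * l * ln l + c2 R * l + (eint (pfrac l) - pmean) * l =
    eint (fun t => t * Vmain (l / t)).
  transitivity (eint (fun t => l * (a0 * 1 + (a1 * ln t + (L^-1 * ln t ^+ 2 + pfrac l t))))).
    rewrite (eintZ l i0123) (eintD i0 i123) (eintD i1 i23) (eintD i2 ip).
    rewrite (eintZ a0 (@eintegrable1 R)) (eintZ a1 (@eintegrable_ln R)).
    rewrite (eintZ L^-1 (@eintegrable_ln2 R)) eint1 eint_ln (eint_ln2 (@zeta2 R)).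
    rewrite /c1 /c2 /lg /a0 /a1 /pmean.
    move: (eint (pfrac l)) (euler_gamma R) (pi : R) (ln l) => P g p w.
    by field; exact: lt0r_neq0.
  by apply: eq_eint => t t0; rewrite mainE.
have -> : eint (fun t => t * Vq (l / t)) - eint (fun t => t * Vmain (l / t)) =
    eint (fun t => t * Vq (l / t) - t * Vmain (l / t)).
  rewrite -[eint (fun t => t * Vmain _)]mul1r -mulNr -(eintZ _ iM).
  rewrite -(eintD iV (eintegrableZ _ iM)).
  by apply: eq_eint => t _; rewrite mulN1r.
apply: (le_trans (le_norm_eint iE ie err)).
by rewrite (eintZ _ (@eintegrable_expR R)) mulrAC.
Qed.

End asymptotics.

(** * The complex Fourier series of the statement *)

Section integer_sums.
Local Open Scope complex_scope.
Context {R : realType}.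
Implicit Types (a : int -> R[i]) (s : R[i]).

Lemma normcE (z : R[i]) : `|z| = (Normc.normc z)%:C.
Proof. by []. Qed.

Lemma le_normc_ReIm (u v : R) : Normc.normc (u +i* v) <= `|u| + `|v|.
Proof.
have uv0 : 0 <= `|u| + `|v| by rewrite addr_ge0.
rewrite /= -(ger0_norm uv0) -sqrtr_sqr ler_sqrt ?sqr_ge0//.
rewrite -(real_normK (num_real u)) -(real_normK (num_real v)).
by have := normr_ge0 u; have := normr_ge0 v; nra.
Qed.

Lemma normc_ge0 (z : R[i]) : 0 <= Normc.normc z.
Proof. by case: z => u v; exact: sqrtr_ge0. Qed.

Lemma normc_sum (I : Type) (r : seq I) (f : I -> R[i]) :
  Normc.normc (\sum_(i <- r) f i) <= \sum_(i <- r) Normc.normc (f i).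
Proof.
elim: r => [|i r IH]; first by rewrite !big_nil Normc.normc0.
by rewrite !big_cons (le_trans (le_normcD _ _))// lerD2l.
Qed.

Definition sym_range (m n : nat) : seq int :=
  [seq Posz j.+1 | j <- index_iota m n] ++ [seq Negz j | j <- index_iota m n].

Lemma sym_range_uniq m n : uniq (sym_range m n).
Proof.
rewrite /sym_range cat_uniq !map_inj_uniq ?iota_uniq//=; last 2 first.
- by move=> i j [].
- by move=> i j [].
by rewrite andbT; apply/hasPn => _ /mapP[j _ ->]; apply/mapP => -[].
Qed.

Lemma mem_sym_range m n (k : int) : (k \in sym_range m n) = (m < `|k| <= n)%N.
Proof.
rewrite /sym_range mem_cat; case: k => [[|j]|j].
- rewrite /=; apply/negbTE; rewrite negb_or; apply/andP; split.
    by apply/mapP => -[].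
  by apply/mapP => -[].
- rewrite (mem_map (f := fun j => Posz j.+1)); last by move=> i i' [].
  rewrite mem_index_iota ltnS; case: (boolP (_ <= j < n)%N) => //= _.
  by apply/mapP => -[].
- rewrite (mem_map (f := Negz)); last by move=> i i' [].
  rewrite mem_index_iota NegzE abszN /= ltnS orbC; case: (boolP (_ <= j < n)%N) => //= _.
  by apply/mapP => -[].
Qed.

Lemma big_sym_range (V : zmodType) (f : int -> V) m n :
  \sum_(k <- sym_range m n) f k = \sum_(m <= j < n) (f (Posz j.+1) + f (Negz j)).
Proof. by rewrite /sym_range big_cat/= !big_map big_split. Qed.

Lemma sum_subseq_le (f : int -> R) (H r : seq int) : (forall k, 0 <= f k) ->
  uniq H -> uniq r -> {subset H <= r} -> \sum_(k <- H) f k <= \sum_(k <- r) f k.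
Proof.
move=> f0 uH ur Hr.
have pH : perm_eq H [seq k <- r | k \in H].
  apply: uniq_perm => //; first exact: filter_uniq.
  move=> k; rewrite mem_filter; apply/idP/idP => [kH|/andP[]//].
  by rewrite kH Hr.
rewrite (perm_big _ pH) big_filter [leRHS](bigID (fun k => k \in H))/= lerDl.
exact: sumr_ge0.
Qed.

Lemma sum_inv_sq_tail m n : (0 < m)%N ->
  \sum_(m <= j < n) (j.+1%:R ^+ 2)^-1 <= m%:R^-1 :> R.
Proof.
move=> m0; have [nm|mn] := leqP n m.
  by rewrite big_geq// invr_ge0.
suff : \sum_(m <= j < n) (j.+1%:R ^+ 2)^-1 <= m%:R^-1 - n%:R^-1 :> R.
  by move/le_trans; apply; rewrite gerBl invr_ge0.
elim: n mn => // n IH; rewrite ltnS => mn.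
rewrite big_nat_recr//=.
have step (k : nat) : (0 < k)%N -> (k.+1%:R ^+ 2)^-1 <= k%:R^-1 - k.+1%:R^-1 :> R.
  move=> k0; have kp : 0 < k%:R :> R by rewrite ltr0n.
  rewrite -natr1; move: (k%:R : R) kp => x x0.
  have -> : x^-1 - (x + 1)^-1 = (x * (x + 1))^-1.
    by field; apply/andP; split; apply: lt0r_neq0; lra.
  have p1 : 0 < x * (x + 1) by nra.
  have p2 : 0 < (x + 1) ^+ 2 by rewrite exprn_gt0//; lra.
  by rewrite lef_pV2 ?posrE//; nra.
have n0 : (0 < n)%N by exact: leq_trans mn.
move: mn; rewrite leq_eqVlt => /predU1P[<-|mn].
  by rewrite big_geq// add0r step.
by apply: (le_trans (lerD (IH mn) (step n n0))); rewrite addrA subrK.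
Qed.

(** Quadratic decay upgrades convergence of the symmetric partial sums: a finite set containing all
    k with 0 < |k| <= n differs from them by indices of modulus above n, which contribute at most 2
    C / n. *)
Lemma has_sum_sym a s (C : R) :
  (forall n, Normc.normc (a (Posz n.+1)) <= C / n.+1%:R ^+ 2) ->
  (forall n, Normc.normc (a (Negz n)) <= C / n.+1%:R ^+ 2) ->
  (forall e : R, 0 < e -> \forall N \near \oo,
     Normc.normc (\sum_(j < N) (a (Posz j.+1) + a (Negz j)) - s) < e) ->
  has_sum [set k : int | k != 0] a s.
Proof.
move=> aP aN cv e e0.
have C0 : 0 <= C.
  have := aP 0%N; rewrite expr1n divr1; apply: le_trans.
  exact: normc_ge0.
have e20 : 0 < e / 2 by rewrite divr_gt0.
near \oo => n.
have n0 : (0 < n)%N by near: n; exact: nbhs_infty_gt.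
have hn : Normc.normc (\sum_(j < n) (a (Posz j.+1) + a (Negz j)) - s) < e / 2.
  by near: n; exact: cv.
have tn : 2 * C / n%:R < e / 2.
  have n0' : 0 < n%:R :> R by rewrite ltr0n.
  rewrite ltr_pdivrMr// -ltr_pdivrMl//.
  by near: n; exact: nbhs_infty_gtr.
exists [fset k in sym_range 0 n]%fset.
  move=> k /=; rewrite !inE/= -mem_cat -/(sym_range 0 n) mem_sym_range => /andP[k0 _].
  by rewrite -absz_gt0.
move=> G FG Gn0; rewrite normcE ltcR.
have Gn k : k \in G -> k != 0 by move=> kG; exact: Gn0.
have GF k : k \in sym_range 0 n -> k \in G.
  by move=> kF; apply: FG; rewrite /= !inE -mem_cat.
have split_G : \sum_(k <- G) a k =
    \sum_(k <- sym_range 0 n) a k + \sum_(k <- [seq k <- G | k \notin sym_range 0 n]) a k.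
  rewrite (bigID (fun k => k \in sym_range 0 n))/= big_filter; congr (_ + _).
  rewrite -big_filter; apply: perm_big; apply: uniq_perm.
  - by rewrite filter_uniq// fset_uniq.
  - exact: sym_range_uniq.
  - move=> k; rewrite mem_filter; apply/andP/idP => [[]//|kF].
    by split => //; exact: GF.
rewrite split_G addrAC (le_lt_trans (le_normcD _ _))// (splitr e) ltrD//.
  by rewrite big_sym_range big_mkord.
apply: le_lt_trans tn; apply: (le_trans (normc_sum _ _)).
pose f (k : int) : R := C / `|k|%N%:R ^+ 2.
have f0 k : 0 <= f k by rewrite divr_ge0// exprn_ge0.
pose M := \max_(k <- G) `|k|%N.
set H := [seq _ <- _ | _].
have HM : {subset H <= sym_range n M}.
  move=> k; rewrite mem_filter !mem_sym_range => /andP[+ kG].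
  rewrite absz_gt0 Gn//= -ltnNge => -> /=.
  exact: (@leq_bigmax_seq _ _ xpredT (fun k : int => `|k|%N)).
apply: (@le_trans _ _ (\sum_(k <- H) f k)).
  rewrite big_seq [leRHS]big_seq; apply: ler_sum => k; rewrite mem_filter => /andP[_ kG].
  have := Gn k kG; rewrite /f; case: k {kG} => [[|j]|j] //=.
apply: (le_trans (sum_subseq_le f0 _ (sym_range_uniq n M) HM)).
  by rewrite filter_uniq// fset_uniq.
rewrite big_sym_range (eq_bigr (fun j => 2 * C * (j.+1%:R ^+ 2)^-1)); last first.
  by move=> j _; rewrite /f NegzE abszN /=; ring.
by rewrite -mulr_sumr ler_wpM2l ?mulr_ge0// sum_inv_sq_tail.
Unshelve. all: by end_near. Qed.

Lemma has_sum_unique (I : choiceType) (A : set I) (b : I -> R[i]) (s s' : R[i]) :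
  has_sum A b s -> has_sum A b s' -> s = s'.
Proof.
move=> h h'; apply/eqP; rewrite -subr_eq0; apply/negPn/negP => ss0.
set e := Normc.normc (s - s').
have e0 : 0 < e.
  rewrite lt_neqAle normc_ge0 andbT eq_sym; apply: contra ss0 => /eqP.
  by move=> /Normc.eq0_normc ->.
have e20 : 0 < e / 2 by rewrite divr_gt0.
have [F FA hF] := h _ e20; have [F' FA' hF'] := h' _ e20.
have sub1 : [set` F] `<=` [set` (F `|` F')%fset].
  by move=> i /= iF; rewrite in_fsetU iF.
have sub2 : [set` F'] `<=` [set` (F `|` F')%fset].
  by move=> i /= iF; rewrite in_fsetU iF orbT.
have subA : [set` (F `|` F')%fset] `<=` A.
  by move=> i /=; rewrite in_fsetU => /orP[iF|iF]; [exact: FA|exact: FA'].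
have h1 := hF _ sub1 subA; have h2 := hF' _ sub2 subA.
rewrite normcE ltcR in h1; rewrite normcE ltcR in h2.
set S := \sum_(i <- _) _ in h1 h2.
have : e <= Normc.normc (S - s') + Normc.normc (S - s).
  rewrite -(normcN (S - s)); apply: le_trans (le_normcD _ _).
  by rewrite opprB [S - s']addrC addrAC addrA subrK /e addrC.
lra.
Qed.

Lemma csumE (I : choiceType) (A : set I) (b : I -> R[i]) (s : R[i]) :
  has_sum A b s -> has_sum A b (csum A b) /\ csum A b = s.
Proof.
move=> h; have hc : has_sum A b (csum A b) by exact: (xgetI _ h).
by split => //; exact: (has_sum_unique hc h).
Qed.

End integer_sums.

(** * Values of Gamma on the line of real part -1 *)

Section gamma_values.
Local Open Scope complex_scope.
Context {R : realType}.
Implicit Types (b l : R).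

Definition ecos b : R := eint (fun t => cos (b * ln t)).
Definition esin b : R := eint (fun t => sin (b * ln t)).

Lemma cpow_imaginary (t b : R) : 
  cpow t (0 +i* b) = cos (b * ln t) +i* sin (b * ln t).
Proof. by rewrite /cpow /= powRr0 mul1r. Qed.

Lemma Gamma_integral_line b : Gamma_integral (1 +i* - b) = ecos b +i* - esin b.
Proof.
rewrite /Gamma_integral.
have -> : (1 +i* - b) - 1 = 0 +i* - b.
  by apply/eqP; rewrite eq_complex /= subrr oppr0 addr0 !eqxx.
have E (t : R) : cpow t (0 +i* - b) * (expR (- t))%:C =
    (expR (- t) * cos (b * ln t)) +i* (- (expR (- t) * sin (b * ln t))).
  rewrite cpow_imaginary; apply/eqP; rewrite eq_complex /= mulNr cosN sinN.
  by apply/andP; split; apply/eqP; ring.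
congr (_ +i* _); first by apply: eq_Rintegral => t _; rewrite E.
transitivity (eint (fun t => -1 * sin (b * ln t))).
  by apply: eq_Rintegral => t _; rewrite E /= mulN1r mulrN.
by rewrite (eintZ _ (eintegrable_sin b)) mulN1r.
Qed.

Lemma Gamma_line b : Gamma ((-1) +i* - b) =
  (ecos b +i* - esin b) / (((-1) +i* - b) * (0 +i* - b)).
Proof.
(* On this line m = 2: one shift only reaches real part 0. *)
rewrite /Gamma /= ltr0N1 opprK truncn1.
rewrite !big_ord_recl big_ord0 /= mulr1.
congr (_ / (_ * _)).
- rewrite -Gamma_integral_line; congr Gamma_integral.
  apply/eqP; rewrite eq_complex /=; apply/andP; split; apply/eqP; ring.
- apply/eqP; rewrite eq_complex /=; apply/andP; split; apply/eqP; ring.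
- apply/eqP; rewrite eq_complex /=; apply/andP; split; apply/eqP; ring.
Qed.

(* The real and imaginary parts of [pi_term] *)
Definition pi_Re l (x : R) : R := let b := Defs.beta R * x in
  let X := ecos b * cos (b * ln l) + esin b * sin (b * ln l) in
  let Y := ecos b * sin (b * ln l) - esin b * cos (b * ln l) in
  - ((1 - b ^+ 2) * X + 2 * b * Y) / (pi * x * b * (1 + b ^+ 2) ^+ 2).
Definition pi_Im l (x : R) : R := let b := Defs.beta R * x in
  let X := ecos b * cos (b * ln l) + esin b * sin (b * ln l) in
  let Y := ecos b * sin (b * ln l) - esin b * cos (b * ln l) in
  - ((1 - b ^+ 2) * Y - 2 * b * X) / (pi * x * b * (1 + b ^+ 2) ^+ 2).

Lemma beta_gt0 : 0 < Defs.beta R.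
Proof. by rewrite /Defs.beta divr_gt0 ?ln2_gt0// mulr_gt0// pi_gt0. Qed.

Lemma pi_termE l (k : int) : k != 0 ->
  pi_term l k = pi_Re l k%:~R +i* pi_Im l k%:~R.
Proof.
move=> k0; rewrite /pi_term.
have x0 : k%:~R != 0 :> R by rewrite intr_eq0.
have -> : k%:~R = (k%:~R : R)%:C by rewrite rmorph_int.
move: (k%:~R : R) x0 => x x0.
set b := Defs.beta R * x.
have b0 : b != 0 by rewrite mulf_neq0// gt_eqF// beta_gt0.
have ibE : 'i%C * b%:C = 0 +i* b.
  by apply/eqP; rewrite eq_complex /=; apply/andP; split; apply/eqP; ring.
rewrite ibE cpow_imaginary.
have wE : -1 - (0 +i* b) = (-1) +i* - b.
  by apply/eqP; rewrite eq_complex /=; apply/andP; split; apply/eqP; ring.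
rewrite wE Gamma_line.
set w : R[i] := (-1) +i* - b.
have w0 : w != 0 by rewrite eq_complex /= oppr_eq0 oner_eq0.
have v0 : (0 +i* - b) != 0 :> R[i] by rewrite eq_complex /= oppr_eq0 (negPf b0) andbF.
have p0 : pi != 0 :> R by rewrite gt_eqF// pi_gt0.
have px0 : (pi%:C * x%:C) != 0 :> R[i].
  by rewrite -rmorphM/=; apply/eqP => -[]; apply/eqP; exact: mulf_neq0.
have d0 : 1 + b ^+ 2 != 0 by rewrite gt_eqF// ltr_wpDr// sqr_ge0.
have -> : 'i%C / (pi%:C * x%:C * w) * ((ecos b +i* - esin b) / (w * (0 +i* - b))) *
   (cos (b * ln l) +i* sin (b * ln l)) =
   ('i%C * (ecos b +i* - esin b) * (cos (b * ln l) +i* sin (b * ln l))) /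
   ((pi%:C * x%:C * w) * (w * (0 +i* - b))).
  by move: (_ * x%:C) px0 => q q0; field; rewrite w0 v0 q0.
apply: (canLR (mulfK (mulf_neq0 (mulf_neq0 px0 w0) (mulf_neq0 w0 v0)))).
rewrite /pi_Re /pi_Im -/b /w.
move: (ecos b) (esin b) (cos (b * ln l)) (sin (b * ln l)) (pi : R) p0 => g h c s p p0.
apply/eqP; rewrite eq_complex /=; apply/andP; split; apply/eqP; field.
  by rewrite d0 b0 x0 p0.
by rewrite d0 b0 x0 p0.
Qed.

Lemma ecosN b : ecos (- b) = ecos b.
Proof. by apply: eq_eint => t _; rewrite mulNr cosN. Qed.

Lemma esinN b : esin (- b) = - esin b.
Proof.
rewrite -[RHS]mulN1r /esin -(eintZ _ (eintegrable_sin b)).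
by apply: eq_eint => t _; rewrite mulNr sinN mulN1r.
Qed.

Lemma pi_ReN l x : pi_Re l (- x) = pi_Re l x.
Proof.
rewrite /pi_Re mulrN; set b := _ * x.
rewrite ecosN esinN (mulNr b (ln l)) cosN sinN.
by congr (_ / _); ring.
Qed.

Lemma pi_ImN l x : pi_Im l (- x) = - pi_Im l x.
Proof.
rewrite /pi_Im mulrN; set b := _ * x.
rewrite ecosN esinN (mulNr b (ln l)) cosN sinN -[RHS]mulNr.
by congr (_ / _); ring.
Qed.

(** The meeting point of the Fourier coefficients of [pfun] and of the Gamma values: with freq = (ln
    2) b and pi (n + 1) = (ln 2) b / 2, both sides have the same rational coefficients in b. *)
Lemma pi_Re_real l n : pi_Re l n.+1%:R + pi_Re l n.+1%:R = pi_real_term l n.+1.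
Proof.
have L0 := @ln2_gt0 R; have p0 := @pi_gt0 R.
have bE : Defs.beta R * n.+1%:R = bfreq n.+1.
  by rewrite /Defs.beta /bfreq /freq; ring.
rewrite /pi_Re bE /pi_real_term /gcos /gsin.
rewrite -/(ecos (bfreq n.+1)) -/(esin (bfreq n.+1)).
have fE : freq n.+1 = ln 2 * bfreq n.+1 :> R.
  by rewrite /bfreq mulrC divfK// gt_eqF.
have xE : pi * n.+1%:R = ln 2 * bfreq n.+1 / 2 :> R by rewrite -fE /freq; field.
rewrite /pcos /psin xE fE.
have b0 : bfreq n.+1 != 0 :> R by rewrite mulf_neq0 ?invr_eq0 ?gt_eqF ?freq_gt0.
have d0 : 1 + bfreq n.+1 ^+ 2 != 0 :> R by rewrite gt_eqF// ltr_wpDr// sqr_ge0.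
rewrite -/(ecos (bfreq n.+1)) -/(esin (bfreq n.+1)).
move: (ecos _) (esin _) (cos _) (sin _) => g h c s.
move: (bfreq n.+1) b0 d0 => b b0 d0.
have -> : ln 2 ^+ 2 + (ln 2 * b) ^+ 2 = ln 2 ^+ 2 * (1 + b ^+ 2) by ring.
move: (ln 2 : R) (lt0r_neq0 L0) => w w0.
by field; rewrite d0 b0 w0.
Qed.

Lemma eint_le1 (f : R -> R) : eintegrable f -> (forall t, `|f t| <= 1) -> `|eint f| <= 1.
Proof. by move=> i h; rewrite -(@eint1 R); apply: le_norm_eint => //; exact: eintegrable1. Qed.

(** Since |ecos| and |esin| are at most 1, each numerator is at most 4 (1 + b^2), and the factor x b
    of the denominator provides the quadratic decay. *)
Lemma pi_ReIm_bound l x : x != 0 ->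
  `|pi_Re l x| + `|pi_Im l x| <= 8 / (pi * Defs.beta R) / x ^+ 2.
Proof.
move=> x0; rewrite /pi_Re /pi_Im.
set b := Defs.beta R * x.
set X := ecos b * cos _ + _; set Y := ecos b * sin _ - _.
have hc := eint_le1 (eintegrable_cos b) (fun t => cos_max _).
have hs := eint_le1 (eintegrable_sin b) (fun t => sin_max _).
have prod1 (u v : R) : `|u| <= 1 -> `|v| <= 1 -> `|u * v| <= 1.
  by move=> hu hv; rewrite normrM mulr_ile1.
have X2 : `|X| <= 2.
  rewrite (le_trans (ler_normD _ _))// (_ : 2 = 1 + 1)// lerD//; apply: prod1 => //.
    exact: cos_max.
  exact: sin_max.
have Y2 : `|Y| <= 2.
  rewrite (le_trans (ler_normB _ _))// (_ : 2 = 1 + 1)// lerD//; apply: prod1 => //.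
    exact: sin_max.
  exact: cos_max.
have d0 : 0 < 1 + b ^+ 2 by rewrite ltr_wpDr// sqr_ge0.
have h1 : `|1 - b ^+ 2| <= 1 + b ^+ 2.
  by rewrite ler_norml; have := sqr_ge0 b => ?; apply/andP; split; lra.
have h2 : `|2 * b| <= 1 + b ^+ 2.
  have := sqr_ge0 (b + 1); have := sqr_ge0 (b - 1) => ? ?.
  by rewrite ler_norml; apply/andP; split; nra.
have hU : `|(1 - b ^+ 2) * X + 2 * b * Y| <= 4 * (1 + b ^+ 2).
  rewrite (le_trans (ler_normD _ _))// (normrM _ X) (normrM _ Y).
  have := ler_pM (normr_ge0 _) (normr_ge0 _) h1 X2.
  have := ler_pM (normr_ge0 _) (normr_ge0 _) h2 Y2.
  lra.
have hV : `|(1 - b ^+ 2) * Y - 2 * b * X| <= 4 * (1 + b ^+ 2).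
  rewrite (le_trans (ler_normB _ _))// (normrM _ X) (normrM _ Y).
  have := ler_pM (normr_ge0 _) (normr_ge0 _) h1 Y2.
  have := ler_pM (normr_ge0 _) (normr_ge0 _) h2 X2.
  lra.
have xx : pi * x * b = pi * Defs.beta R * x ^+ 2 by rewrite /b; ring.
have q0 : 0 < pi * Defs.beta R * x ^+ 2.
  by apply: mulr_gt0 (mulr_gt0 (pi_gt0 R) beta_gt0) _; rewrite exprn_even_gt0.
rewrite xx !normrM !normrN normfV (gtr0_norm (mulr_gt0 q0 (exprn_gt0 2 d0))).
rewrite -mulrDl ler_pdivrMr; last by rewrite mulr_gt0// exprn_gt0.
have -> : 8 / (pi * Defs.beta R) / x ^+ 2 * (pi * Defs.beta R * x ^+ 2 * (1 + b ^+ 2) ^+ 2)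
    = 8 * (1 + b ^+ 2) ^+ 2.
  have := pi_gt0 R; have := beta_gt0; move: (pi : R) (Defs.beta R) => p bb hb hp.
  by field; rewrite x0 !lt0r_neq0.
apply: (le_trans (lerD hU hV)).
have : 1 <= 1 + b ^+ 2 by rewrite lerDl sqr_ge0.
move: (1 + b ^+ 2) => d hd; nra.
Qed.

Theorem pi_has_sum l s : \sum_(k < N) pi_real_term l k.+1 @[N --> \oo] --> (s : R) ->
  has_sum [set k : int | k != 0] (pi_term l) (pi_ l) /\ pi_ l = s%:C.
Proof.
move=> cs; apply: csumE.
apply: (@has_sum_sym _ _ _ (8 / (pi * Defs.beta R))).
- move=> n; rewrite pi_termE// (le_trans (le_normc_ReIm _ _))//.
  by apply: (le_trans (pi_ReIm_bound l _)); rewrite ?pnatr_eq0.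
- move=> n; rewrite pi_termE// NegzE mulrNz pi_ReN pi_ImN (le_trans (le_normc_ReIm _ _))// normrN.
  by apply: (le_trans (pi_ReIm_bound l _)); rewrite ?pnatr_eq0.
move=> e e0; move/cvgrPdist_lt : cs => /(_ e e0); apply: filterS => N.
rewrite distrC; apply: le_lt_trans.
have -> : \sum_(j < N) (pi_term l (Posz j.+1) + pi_term l (Negz j)) =
    (\sum_(j < N) pi_real_term l j.+1)%:C.
  rewrite rmorph_sum; apply: eq_bigr => j _.
  rewrite !pi_termE// NegzE mulrNz pi_ReN pi_ImN -pi_Re_real.
  by apply/eqP; rewrite eq_complex /= subrr !eqxx.
rewrite -rmorphB /=; apply: le_trans (le_normc_ReIm _ _) _.
by rewrite normr0 addr0.
Qed.

End gamma_values.

(** * Quicksort on a convex set of keys *)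

Section quicksort.

(* The keys are numbered from 1: the index 0 is the default value of [nth], taken
   when a pivot position is out of range. *)
Fixpoint qs (lt : rel nat) (pivot : seq bool -> nat -> nat) (fuel : nat)
    (v : seq bool) (s : seq nat) : seq (nat * nat) :=
  if fuel is m.+1 then
    if (size s <= 1)%N then [::] else
    let i := pivot v (size s) in
    let p := nth 0%N s i in
    let others := take i s ++ drop i.+1 s in
    [seq (y, p) | y <- others]
    ++ qs lt pivot m (rcons v false) [seq y <- others | lt y p]
    ++ qs lt pivot m (rcons v true) [seq y <- others | lt p y]
  else [::].

(** With indices in place of real keys, the list of compared pairs lives in a countable type and can
    be handled as a discrete random variable. The hypothesis on index 0 matches the default values
    of the two versions of [nth]. *)
Lemma comparisons_rec_qs (R : realType) (key : nat -> R) pivot fuel v s :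
  key 0%N = 0 ->
  comparisons_rec pivot fuel v [seq key j | j <- s] =
  [seq (key c.1, key c.2) | c <- qs (fun i j => key i < key j) pivot fuel v s].
Proof.
move=> key0; elim: fuel v s => //= m IH v s; rewrite size_map.
case: ifP => // _; set i := pivot v (size s).
have -> : nth 0 [seq key j | j <- s] i = key (nth 0%N s i).
  by have [lt_is|le_si] := ltnP i (size s);
    [rewrite (nth_map 0%N)|rewrite !nth_default ?size_map].
by rewrite -map_take -map_drop -map_cat !filter_map !IH !map_cat -!map_comp.
Qed.

(** Used to freeze the order of the keys on an event. Index 0 is within the range because it may
    occur as a default pivot. *)
Lemma qs_ext (lt lt' : rel nat) pivot fuel v s n :
  (forall i j, (i <= n)%N -> (j <= n)%N -> lt i j = lt' i j) ->
  {in s, forall j, (j <= n)%N} ->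
  qs lt pivot fuel v s = qs lt' pivot fuel v s.
Proof.
move=> E; elim: fuel v s => //= m IH v s sn; case: ifP => // _.
set i := pivot v (size s); set p := nth 0%N s i; set o := take i s ++ drop _ s.
have pn : (p <= n)%N.
  rewrite /p; have [lt_is|le_si] := ltnP i (size s); last by rewrite nth_default.
  by apply: sn; exact: mem_nth.
have on : {in o, forall j, (j <= n)%N}.
  by move=> j; rewrite mem_cat => /orP[/mem_take|/mem_drop]; exact: sn.
have -> : [seq y <- o | lt y p] = [seq y <- o | lt' y p].
  by apply: eq_in_filter => j jo; exact: (E _ _ (on _ jo) pn).
have -> : [seq y <- o | lt p y] = [seq y <- o | lt' p y].
  by apply: eq_in_filter => j jo; exact: (E _ _ pn (on _ jo)).
by congr (_ ++ (_ ++ _)); apply: IH => j; rewrite mem_filter => /andP[_]; exact: on.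
Qed.

Lemma qs_mem (lt : rel nat) pivot fuel v s :
  (forall v n, (0 < n)%N -> (pivot v n < n)%N) -> uniq s ->
  {in qs lt pivot fuel v s, forall c, [/\ c.1 \in s, c.2 \in s & c.1 != c.2]}.
Proof.
move=> pv; elim: fuel v s => //= m IH v s us; case: ifP => // /negbT.
rewrite -ltnNge => s1; set i := pivot v (size s).
have lt_is : (i < size s)%N by apply: pv; exact: leq_trans s1.
set p := nth 0%N s i; set o := take i s ++ drop _ s.
have ps : p \in s by exact: mem_nth.
have perm_o : perm_eq s (p :: o).
  by rewrite -{1}(cat_take_drop i s) (drop_nth 0%N lt_is) -cat1s perm_catCA.
have /andP[po uo] : uniq (p :: o) by rewrite -(perm_uniq perm_o).
have os j : j \in o -> j \in s by move=> jo; rewrite (perm_mem perm_o) inE jo orbT.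
move=> c; rewrite !mem_cat => /or3P[/mapP[y yo -> /=]|h|h].
- by split; [exact: os|exact: ps|apply: contraNneq po => <-].
- have [|c1 c2 c12] := IH _ _ _ _ h; first exact: filter_uniq.
  by split=> //; apply: os; [move: c1|move: c2]; rewrite mem_filter => /andP[].
- have [|c1 c2 c12] := IH _ _ _ _ h; first exact: filter_uniq.
  by split=> //; apply: os; [move: c1|move: c2]; rewrite mem_filter => /andP[].
Qed.

Context {R : realType}.

(* The mean of the number of comparisons of two keys satisfying [a]. *)
Fixpoint qe (lt : rel nat) (a : pred nat) (fuel : nat) (s : seq nat) : R :=
  if fuel is m.+1 then
    if (size s <= 1)%N then 0 else
    (size s)%:R^-1 * \sum_(i < size s)
      let p := nth 0%N s i in
      let others := take i s ++ drop i.+1 s in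
      (count (fun y => a y && a p) others)%:R
      + qe lt a m [seq y <- others | lt y p]
      + qe lt a m [seq y <- others | lt p y]
  else 0.

(** The rank is an injection of t into the numbers below its size, hence a bijection: a pivot
    uniform in t has uniform rank. *)
Lemma sum_rank (f : nat -> R) (t : seq nat) (F : nat -> R) : uniq t ->
  {in t &, injective f} ->
  \sum_(p <- t) F (count (fun y => f y < f p) t) = \sum_(j < size t) F j.
Proof.
move=> ut fi; pose r p := count (fun y => f y < f p) t.
have r_lt p q : p \in t -> q \in t -> f p < f q -> (r p < r q)%N.
  move=> pt qt pq; rewrite /r.
  have E : count (fun y => f y < f q) t =
      (count (fun y => (f y < f p)%R) t + count (fun y => (f p <= f y)%R && (f y < f q)%R) t)%N.
    rewrite -count_predUI -[LHS]addn0; congr (_ + _)%N.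
      apply: eq_count => y /=; apply/idP/orP => [yq|[yp|/andP[]//]].
        by have [yp|py] := ltP (f y) (f p); [left|right].
      exact: lt_trans pq.
    apply/esym/eqP; rewrite -leqn0 leqNgt -has_count; apply/hasP => -[y _ /=].
    by case: ltP.
  rewrite E -addn1 leq_add2l -has_count; apply/hasP; exists p => //=.
  by rewrite lexx.
have ri : {in t &, injective r}.
  move=> p q pt qt rpq; apply: fi => //.
  have [pq|qp|//] := ltgtP (f p) (f q).
    by have := r_lt _ _ pt qt pq; rewrite rpq ltnn.
  by have := r_lt _ _ qt pt qp; rewrite rpq ltnn.
have rs p : p \in t -> (r p < size t)%N.
  move=> pt; rewrite /r -(count_predC (fun y => (f y < f p)%R) t) -[X in (X < _)%N]addn0 ltn_add2l.
  by rewrite -has_count; apply/hasP; exists p => //=; rewrite ltxx.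
have ur : uniq (map r t) by rewrite map_inj_in_uniq.
have pr : perm_eq (map r t) (iota 0 (size t)).
  apply: uniq_perm => //; first exact: iota_uniq.
  have sub : {subset map r t <= iota 0 (size t)}.
    by move=> _ /mapP[p pt ->]; rewrite mem_iota add0n rs.
  have [] // := uniq_min_size ur sub; by rewrite size_iota size_map.
rewrite -(big_map r xpredT F) (perm_big _ pr) /=.
by rewrite -(big_mkord xpredT F) /index_iota subn0.
Qed.

Lemma qcmp_rec (m : nat) :
  2 * (\sum_(j < m) @qcmp R j) + m%:R * (m%:R - 1) = m%:R * qcmp m.
Proof.
elim: m => [|m IH]; first by rewrite big_ord0; ring.
rewrite big_ord_recr/= mulrDr.
have -> : 2 * (\sum_(j < m) @qcmp R j) = m%:R * qcmp m - m%:R * (m%:R - 1).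
  by rewrite -IH addrK.
rewrite /qcmp harmS.
have e1 : m.+1%:R = m%:R + 1 :> R by rewrite natr1.
have e2 : m.+2%:R = m%:R + 2 :> R by rewrite -(natr1 m.+1) -(natr1 m); ring.
have n0 : m%:R + 1 != 0 :> R by rewrite natr1 pnatr_eq0.
rewrite e2 e1; move: (harm m) (m%:R : R) n0 => h x x0.
by field.
Qed.

(** The Quicksort recurrence: m - 1 comparisons with the pivot, then j and m - 1 - j keys on its two
    sides. *)
Lemma sum_qcmp_split (m : nat) :
  \sum_(j < m) ((m%:R - 1) + @qcmp R j + qcmp (m - 1 - j)) = m%:R * qcmp m.
Proof.
rewrite 2!big_split/= sumr_const card_ord -qcmp_rec -(mulr_natl (m%:R - 1)).
have -> : \sum_(j < m) @qcmp R (m - 1 - j) = \sum_(j < m) qcmp j.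
  rewrite (reindex_inj rev_ord_inj)/=; apply: eq_bigr => j _.
  by congr qcmp; have := ltn_ord j; lia.
by ring.
Qed.

(* The pairs compared inside a convex set of keys are those of Quicksort run on
   that set alone: a pivot outside the set does not separate it. *)
Lemma qe_qcmp (f : nat -> R) (A : pred R) fuel s :
  (forall x y z, A x -> A z -> x < y -> y < z -> A y) ->
  uniq s -> {in s &, injective f} -> (size s <= fuel)%N ->
  qe (fun i j => f i < f j) (fun i => A (f i)) fuel s =
  qcmp (count (fun i => A (f i)) s).
Proof.
move=> cA; set a := fun i => A (f i); set lt := fun i j => f i < f j.
have q0 : @qcmp R 0 = 0 by rewrite /qcmp /harm big_ord0; ring.
have q1 : @qcmp R 1 = 0 by rewrite /qcmp /harm big_ord1 invr1; ring.
elim: fuel s => [|m IH] s us fi; first by rewrite leqn0 size_eq0 => /eqP ->.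
move=> sm; rewrite [LHS]/=; case: ifP => [s1|/negbT].
  have : (count a s <= 1)%N by apply: leq_trans s1; exact: count_size.
  by case: (count a s) => [|[|]].
rewrite -ltnNge => s1.
set M := count a s.
pose G (p : nat) : R := (if a p then M%:R - 1 else 0) +
   qcmp (count (fun y => a y && (f y < f p)) s) +
   qcmp (count (fun y => a y && (f p < f y)) s).
have step (i : 'I_(size s)) : (let p := nth 0%N s i in
      let others := take i s ++ drop i.+1 s in
      (count (fun y => a y && a p) others)%:R
      + qe lt a m [seq y <- others | lt y p]
      + qe lt a m [seq y <- others | lt p y]) = G (nth 0%N s i).
  set p := nth 0%N s i; set o := take i s ++ drop _ s => /=.
  have lt_is := ltn_ord i.
  have ps : p \in s by exact: mem_nth.
  have perm_o : perm_eq s (p :: o).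
    by rewrite -{1}(cat_take_drop i s) (drop_nth 0%N lt_is) -cat1s perm_catCA.
  have /andP[po uo] : uniq (p :: o) by rewrite -(perm_uniq perm_o).
  have os j : j \in o -> j \in s by move=> jo; rewrite (perm_mem perm_o) inE jo orbT.
  have so : (size o <= m)%N.
    by move: sm; rewrite (perm_size perm_o) /= ltnS.
  have IHf (b : pred nat) : qe lt a m [seq y <- o | b y] = qcmp (count a [seq y <- o | b y]).
    apply: IH; first exact: filter_uniq.
      move=> x y; rewrite !mem_filter => /andP[_ xo] /andP[_ yo].
      by apply: fi; exact: os.
    by rewrite size_filter (leq_trans (count_size _ _)).
  rewrite !IHf !count_filter /G; congr (_ + qcmp _ + qcmp _).
  - rewrite /M (permP perm_o a) /=; case: (a p) => /=.
      by rewrite natrD addrAC subrr add0r; congr (_%:R); apply: eq_count => y /=; rewrite andbT.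
    by rewrite (eq_count (a2 := pred0)) ?count_pred0// => y /=; rewrite andbF.
  - by rewrite (permP perm_o) /= ltxx andbF.
  - by rewrite (permP perm_o) /= ltxx andbF.
rewrite (eq_bigr (fun i : 'I_(size s) => G (nth 0%N s i))); last by move=> i _; exact: step.
rewrite -(big_mkord xpredT (fun i => G (nth 0%N s i))) -(big_nth 0%N xpredT G).
(* A pivot outside the set: by convexity all M keys of the set lie on one side of it, so one count
   is M and the other is 0. *)
have Gout p : p \in s -> ~~ a p -> G p = qcmp M.
  move=> ps ap; rewrite /G (negPf ap) add0r.
  have E : M = (count (fun y => (a y && (f y < f p)%R)) s
      + count (fun y => (a y && (f p < f y)%R)) s)%N.
    rewrite /M -count_predUI -[LHS]addn0; congr (_ + _)%N.
      apply: eq_in_count => y ys /=; rewrite -andb_orr.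
      have [ay|//] := boolP (a y); rewrite /= -neq_lt.
      apply/esym; apply: contraNneq ap => fyp.
      by rewrite -(fi y p ys ps fyp).
    apply/esym/eqP; rewrite -leqn0 leqNgt -has_count; apply/hasP => -[y _ /=].
    by case: ltgtP; rewrite ?andbF.
  have [/hasP[x xs /andP[ax xp]]|] := boolP (has (fun y => a y && (f y < f p)) s).
    have Z : count (fun y => a y && (f p < f y)) s = 0%N.
      apply/eqP; rewrite -leqn0 leqNgt -has_count; apply/hasP => -[z zs /andP[az pz]].
      by move: ap; rewrite /a (cA _ _ _ ax az xp pz).
    by rewrite E Z addn0 q0 addr0.
  rewrite has_count -leqNgt leqn0 => /eqP Z.
  by rewrite E Z add0n q0 add0r.
(* A pivot inside the set splits it by its rank among the M keys; averaged over these pivots this is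
   the Quicksort recurrence, so both kinds of pivots contribute the mean [qcmp M]. *)
have Gin p : p \in s -> a p -> G p = (fun j => (M%:R - 1) + qcmp j + qcmp (M - 1 - j))
     (count (fun y => f y < f p) [seq y <- s | a y]).
  move=> ps ap /=; rewrite /G ap count_filter.
  have E1 : count (predI (fun y => f y < f p) a) s = count (fun y => a y && (f y < f p)) s.
    by apply: eq_count => y /=; rewrite andbC.
  rewrite E1; congr (_ + qcmp _).
  have E : M = (count (fun y => a y && (f y < f p)%R) s
      + (count (fun y => a y && (f p < f y)%R) s + 1))%N.
    have <- : count_mem p s = 1%N by rewrite count_uniq_mem ?ps.
    have D1 : count (predI (fun y => a y && (f p < f y)) (pred1 p)) s = 0%N.
      apply/eqP; rewrite -leqn0 leqNgt -has_count; apply/hasP => -[y _ /=].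
      by move=> /andP[/andP[_ +] /eqP yp]; rewrite yp ltxx.
    have D2 : (count (fun y => a y && (f p < f y)%R) s + count_mem p s)%N =
        count (predU (fun y => a y && (f p < f y)) (pred1 p)) s.
      by rewrite -count_predUI D1 addn0.
    rewrite D2.
    have D3 : count (predI (fun y => a y && (f y < f p))
        (predU (fun y => a y && (f p < f y)) (pred1 p))) s = 0%N.
      apply/eqP; rewrite -leqn0 leqNgt -has_count; apply/hasP => -[y _ /=].
      move=> /andP[/andP[_ yp]] /orP[/andP[_ py]|/eqP yp'].
        by have := lt_trans yp py; rewrite ltxx.
      by move: yp; rewrite yp' ltxx.
    rewrite -count_predUI D3 addn0; apply: eq_in_count => y ys /=.
    have [-> |yp] := eqVneq y p; first by rewrite ap orbT orbT.
    rewrite orbF -andb_orr; have [ay|//] := boolP (a y); rewrite /= -neq_lt.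
    by apply/esym; apply: contra_neq yp; exact: fi.
  by rewrite E; lia.
have S2 : \sum_(p <- s | ~~ a p) G p = \sum_(p <- s | ~~ a p) qcmp M.
  rewrite big_seq_cond [RHS]big_seq_cond; apply: eq_bigr => p /andP[ps ap].
  exact: Gout.
have S1 : \sum_(p <- s | a p) G p = \sum_(p <- [seq y <- s | a y])
    (fun j => (M%:R - 1) + qcmp j + qcmp (M - 1 - j))
     (count (fun y => f y < f p) [seq y <- s | a y]).
  rewrite big_filter big_seq_cond [RHS]big_seq_cond; apply: eq_bigr => p /andP[ps ap].
  exact: Gin.
rewrite (bigID a)/= S1 S2.
have ua : uniq [seq y <- s | a y] by exact: filter_uniq.
rewrite (@sum_rank f _ (fun j => (M%:R - 1) + qcmp j + qcmp (M - 1 - j)) ua); last first.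
  by move=> x y; rewrite !mem_filter => /andP[_ xs] /andP[_ ys]; exact: fi.
rewrite size_filter -/M sum_qcmp_split.
rewrite big_const_seq iter_addr_0 -(mulr_natl (qcmp M)) -mulrDl -natrD.
have -> : (M + count (fun i => ~~ a i) s)%N = size s by rewrite /M count_predC.
rewrite mulrA mulVf ?mul1r// pnatr_eq0.
by case: (size s) s1.
Qed.

End quicksort.

(** * Independence of the pivots *)

Section discrete_maps.
Context {d : measure_display} {T : measurableType d}.

(* Measurability with respect to the discrete sigma-algebra, when the codomain
   is countable. *)
Definition dmeas (U : Type) (f : T -> U) : Prop :=
  forall u, measurable (f @^-1` [set u]).

Lemma dmeas_set (U : countType) (f : T -> U) (A : set U) :
  dmeas f -> measurable (f @^-1` A).
Proof.
move=> mf.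
have -> : f @^-1` A = \bigcup_(u : U) (f @^-1` [set u] `&` [set _ | A u]).
  apply/seteqP; split => [w Aw|w [u _ [/= -> //]]].
  by exists (f w).
apply: countable_bigcupT_measurable => [|u]; first exact: countableP.
apply: measurableI => //; have [Au|Au] := pselect (A u).
  by rewrite (_ : [set _ | A u] = setT)//; apply/seteqP; split.
by rewrite (_ : [set _ | A u] = set0)//; apply/seteqP; split.
Qed.

(** A countable random argument may be frozen: this reduces random sizes, pivots and sublists to
    fixed ones. *)
Lemma dmeas_bind (U : countType) (V : Type) (f : T -> U) (F : U -> T -> V) :
  dmeas f -> (forall u, dmeas (F u)) -> dmeas (fun w => F (f w) w).
Proof.
move=> mf mF v.
have -> : (fun w => F (f w) w) @^-1` [set v] =
    \bigcup_(u : U) (f @^-1` [set u] `&` F u @^-1` [set v]).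
  apply/seteqP; split => [w /= Fw|w [u _ [/= -> //]]].
  by exists (f w).
apply: countable_bigcupT_measurable => [|u]; first exact: countableP.
by apply: measurableI => //; exact: mF.
Qed.

Lemma dmeas_cst (V : Type) (v : V) : dmeas (fun=> v).
Proof.
move=> u; have [uv|uv] := pselect (v = u).
  by rewrite (_ : _ @^-1` _ = setT)//; apply/seteqP; split.
by rewrite (_ : _ @^-1` _ = set0)//; apply/seteqP; split.
Qed.

Lemma dmeas_comp (U : countType) (V : Type) (h : U -> V) (f : T -> U) :
  dmeas f -> dmeas (fun w => h (f w)).
Proof.
by move=> mf; apply: (dmeas_bind (F := fun u _ => h u)) => // u; exact: dmeas_cst.
Qed.

Lemma dmeas_comp2 (U U' : countType) (V : Type) (h : U -> U' -> V)
    (f : T -> U) (g : T -> U') :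
  dmeas f -> dmeas g -> dmeas (fun w => h (f w) (g w)).
Proof.
move=> mf mg; apply: (dmeas_bind (F := fun u w => h u (g w))) => // u.
exact: dmeas_comp.
Qed.

Lemma dmeas_bool (b : T -> bool) : measurable [set w | b w] -> dmeas b.
Proof.
move=> mb [|]; first by rewrite (_ : _ @^-1` _ = [set w | b w]).
rewrite (_ : _ @^-1` _ = ~` [set w | b w]); first exact: measurableC.
by apply/seteqP; split => w /=; [move=> ->|move/negP/negbTE].
Qed.

Lemma dmeas_filter (lt : T -> nat -> bool) (s : seq nat) :
  (forall i, dmeas (fun w => lt w i)) -> dmeas (fun w => [seq y <- s | lt w y]).
Proof.
move=> mlt; elim: s => [|y s IH]; first exact: dmeas_cst.
exact: (dmeas_comp2 (fun b l => if b then y :: l else l) (mlt y) IH).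
Qed.

Lemma dmeas_sum (I : Type) (s : seq I) (F : I -> T -> nat) : (forall i, dmeas (F i)) ->
  dmeas (fun w => \sum_(i <- s) F i w)%N.
Proof.
move=> mF; elim: s => [|i s IH].
  by under eq_fun do rewrite big_nil; exact: dmeas_cst.
by under eq_fun do rewrite big_cons; exact: (dmeas_comp2 addn).
Qed.

Lemma dmeas_qs (lt : T -> rel nat) (J : seq bool -> nat -> T -> nat) fuel v s :
  (forall i j, dmeas (fun w => lt w i j)) -> (forall u n, dmeas (J u n)) ->
  dmeas (fun w => qs (lt w) (fun u n => J u n w) fuel v s).
Proof.
move=> mlt mJ; elim: fuel v s => [|m IH] v s /=; first exact: dmeas_cst.
case: (size s <= 1)%N; first exact: dmeas_cst.
apply: (dmeas_bind (F := fun i w => let p := nth 0%N s i in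
  let o := take i s ++ drop i.+1 s in [seq (y, p) | y <- o] ++
    qs (lt w) (fun u n => J u n w) m (rcons v false) [seq y <- o | lt w y p] ++
    qs (lt w) (fun u n => J u n w) m (rcons v true) [seq y <- o | lt w p y])) => // i /=.
set p := nth _ _ _; set o := take _ _ ++ _.
apply: (dmeas_comp (cat _)); apply: dmeas_comp2.
  apply: (dmeas_bind (F := fun l w => qs (lt w) (fun u n => J u n w) m (rcons v false) l)) => //.
  exact: dmeas_filter.
apply: (dmeas_bind (F := fun l w => qs (lt w) (fun u n => J u n w) m (rcons v true) l)) => //.
exact: dmeas_filter.
Qed.

Lemma dmeas_measurable (R : realType) (f : T -> nat) (D : set T) : dmeas f ->
  measurable_fun D (fun w => (f w)%:R%:E : \bar R).
Proof.
move=> mf; apply: measurable_funTS => _ Y mY; rewrite setTI.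
exact: (dmeas_set (fun n => Y (n%:R%:E))).
Qed.

Lemma dmeas_measurable_fun (R : realType) (U : countType) (f : T -> U) (h : U -> R) (D : set T) :
  dmeas f -> measurable_fun D (fun w => (h (f w))%:E).
Proof.
move=> mf; apply: measurable_funTS => _ Y mY; rewrite setTI.
exact: (dmeas_set (fun n => Y (h n)%:E)).
Qed.

Lemma integral_split_fin (R : realType) (P : probability T R)
    (F : finType) (c : T -> F) (C : set T) (f : T -> \bar R) :
  dmeas c -> measurable C -> measurable_fun setT f -> (forall w, 0 <= f w)%E ->
  (\int[P]_(w in C) f w = \sum_(x : F) \int[P]_(w in C `&` c @^-1` [set x]) f w)%E.
Proof.
move=> mc mC mf f0.
have E : C = \big[setU/set0]_(x <- index_enum F) (C `&` c @^-1` [set x]).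
  apply/seteqP; split => [w Cw|w].
    by rewrite -bigcup_seq; exists (c w) => //=; rewrite mem_index_enum.
  by rewrite -bigcup_seq => -[x _ []].
rewrite {1}E ge0_integral_bigsetU//.
- by move=> x; apply: measurableI => //; exact: mc.
- exact: index_enum_uniq.
- by move=> x y _ _ [w [[_ /= <-] [_ /= <-]]].
- exact: measurable_funTS.
Qed.

End discrete_maps.

(** * Averaging over the pivots for frozen keys *)

Section pivots.
Context {R : realType} {d : measure_display} {T : measurableType d}
  (P : probability T R) (J : seq bool -> nat -> T -> nat).
Hypothesis mJ : forall v n, dmeas (J v n).
Hypothesis J_uniform : forall v n i, (i < n)%N ->
  P (J v n @^-1` [set i]) = (n%:R^-1)%:E.

Definition pivot_cyl (r : seq (seq bool * nat)) (g : seq bool * nat -> nat) : set T :=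
  [set w | forall x, x \in r -> J x.1 x.2 w = g x].

Lemma pivot_cyl_cons x r g :
  pivot_cyl (x :: r) g = (J x.1 x.2 @^-1` [set g x]) `&` pivot_cyl r g.
Proof.
apply/seteqP; split => w /=.
  by move=> h; split => [|y yr]; apply: h; rewrite inE ?eqxx// yr orbT.
by move=> [hx hr] y; rewrite inE => /predU1P[->//|]; exact: hr.
Qed.

(* [C] is independent of the pivots chosen at node [v] and below. *)
Definition indep_below (C : set T) (v : seq bool) : Prop :=
  measurable C /\ forall r g, uniq r -> (forall x, x \in r -> prefix v x.1) ->
    P (C `&` pivot_cyl r g) =
    (P C * \prod_(x <- r) P (J x.1 x.2 @^-1` [set g x]))%E.

(** Reading the pivot at v affects no node below [rcons v b], since such addresses are strictly
    longer than v. Independence is obtained by adding (v, n) to the list of constrained pivots. *)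
Lemma indep_below_pivot C v n i b : indep_below C v -> (i < n)%N ->
  P (C `&` J v n @^-1` [set i]) = (P C * (n%:R^-1)%:E)%E /\
  indep_below (C `&` J v n @^-1` [set i]) (rcons v b).
Proof.
move=> [mC iC] lt_in.
have one : P (C `&` J v n @^-1` [set i]) = (P C * (n%:R^-1)%:E)%E.
  have := iC [:: (v, n)] (fun=> i) isT.
  rewrite big_seq1 pivot_cyl_cons/= J_uniform// => <-.
    congr (P (_ `&` _)); apply/seteqP; split => w /=; last by case.
    by move=> hw; split.
  by move=> x; rewrite inE => /eqP -> /=; exact: prefix_refl.
split=> //; split; first by apply: measurableI => //; exact: mJ.
move=> r g ur pr.
have vr : (v, n) \notin r.
  apply/negP => /pr /=; move/prefixP => [s' /(congr1 size)].
  by rewrite size_cat size_rcons; lia.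
pose g' x := if x == (v, n) then i else g x.
have gg' x : x \in r -> g' x = g x.
  by move=> xr; rewrite /g'; case: eqP => // xv; rewrite -xv xr in vr.
have := iC ((v, n) :: r) g'; rewrite /= vr ur => /(_ isT).
have g'v : g' (v, n) = i by rewrite /g' eqxx.
rewrite pivot_cyl_cons big_cons /= g'v J_uniform// => h; rewrite one.
have -> : C `&` J v n @^-1` [set i] `&` pivot_cyl r g =
    C `&` (J v n @^-1` [set i] `&` pivot_cyl r g').
  rewrite -setIA; congr (_ `&` (_ `&` _)); apply/seteqP; split => w h' x xr.
    by rewrite gg'// h'.
  by rewrite -gg'// h'.
rewrite h; last first.
  move=> x; rewrite inE => /predU1P[-> /=|/pr]; first exact: prefix_refl.
  exact: prefix_trans (prefix_rcons v b).
rewrite muleA; congr (_ * _)%E.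
rewrite big_seq [RHS]big_seq; apply: eq_bigr => x xr; by rewrite gg'.
Qed.

Definition pair_count (a : pred nat) (l : seq (nat * nat)) : nat :=
  count (fun c => a c.1 && a c.2) l.

Lemma integral_pivot_split (C : set T) v n (f : T -> nat) : indep_below C v ->
  (0 < n)%N -> dmeas f ->
  (\int[P]_(w in C) (f w)%:R%:E =
   \sum_(i < n) \int[P]_(w in C `&` J v n @^-1` [set (i : nat)]) (f w)%:R%:E)%E.
Proof.
move=> iC n0 mf; have [mC _] := iC.
(* The value n collects the positions out of range; [Pmax] shows that it is null, since the n
   admissible positions already have total probability 1. *)
pose c w : 'I_n.+1 := inord (minn (J v n w) n).
have mc : dmeas c by exact: (dmeas_comp (fun k => inord (minn k n) : 'I_n.+1)).
have cE (i : 'I_n) : c @^-1` [set widen_ord (leqnSn n) i] = J v n @^-1` [set (i : nat)].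
  apply/seteqP; split => w /=.
    move=> /(congr1 val); rewrite /c/= inordK ?ltnS ?geq_minr//.
    by have := ltn_ord i; lia.
  move=> Ji; apply: val_inj; rewrite /c Ji /= inordK ?ltnS ?geq_minr//.
  by apply/minn_idPl; exact: ltnW.
have mf' D : measurable_fun D (fun w => (f w)%:R%:E : \bar R) by exact: dmeas_measurable.
have Pmax : P (c @^-1` [set ord_max]) = 0%E.
  have := integral_split_fin P (f := cst 1%E) mc measurableT (measurable_cst _) (fun _ => lee01).
  have h0 A : measurable A -> (\int[P]_(w in A) cst 1 w = P A)%E.
    by move=> mA; rewrite integral_cst// mul1e.
  rewrite h0// probability_setT.
  rewrite (eq_bigr (fun x => P (c @^-1` [set x]))); last first.
    by move=> x _; rewrite setTI h0//; exact: mc.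
  rewrite big_ord_recr/=.
  rewrite (eq_bigr (fun=> (n%:R^-1)%:E)); last first.
    by move=> i _; rewrite cE J_uniform.
  rewrite sumEFin sumr_const card_ord -(mulr_natl n%:R^-1) divff ?pnatr_eq0 -?lt0n//.
  have Pf : P (c @^-1` [set ord_max]) \is a fin_num := fin_num_measure P _ (mc _).
  move=> h; move: Pf h; case: (P _) => // x _; rewrite -EFinD => -[] e.
  by congr EFin; lra.
rewrite (integral_split_fin P mc mC (mf' setT))//.
rewrite big_ord_recr/= [X in (_ + X)%E](_ : _ = 0%E) ?adde0.
  by apply: eq_bigr => i _; rewrite cE.
apply: null_set_integral; first by apply: measurableI => //; exact: mc.
  exact: mf'.
apply/eqP; rewrite eq_le measure_ge0 andbT -Pmax.
apply: le_measure; [|rewrite inE; exact: mc|by move=> w []].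
by rewrite inE; apply: measurableI => //; exact: mc.
Qed.

Lemma integral_nat_add (C : set T) (f g : T -> nat) : measurable C ->
  dmeas f -> dmeas g ->
  (\int[P]_(w in C) (f w + g w)%N%:R%:E =
   \int[P]_(w in C) (f w)%:R%:E + \int[P]_(w in C) (g w)%:R%:E)%E.
Proof.
move=> mC mf mg; rewrite -ge0_integralD//; try exact: dmeas_measurable.
by apply: eq_integral => w _; rewrite natrD EFinD.
Qed.

(** Induction on the fuel with C varying: the event absorbs each pivot once it is read. The same
    enlarged event serves both recursive calls, and linearity separates them. *)
Lemma integral_pair_count (lt : rel nat) (a : pred nat) fuel v s (C : set T) :
  indep_below C v ->
  (\int[P]_(w in C) (pair_count a (qs lt (fun u n => J u n w) fuel v s))%:R%:E =
   (fine (P C) * qe lt a fuel s)%:E)%E.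
Proof.
have mq u k l : dmeas (fun w => pair_count a (qs lt (fun u n => J u n w) k u l)).
  apply: (dmeas_comp (pair_count a)); apply: (dmeas_qs (lt := fun=> lt)) => //.
  by move=> i j; exact: dmeas_cst.
have pc0 : pair_count a [::] = 0%N by [].
elim: fuel v s C => [|m IH] v s C iC /=.
  by rewrite mulr0 integral0_eq.
case: ifP => [_|/negbT]; first by rewrite mulr0 integral0_eq.
rewrite -ltnNge => s1; have s0 : (0 < size s)%N by exact: ltnW.
have [mC _] := iC.
rewrite (integral_pivot_split iC s0); last first.
  by have := mq v m.+1 s; rewrite /= leqNgt s1.
rewrite mulrA mulr_sumr -sumEFin; apply: eq_bigr => i _.
have [E iL] := indep_below_pivot false iC (ltn_ord i).
have [_ iR] := indep_below_pivot true iC (ltn_ord i).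
have [mCi _] := iL.
have fE : fine (P (C `&` J v (size s) @^-1` [set (i : nat)])) =
    fine (P C) / (size s)%:R.
  by rewrite E fineM//; exact: fin_num_measure.
set p := nth _ _ _; set o := take _ _ ++ _.
pose K := count (fun y => a y && a p) o.
transitivity (\int[P]_(w in C `&` J v (size s) @^-1` [set (i : nat)])
    (K + (pair_count a (qs lt (fun u n => J u n w) m (rcons v false) [seq y <- o | lt y p])
     + pair_count a (qs lt (fun u n => J u n w) m (rcons v true) [seq y <- o | lt p y])))%N%:R%:E)%E.
  apply: eq_integral => w; rewrite inE => -[_ /= ->].
  rewrite -/p -/o /pair_count !count_cat count_map.
  by congr ((_ + _)%N%:R%:E); apply: eq_count.
rewrite integral_nat_add//; last 2 first.
- exact: dmeas_cst.
- by apply: (dmeas_comp2 addn).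
rewrite integral_nat_add// (IH _ _ _ iL) (IH _ _ _ iR) fE.
rewrite integral_cst// -[X in (_ * X)%E]fineK ?fin_num_measure// fE.
by rewrite -EFinM -!EFinD; congr EFin; ring.
Qed.

End pivots.

(** * Independence of the pivots from the keys and their number *)

Section independence.
Context {R : realType} {d : measure_display} {T : measurableType d}
  (P : probability T R) (X : nat -> {RV P >-> R}) (N : {RV P >-> nat})
  (J : seq bool -> nat -> {RV P >-> nat}).
Hypothesis indep : mutually_independent P
  (model_events (fun j => X j : T -> R) N (fun v n => J v n : T -> nat)).

Lemma dmeas_RV (Z : {RV P >-> nat}) : dmeas (Z : T -> nat).
Proof. by move=> u; rewrite -[_ @^-1` _]setTI; apply: measurable_funP. Qed.

Let idx : choiceType := (unit + nat + seq bool * nat)%type.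

Lemma indep_seq (r : seq idx) (E : idx -> set T) : uniq r ->
  (forall i, i \in r -> model_events (fun j => X j : T -> R) N (fun v n => J v n : T -> nat) i (E i)) ->
  P [set w | forall i, i \in r -> E i w] = (\prod_(i <- r) P (E i))%E.
Proof.
move=> ur hE.
have := indep (S := [fset i in r]%fset) (E := E).
have pr : perm_eq [fset i in r]%fset r.
  by apply: uniq_perm => // i; rewrite inE.
rewrite (perm_big _ pr) => <-.
  congr (P _); apply/seteqP; split => w h i /= ir.
    by apply: h; move: ir; rewrite inE.
  by apply: h; rewrite /= inE.
by move=> i; rewrite inE; exact: hE.
Qed.

Definition key_cyl (E0 : set nat) (E : nat -> set R) : set T :=
  [set w | E0 (N w) /\ forall j, E j (X j w)].

Definition key_cylinders : set (set T) :=
  [set A | exists E0 E m, [/\ forall j, measurable (E j),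
     forall j, (m <= j)%N -> E j = setT & A = key_cyl E0 E]].

Lemma key_cylindersI : setI_closed key_cylinders.
Proof.
move=> _ _ [E0 [E [m [mE hE ->]]]] [F0 [F [n [mF hF ->]]]].
exists (E0 `&` F0), (fun j => E j `&` F j), (maxn m n); split.
- by move=> j; exact: measurableI.
- by move=> j; rewrite geq_max => /andP[mj nj]; rewrite hE// hF// setIT.
- apply/seteqP; split => [w [[a b] [c e]]|w [[a c] h]].
    by split; [split|move=> j; split].
  by split; split => // j; have [] := h j.
Qed.

Lemma key_pivot_cyl_prob E0 E m r g :
  (forall j, measurable (E j)) -> (forall j, (m <= j)%N -> E j = setT) -> uniq r ->
  P (key_cyl E0 E `&` pivot_cyl (fun v n => J v n : T -> nat) r g) =
  (P (N @^-1` E0) * \prod_(j < m) P (X j @^-1` E j) *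
   \prod_(x <- r) P (J x.1 x.2 @^-1` [set g x]))%E.
Proof.
move=> mE hE ur.
pose F (i : idx) : set T := match i with
  | inl (inl _) => N @^-1` E0
  | inl (inr j) => X j @^-1` E j
  | inr x => J x.1 x.2 @^-1` [set g x] end.
pose r1 : seq idx := inl (inl tt) :: [seq inl (inr j) | j <- iota 0 m].
have ur1 : uniq r1.
  rewrite /r1 /= map_inj_uniq ?iota_uniq ?andbT; last by move=> j k [].
  by apply/mapP => -[].
have ur2 : uniq (r1 ++ [seq (inr x : idx) | x <- r]).
  rewrite cat_uniq ur1 map_inj_uniq ?ur ?andbT/=; last by move=> x y [].
  apply/hasPn => _ /mapP[x _ ->]; rewrite /r1 inE /=.
  by apply/mapP => -[].
have hF i : i \in r1 ++ [seq (inr x : idx) | x <- r] ->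
    model_events (fun j => X j : T -> R) N (fun v n => J v n : T -> nat) i (F i).
  move=> _; case: i => [[[]|j]|[v n]] /=; rewrite /generated_events.
  - by exists E0; rewrite ?setTI.
  - by exists (E j); rewrite ?setTI.
  - by exists [set g (v, n)]; rewrite ?setTI.
have h2 := indep_seq ur2 hF.
have k1 : [set w | forall i, i \in r1 -> F i w] = key_cyl E0 E.
  apply/seteqP; split => w /=.
    move=> h; split; first by have := h (inl (inl tt)); rewrite inE eqxx; apply.
    move=> j; have [mj|jm] := leqP m j; first by rewrite hE.
    by have := h (inl (inr j)); apply; rewrite inE /= map_f// mem_iota.
  move=> [h0 h] i; rewrite inE => /predU1P[->//|/mapP[j _ ->]].
  exact: h.
have k2 (q : seq idx) (r' : seq (seq bool * nat)) :
    [set w | forall i, i \in q ++ [seq (inr x : idx) | x <- r'] -> F i w] =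
    [set w | forall i, i \in q -> F i w] `&` pivot_cyl (fun v n => J v n : T -> nat) r' g.
  apply/seteqP; split => w /=.
    move=> h; split => [i ir|x xr]; first by apply: h; rewrite mem_cat ir.
    have := h (inr x); apply; rewrite mem_cat; apply/orP; right.
    by apply/mapP; exists x.
  by move=> [h h'] i; rewrite mem_cat => /orP[|/mapP[x xr ->]]; [exact: h|exact: h'].
rewrite -k1 -k2 h2 big_cat big_map big_cons big_map.
by rewrite -(big_mkord xpredT (fun j => P (X j @^-1` E j))) /index_iota subn0.
Qed.

Lemma key_cyl_prob E0 E m :
  (forall j, measurable (E j)) -> (forall j, (m <= j)%N -> E j = setT) ->
  P (key_cyl E0 E) = (P (N @^-1` E0) * \prod_(j < m) P (X j @^-1` E j))%E.
Proof.
move=> mE hE.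
have := @key_pivot_cyl_prob E0 E m [::] (fun=> 0%N) mE hE isT.
rewrite big_nil mule1 (_ : pivot_cyl _ _ _ = setT) ?setIT//.
by apply/seteqP; split.
Qed.

Lemma key_cylinder_indep E0 E m r g :
  (forall j, measurable (E j)) -> (forall j, (m <= j)%N -> E j = setT) -> uniq r ->
  P (key_cyl E0 E `&` pivot_cyl (fun v n => J v n : T -> nat) r g) =
  (P (key_cyl E0 E) * \prod_(x <- r) P (J x.1 x.2 @^-1` [set g x]))%E.
Proof.
by move=> mE hE ur; rewrite (key_pivot_cyl_prob _ _ mE hE ur) (key_cyl_prob _ mE hE).
Qed.

Lemma measurable_pivot_cyl r g : measurable (pivot_cyl (fun v n => J v n : T -> nat) r g).
Proof.
elim: r => [|x r IH].
  by rewrite (_ : pivot_cyl _ _ _ = setT)//; apply/seteqP; split.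
by rewrite pivot_cyl_cons; apply: measurableI => //; exact: dmeas_RV.
Qed.

Lemma measurable_key_cyl E0 E : (forall j, measurable (E j)) -> measurable (key_cyl E0 E).
Proof.
move=> mE.
have -> : key_cyl E0 E = N @^-1` E0 `&` \bigcap_j (X j @^-1` E j).
  by apply/seteqP; split => w [h0 h]; split => // j; [move=> _|]; exact: h.
apply: measurableI; first by exact: (dmeas_set E0 (@dmeas_RV N)).
apply: bigcap_measurable => // j _.
by rewrite -[_ @^-1` _]setTI; apply: measurable_funP.
Qed.

(* Dynkin's lambda-pi theorem extends independence from cylinders. *)
Lemma sigma_keys_indep A : <<s key_cylinders >> A ->
  indep_below P (fun v n => J v n : T -> nat) A [::].
Proof.
move=> sA; suff H r g : uniq r -> <<s key_cylinders >> `<=`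
    [set A | measurable A /\ P (A `&` pivot_cyl (fun v n => J v n : T -> nat) r g) =
      (P A * \prod_(x <- r) P (J x.1 x.2 @^-1` [set g x]))%E].
  split; first by have [] := H [::] (fun=> 0%N) isT A sA.
  by move=> r g ur _; have [] := H r g ur A sA.
move=> ur; set D := pivot_cyl _ r g; set Q := (\prod_(x <- r) _)%E.
have mD : measurable D by exact: measurable_pivot_cyl.
have PD : P D = Q.
  have := @key_cylinder_indep setT (fun=> setT) 0 r g (fun=> measurableT) (fun _ _ => erefl) ur.
  rewrite (_ : key_cyl _ _ = setT) ?setTI ?probability_setT ?mul1e//.
  by apply/seteqP; split.
rewrite -PD.
apply: lambda_system_subset => //; first exact: key_cylindersI.
apply/dynkin_lambda_system; split.
- by split => //; rewrite setTI probability_setT mul1e.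
- move=> B [mB hB]; split; first exact: measurableC.
  have -> : ~` B `&` D = D `\` B by rewrite setDE setIC.
  have Dfin : (P D < +oo)%E by rewrite (le_lt_trans (probability_le1 P mD))// ltry.
  have PDf : P D \is a fin_num := fin_num_measure P D mD.
  have PBf : P B \is a fin_num := fin_num_measure P B mB.
  have hB' : P (D `&` B) = (P B * P D)%E by rewrite setIC.
  have hD : P (D `\` B) = (P D - P (D `&` B))%E by exact: measureD.
  rewrite hD hB' (probability_setC P mB).
  move: PDf PBf; case: (P D) => // x _; case: (P B) => // y _.
  by rewrite -EFinM -EFinB -[1%E]/(1%:E) -EFinB -EFinM; congr EFin; ring.
- move=> F tF hF; split; first by apply: bigcup_measurable => k _; have [] := hF k.
  rewrite setI_bigcupl measure_semi_bigcup//; last 3 first.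
  + by move=> k; apply: measurableI => //; have [] := hF k.
  + by apply: trivIset_setIr.
  + by apply: bigcup_measurable => k _; apply: measurableI => //; have [] := hF k.
  rewrite measure_semi_bigcup//; last 2 first.
  + by move=> k; have [] := hF k.
  + by apply: bigcup_measurable => k _; have [] := hF k.
  rewrite (eq_eseriesr (g := fun k => (P D * P (F k))%E)); last first.
    by move=> k _; have [_ e] := hF k; exact: etrans e (muleC _ _).
  rewrite -[P D in LHS]fineK ?fin_num_measure// nneseriesZl// fineK ?fin_num_measure//.
  by rewrite muleC.
- move=> _ [E0 [E [m [mE hE ->]]]]; split; first exact: measurable_key_cyl.
  by rewrite (key_cylinder_indep _ _ mE hE ur) PD.
Qed.

End independence.

(** * Bits, dyadic blocks and Poisson thinning *)

Section bits.
Context {R : realType}.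
Implicit Types (x y : R) (k : nat).

Definition block k x : int := Num.floor (2 ^+ k * x).

Lemma block0 x : 0 <= x < 1 -> block 0 x = 0.
Proof. by move=> x01; apply: floor_def; rewrite expr0 mul1r. Qed.

Lemma block_ge0 k x : 0 <= x -> 0 <= block k x.
Proof. by move=> x0; rewrite floor_ge0 mulr_ge0 ?exprn_ge0. Qed.

Lemma blockS k x : 0 <= x -> block k.+1 x = 2 * block k x + (bit k.+1 x : nat)%:Z.
Proof.
move=> x0; rewrite /bit -/(block k.+1 x).
have := block_ge0 k.+1 x0.
have := ge_floor (2 ^+ k.+1 * x); have := lt_succ_floor (2 ^+ k.+1 * x).
rewrite -/(block k.+1 x); case: (block k.+1 x) => // n h2 h1 _.
rewrite -pmulrn in h1.
have nE : n = (odd n + (n./2).*2)%N by rewrite odd_double_half.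
suff -> : block k x = n./2%:Z.
  by rewrite /= {1}nE PoszD addrC -muln2 PoszM mulrC.
have e2 : 2 ^+ k.+1 * x = 2 * (2 ^+ k * x) by rewrite exprS mulrA.
rewrite e2 in h1 h2.
have nR : n%:R = (odd n)%:R + 2 * (n./2)%:R :> R.
  by rewrite {1}nE natrD -muln2 natrM mulrC.
have o1 : (0 <= (odd n)%:R :> R) && ((odd n)%:R <= 1 :> R) by rewrite ler0n lern1 leq_b1.
apply: floor_def; rewrite intrD1 -pmulrn.
rewrite intrD1 -pmulrn in h2.
case/andP: o1 => ? ?; apply/andP; split; lra.
Qed.

Lemma block_eqP k x y : 0 <= x < 1 -> 0 <= y < 1 ->
  reflect (forall j, (0 < j <= k)%N -> bit j x = bit j y) (block k x == block k y).
Proof.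
move=> x01 y01; have /andP[x0 _] := x01; have /andP[y0 _] := y01.
apply: (iffP eqP).
  elim: k => [|k IH]; first by move=> _ j; case: j.
  rewrite !blockS// => e j /andP[j0]; rewrite leq_eqVlt ltnS => /predU1P[->|jk].
    by move: e; case: (bit k.+1 x); case: (bit k.+1 y) => //=; lia.
  apply: IH; last by rewrite j0.
  by move: e; case: (bit k.+1 x); case: (bit k.+1 y) => /=; lia.
elim: k => [|k IH] h; first by rewrite !block0.
rewrite !blockS// h ?ltnSn// IH// => j /andP[j0 jk]; apply: h.
by rewrite j0 ltnW.
Qed.

(** Level 0 has one block, so the cost b is the number of levels k = 0, ..., b - 1 at which x and y
    share a block. Distinct keys do separate: once 2^n > 1 / |x - y| their blocks differ. *)
Lemma first_diff_bitP x y k : 0 < x < 1 -> 0 < y < 1 -> x != y ->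
  (block k x == block k y) = (k < first_diff_bit x y)%N.
Proof.
move=> /andP[x0 x1] /andP[y0 y1] xy.
have x01 : 0 <= x < 1 by rewrite ltW.
have y01 : 0 <= y < 1 by rewrite ltW.
have [n hn] : exists n, block n x != block n y.
  exists (Num.bound (`|x - y|^-1)); set n := Num.bound _.
  have h := archi_boundP (x := `|x - y|^-1); rewrite invr_ge0 normr_ge0 in h.
  have {}h := lt_trans (h isT) (_ : n%:R < 2 ^+ n).
  apply/eqP => e.
  have d1 : `|2 ^+ n * x - 2 ^+ n * y| < 1.
    have := ge_floor (2 ^+ n * x); have := lt_succ_floor (2 ^+ n * x).
    have := ge_floor (2 ^+ n * y); have := lt_succ_floor (2 ^+ n * y).
    rewrite -/(block n x) -/(block n y) e !intrD1 => ? ? ? ?.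
    by rewrite ltr_norml; apply/andP; split; lra.
  rewrite -mulrBr normrM ger0_norm ?exprn_ge0// in d1.
  have h1 : `|x - y|^-1 < 2 ^+ n by apply: h; rewrite -natrX ltr_nat ltn_expl.
  have xy0 : 0 < `|x - y| by rewrite normr_gt0 subr_eq0.
  rewrite -(ltr_pM2r xy0) mulVf ?gt_eqF// in h1.
  by have := lt_trans h1 d1; rewrite ltxx.
have ex : exists k, (0 < k)%N && (bit k x != bit k y).
  apply: contrapT => nex; move/negP : hn; apply; apply/block_eqP => // j /andP[j0 _].
  by apply: contrapT => /eqP bj; apply: nex; exists j; rewrite j0.
rewrite /first_diff_bit; case: pselect => [ex'|//].
case: ex_minnP => b /andP[b0 bb] bmin.
apply/block_eqP/idP => //.
  by move=> h; rewrite ltnNge; apply/negP => bk; move: bb; rewrite h ?eqxx// b0.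
move=> kb j /andP[j0 jk]; apply/eqP; apply/negPn/negP => bj.
have := bmin j; rewrite j0 bj => /(_ isT).
by move=> bj'; have := leq_trans (leq_ltn_trans jk kb) bj'; rewrite ltnn.
Qed.

Lemma block_lt k x : 0 <= x < 1 -> exists l : 'I_(2 ^ k), block k x = (l : nat)%:Z.
Proof.
move=> /andP[x0 x1]; have := block_ge0 k x0.
have h : block k x < (2 ^ k)%N%:Z.
  by rewrite floor_lt_int -pmulrn natrX -[ltRHS]mulr1 ltr_pM2l ?exprn_gt0.
move: h; case: (block k x) => // n h _.
have hn : (n < 2 ^ k)%N by [].
by exists (Ordinal hn).
Qed.

Lemma sum_block (k : nat) x y : 0 <= x < 1 -> 0 <= y < 1 ->
  (\sum_(l < 2 ^ k) ((block k x == (l : nat)%:Z) && (block k y == (l : nat)%:Z)) =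
   (block k x == block k y))%N.
Proof.
move=> x01 y01; have [l0 El0] := block_lt k x01.
rewrite (bigD1 l0)//= El0 eqxx /= big1 ?addn0; first by rewrite eq_sym.
move=> l ll0; case: eqP => //= -[] /val_inj e; by rewrite e eqxx in ll0.
Qed.

Lemma sum_lt_series (b : nat) :
  (\sum_(k <oo) ((k < b)%N : nat)%:R%:E = (b%:R)%:E :> \bar R)%E.
Proof.
rewrite (@nneseries_split _ _ 0 b)// add0n big_mkord eseries0 ?adde0.
  rewrite (eq_bigr (fun=> 1%E)); last by move=> i _; rewrite ltn_ord.
  by rewrite sumEFin sumr_const card_ord.
by move=> k bk _; rewrite ltnNge bk.
Qed.

Lemma bits_series (key : nat -> R) (l : seq (nat * nat)) :
  {in l, forall c, [/\ 0 < key c.1 < 1, 0 < key c.2 < 1 & key c.1 != key c.2]} ->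
  ((\sum_(c <- l) first_diff_bit (key c.1) (key c.2))%N%:R%:E =
   \sum_(k <oo) (\sum_(i < 2 ^ k)
     pair_count (fun j => block k (key j) == (i : nat)%:Z) l)%N%:R%:E :> \bar R)%E.
Proof.
elim: l => [|c l IH] hl.
  rewrite big_nil eseries0// => k _ _.
  by rewrite big1.
rewrite big_cons natrD EFinD IH; last by move=> x xl; apply: hl; rewrite inE xl orbT.
have [c1 c2 c12] := hl c (mem_head c l).
rewrite -sum_lt_series -nneseriesD//.
apply: eq_eseriesr => k _; rewrite -EFinD -natrD -first_diff_bitP//.
rewrite -sum_block; last 2 first.
- by case/andP: c1 => /ltW -> ->.
- by case/andP: c2 => /ltW -> ->.
by rewrite -big_split.
Qed.

Lemma block_convex k (m : int) (x y z : R) : block k x == m -> block k z == m ->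
  x < y -> y < z -> block k y == m.
Proof.
move=> /eqP xm /eqP zm xy yz; rewrite eq_le -{1}zm -xm.
by apply/andP; split; apply: le_floor; rewrite ler_pM2l ?exprn_gt0// ltW.
Qed.

Lemma block_itv k (m : nat) : [set x : R | block k x == m%:Z] =
  `[m%:R / 2 ^+ k, m.+1%:R / 2 ^+ k[%classic.
Proof.
have k0 : 0 < 2 ^+ k :> R by rewrite exprn_gt0.
apply/seteqP; split => x /=; rewrite in_itv/= ler_pdivrMr// ltr_pdivlMr// mulrC.
  rewrite floor_eq intrD1 -pmulrn natr1; exact.
by rewrite floor_eq intrD1 -pmulrn natr1.
Qed.

Lemma dmeas_block {d} {T : measurableType d} (f : T -> R) k :
  measurable_fun setT f -> dmeas (fun w => block k (f w)).
Proof.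
move=> mf m.
have -> : (fun w => block k (f w)) @^-1` [set m] =
    f @^-1` `[m%:~R / 2 ^+ k, (m + 1)%:~R / 2 ^+ k[%classic.
  have k0 : 0 < 2 ^+ k :> R by rewrite exprn_gt0.
  apply/seteqP; split => w /=; rewrite in_itv/= ler_pdivrMr// ltr_pdivlMr// mulrC.
    by move/eqP; rewrite floor_eq.
  by move=> h; apply/eqP; rewrite floor_eq.
by rewrite -[_ @^-1` _]setTI; apply: mf => //; exact: measurable_itv.
Qed.

(** The value is determined by countably many bits; the event of value 0 is the one where no bit
    differs, which is the second part of the union. *)
Lemma dmeas_first_diff_bit {d} {T : measurableType d} (f g : T -> R) :
  measurable_fun setT f -> measurable_fun setT g ->
  dmeas (fun w => first_diff_bit (f w) (g w)).
Proof.
move=> mf mg.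
pose E k w := (0 < k)%N && (bit k (f w) != bit k (g w)).
have mE k : dmeas (E k).
  have mb (h : T -> R) : measurable_fun setT h -> dmeas (fun w => bit k (h w)).
    by move=> mh; exact: (dmeas_comp (fun m : int => odd `|m|%N) (dmeas_block k mh)).
  exact: (dmeas_comp2 (fun b b' => (0 < k)%N && (b != b')) (mb _ mf) (mb _ mg)).
have mE1 k : measurable [set w | E k w].
  by rewrite (_ : [set w | E k w] = E k @^-1` [set true])//; exact: mE.
have mE0 k : measurable [set w | ~~ E k w].
  rewrite (_ : [set w | ~~ E k w] = E k @^-1` [set false]); first exact: mE.
  by apply/seteqP; split => w /=; [move/negbTE|move=> ->].
move=> n; have fE w : first_diff_bit (f w) (g w) = n <->
    (E n w /\ forall j, (j < n)%N -> ~~ E j w) \/ (n = 0%N /\ forall j, ~~ E j w).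
  rewrite /first_diff_bit; case: pselect => [ex|nex].
    case: ex_minnP => b Eb bmin; split => [<-|].
      left; split => // j jb; apply/negP => Ej; have := bmin j Ej.
      by rewrite leqNgt jb.
    case => [[En hn]|[_ h]]; last by have := h b; rewrite /E Eb.
    have [bn|nb|//] := ltngtP b n; first by have := hn b bn; rewrite /E Eb.
    by have := bmin n En; rewrite leqNgt nb.
  split => [<-|]; first by right; split => // j; apply/negP => Ej; apply: nex; exists j.
  by case=> [[En _]|[]//]; exfalso; apply: nex; exists n.
have -> : (fun w => first_diff_bit (f w) (g w)) @^-1` [set n] =
    ([set w | E n w] `&` \bigcap_(j in [set j | (j < n)%N]) [set w | ~~ E j w]) `|`
    ([set _ | n = 0%N] `&` \bigcap_j [set w | ~~ E j w]).
  apply/seteqP; split => w /=.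
    move/fE => [[a b]|[a b]]; [left|right]; split => //.
    by move=> j _; exact: b.
  by move=> [[a b]|[a b]]; apply/fE; [left|right]; split => // j; exact: b.
apply: measurableU; apply: measurableI => //.
- exact: bigcap_measurableType.
- by case: n {fE} => [|n]; [rewrite (_ : [set _ | _] = setT)|rewrite (_ : [set _ | _] = set0)]
    => //; apply/seteqP; split.
- exact: bigcapT_measurable.
Qed.

End bits.

(** * Poisson thinning *)

Section thinning.
Context {R : realType}.

(** After exchanging the sums and setting n = j + m, the weight factors into the Poisson weight of m
    and an exponential series in l (1 - p). *)
Lemma poisson_thinning (l p : R) (q : nat -> R) : 0 < l -> 0 < p <= 1 ->
  (forall m, 0 <= q m) ->
  (\sum_(n <oo) (poisson_pmf l n *
      \sum_(m < n.+1) 'C(n, m)%:R * p ^+ m * (1 - p) ^+ (n - m) * q m)%:E =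
   \sum_(m <oo) (poisson_pmf (l * p) m * q m)%:E)%E.
Proof.
move=> l0 /andP[p0 p1] q0.
have lp0 : 0 < l * p by rewrite mulr_gt0.
have p10 : 0 <= 1 - p by rewrite subr_ge0.
pose a n m : R := if (m <= n)%N then poisson_pmf l n *
   ('C(n, m)%:R * p ^+ m * (1 - p) ^+ (n - m) * q m) else 0.
have a0 n m : (0 <= (a n m)%:E)%E.
  rewrite lee_fin /a; case: ifP => // _.
  by rewrite !mulr_ge0 ?poisson_pmf_ge0 ?exprn_ge0 ?(ltW p0).
transitivity (\sum_(n <oo) \sum_(m <oo) (a n m)%:E)%E.
  apply: eq_eseriesr => n _.
  rewrite (@nneseries_split _ _ 0 n.+1)// add0n big_mkord eseries0 ?adde0; last first.
    by move=> m nm _; rewrite /a leqNgt nm.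
  rewrite sumEFin mulr_sumr; congr EFin; apply: eq_bigr => m _.
  by rewrite /a -ltnS ltn_ord.
rewrite nneseries_interchange//; apply: eq_eseriesr => m _.
rewrite (@nneseries_split _ _ 0 m)// add0n big_mkord big1 ?add0e; last first.
  by move=> i _; rewrite /a leqNgt ltn_ord.
rewrite -nneseries_addn//.
transitivity (\sum_(j <oo) (expR (- l) * ((l * p) ^+ m / m`!%:R) * q m)%:E *
    ((l * (1 - p)) ^+ j / j`!%:R)%:E)%E.
  apply: eq_eseriesr => j _; rewrite -EFinM /a leq_addl addnK /poisson_pmf l0.
  congr EFin; have := bin_fact (leq_addl j m); rewrite addnK => e.
  have eR : (j + m)`!%:R = 'C(j + m, m)%:R * (m`!%:R * j`!%:R) :> R by rewrite -!natrM e.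
  have f1 : m`!%:R != 0 :> R by rewrite pnatr_eq0 -lt0n fact_gt0.
  have f2 : j`!%:R != 0 :> R by rewrite pnatr_eq0 -lt0n fact_gt0.
  have f3 : 'C(j + m, m)%:R != 0 :> R by rewrite pnatr_eq0 -lt0n bin_gt0 leq_addl.
  rewrite eR !exprMn exprD; move: f1 f2 f3.
  move: (m`!%:R : R) (j`!%:R : R) ('C(j + m, m)%:R : R) => x y z x0 y0 z0.
  by field; rewrite x0 y0 z0.
rewrite nneseriesZl; last first.
  by move=> j _; rewrite lee_fin divr_ge0// exprn_ge0// mulr_ge0// ltW.
rewrite exp_eseries ?mulr_ge0 ?(ltW l0)// -EFinM /poisson_pmf lp0; congr EFin.
have -> : expR (- (l * p)) = expR (- l) * expR (l * (1 - p)).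
  by rewrite -expRD; congr expR; ring.
ring.
Qed.

End thinning.

(** * Null events *)

Lemma dmeas_ffun {d} {T : measurableType d} (I : finType) (V : eqType) (F : I -> T -> V) :
  (forall i, dmeas (F i)) -> dmeas (fun w => [ffun i => F i w]).
Proof.
move=> mF g.
have -> : (fun w => [ffun i => F i w]) @^-1` [set g] = \bigcap_(i in [set: I]) F i @^-1` [set g i].
  apply/seteqP; split => w /= h; first by move=> i _ /=; rewrite -h ffunE.
  by apply/ffunP => i; rewrite ffunE; exact: h.
by apply: fin_bigcap_measurable => [|i _]; [exact: finite_finset|exact: mF].
Qed.

Lemma qs_le (lt : rel nat) pivot fuel v s n : {in s, forall j, (j <= n)%N} ->
  {in qs lt pivot fuel v s, forall c, (c.1 <= n)%N && (c.2 <= n)%N}.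
Proof.
elim: fuel v s => //= m IH v s sn; case: ifP => // _.
set i := pivot v (size s); set p := nth 0%N s i; set o := take i s ++ drop _ s.
have pn : (p <= n)%N.
  rewrite /p; have [lt_is|le_si] := ltnP i (size s); last by rewrite nth_default.
  by apply: sn; exact: mem_nth.
have on : {in o, forall j, (j <= n)%N}.
  by move=> j; rewrite mem_cat => /orP[/mem_take|/mem_drop]; exact: sn.
move=> c; rewrite !mem_cat => /or3P[/mapP[y yo -> /=]|h|h].
- by rewrite on.
- by apply: IH h => j; rewrite mem_filter => /andP[_]; exact: on.
- by apply: IH h => j; rewrite mem_filter => /andP[_]; exact: on.
Qed.

Section model.
Context {R : realType} {d : measure_display} {T : measurableType d}
  (P : probability T R) (lambda : R) (X : nat -> {RV P >-> R}) (N : {RV P >-> nat})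
  (J : seq bool -> nat -> {RV P >-> nat}).
Hypothesis model : poisson_quicksort lambda X N J.

(* Key number j is X_j, so that [X] is shifted by one. *)
Definition key (w : T) (j : nat) : R := if j is i.+1 then X i w else 0.

Let kc := key_cylinders X N.

(** Measurability for the sigma-algebra of the keys and of N alone, whose events are independent of
    the pivots. *)
Lemma measurable_keys j : measurable_fun setT (X j : g_sigma_algebraType kc -> R).
Proof.
move=> _ Y mY; rewrite setTI; apply: sub_sigma_algebra.
exists setT, (fun i => if i == j then Y else setT), j.+1; split.
- by move=> i; case: ifP.
- by move=> i ji; rewrite gtn_eqF.
- apply/seteqP; split => w /=.
    by move=> Yw; split => // i; case: eqP => // ->.
  by move=> [_ /(_ j)]; rewrite eqxx.
Qed.

Lemma dmeas_size : dmeas (N : g_sigma_algebraType kc -> nat).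
Proof.
move=> n; apply: sub_sigma_algebra; exists [set n], (fun=> setT), 0%N; split => //.
by apply/seteqP; split => w; [move=> h; split|case].
Qed.

Lemma measurable_key j : measurable_fun setT (key^~ j : g_sigma_algebraType kc -> R).
Proof. by case: j => [|j] //=; exact: measurable_keys. Qed.

Lemma key_prob j (A : set R) : measurable A -> A `<=` `[0, 1] ->
  P (X j @^-1` A) = lebesgue_measure A.
Proof.
move=> mA A01; have := keys_uniform model j mA; rewrite /distribution /pushforward => ->.
rewrite /uniform_prob (eq_integral (fun=> 1%E)); first by rewrite integral_cst// mul1e.
move=> x; rewrite inE => /A01/=; rewrite in_itv /= /uniform_pdf => ->.
by rewrite subr0 invr1.
Qed.

Lemma key_block_prob j k (l : nat) : (l < 2 ^ k)%N ->
  P (X j @^-1` [set x | block k x == l%:Z]) = ((2 ^+ k)^-1)%:E.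
Proof.
have k0 : 0 < 2 ^+ k :> R by rewrite exprn_gt0.
move=> lk; rewrite block_itv key_prob//.
  rewrite lebesgue_measure_itv/= lte_fin ltr_pM2r ?invr_gt0// ltr_nat ltnSn.
  by rewrite -EFinB -mulrBl -natr1 addrAC subrr add0r mul1r.
move=> x /=; rewrite !in_itv/= => /andP[lx xl]; apply/andP; split.
  by apply: le_trans lx; rewrite divr_ge0// ltW.
apply: (le_trans (ltW xl)); rewrite ler_pdivrMr// mul1r -natrX ler_nat.
exact: lk.
Qed.

Lemma key_unit_prob j : P (X j @^-1` `]0, 1[) = 1%E.
Proof.
rewrite key_prob//; last by move=> x /=; rewrite !in_itv /= => /andP[/ltW -> /ltW ->].
by rewrite lebesgue_measure_itv/= lte_fin ltr01 -EFinB subr0.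
Qed.

Lemma measurable_tie i j : measurable [set w | (0 < X i w < 1)%R /\ X i w = X j w].
Proof.
have mX m : measurable_fun setT (X m) by exact: measurable_funP.
rewrite (_ : [set w | _] = (X i @^-1` `]0,1[) `&` [set w | X i w == X j w]).
  apply: measurableI; first by rewrite -[_ @^-1` _]setTI; apply: mX.
  by rewrite -[X in measurable X]setTI; exact: (measurable_fun_eqr (mX i) (mX j) measurableT (Y := [set true])).
by apply/seteqP; split => w /=; rewrite in_itv /= => -[-> /eqP].
Qed.

(** Equal keys share one of 2^k blocks, each with probability 4^-k by independence. The restriction
    to the unit interval ensures that one of these blocks contains them; letting k grow makes ties
    null. *)
Lemma key_tie_le i j k : i != j ->
  (P [set w | (0 < X i w < 1)%R /\ X i w = X j w] <= ((2 ^+ k)^-1)%:E)%E.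
Proof.
move=> ij; pose E l m : set R := if (m == i) || (m == j) then [set x | block k x == l%:Z] else setT.
have mB l : measurable [set x : R | block k x == l%:Z].
  by rewrite block_itv; exact: measurable_itv.
have mE l m : measurable (E l m) by rewrite /E; case: ifP.
have PE (l : 'I_(2 ^ k)) : P (key_cyl X N setT (E l)) = ((2 ^+ k)^-1 * (2 ^+ k)^-1)%:E.
  rewrite (@key_cyl_prob _ _ _ _ _ _ _ (model_independent model) _ _ (i + j).+1 (mE l)); last first.
    by move=> m mij; rewrite /E; case: eqP => [|_]; [lia|case: eqP => // ; lia].
  rewrite preimage_setT probability_setT mul1e.
  have hi : (i < (i + j).+1)%N by lia.
  have hj : (j < (i + j).+1)%N by lia.
  rewrite (bigD1 (Ordinal hi))//= (bigD1 (Ordinal hj))/=; last by rewrite -val_eqE /= eq_sym.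
  rewrite big1 ?mule1.
    by rewrite /E !eqxx/= orbT !key_block_prob// ltn_ord.
  move=> m /andP[mi mj]; rewrite /E.
  have -> : (val m == i) || (val m == j) = false.
    by apply/negbTE; rewrite negb_or; apply/andP; split.
  by rewrite preimage_setT probability_setT.
have sub : [set w | 0 < X i w < 1 /\ X i w = X j w] `<=`
    \big[setU/set0]_(l < 2 ^ k) key_cyl X N setT (E l).
  move=> w /= [/andP[x0 x1] e].
  have xi01 : 0 <= X i w < 1 by rewrite ltW.
  have [l El] := block_lt k xi01.
  rewrite -bigcup_seq; exists l => /=; first by rewrite mem_index_enum.
  split => // m; rewrite /E; case: ifP => // /orP[]/eqP -> /=; first by rewrite El.
  by rewrite -e El.
have mX m : measurable_fun setT (X m) by exact: measurable_funP.
apply: (@le_trans _ _ (P (\big[setU/set0]_(l < 2 ^ k) key_cyl X N setT (E l)))).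
  apply: le_measure => //; rewrite inE.
    exact: measurable_tie.
  by apply: bigsetU_measurable => l _; exact: measurable_key_cyl.
pose A l := key_cyl X N setT (E l).
have := @Boole_inequality _ _ _ P A (2 ^ k) (fun l _ => measurable_key_cyl X N setT (mE l)).
move=> /le_trans; apply; rewrite (eq_bigr _ (fun l _ => PE l)).
rewrite sumEFin sumr_const card_ord lee_fin -(mulr_natl ((2 ^+ k)^-1 * _)) mulrA natrX mulfV ?mul1r//.
Qed.

Lemma key_tie0 i j : i != j -> P [set w | (0 < X i w < 1)%R /\ X i w = X j w] = 0%E.
Proof.
move=> ij; apply/eqP; rewrite eq_le measure_ge0 andbT.
apply/lee_addgt0Pr => e e0; rewrite add0e; set k := Num.bound e^-1.
apply: (le_trans (key_tie_le k ij)); rewrite lee_fin -[leRHS]invrK lef_pV2 ?posrE ?exprn_gt0 ?invr_gt0//.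
have := archi_boundP (x := e^-1); rewrite invr_ge0 => /(_ (ltW e0)) /ltW ek.
by apply: (le_trans ek); rewrite -natrX ler_nat ltnW// ltn_expl.
Qed.

Lemma negligible_bigcup_count (I : countType) (F : I -> set T) :
  (forall i, P.-negligible (F i)) -> P.-negligible (\bigcup_i F i).
Proof.
move=> hF; pose G n := oapp F set0 (choice.unpickle n).
have : P.-negligible (\bigcup_n G n).
  apply: negligible_bigcup => n; rewrite /G; case: (choice.unpickle n) => //=; exact: negligible_set0.
apply: negligibleS => w [i _ Fi]; exists (choice.pickle i) => //.
by rewrite /G choice.pickleK.
Qed.

Definition bad_keys : set T :=
  [set w | ~ ((forall j, (0 < X j w < 1)%R) /\ forall i j, i != j -> X i w != X j w)].

Definition bad_pivots : set T := [set w | ~ forall v n, (0 < n)%N -> (J v n w < n)%N].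

Lemma bad_keys_negligible : P.-negligible bad_keys.
Proof.
have : P.-negligible (\bigcup_j (X j @^-1` (~` `]0, 1[%classic)) `|`
   \bigcup_(ij : nat * nat) [set w | ij.1 != ij.2 /\ (0 < X ij.1 w < 1)%R /\ X ij.1 w = X ij.2 w]).
  apply: negligibleU; apply: negligible_bigcup_count.
    move=> j; have mXj : measurable (X j @^-1` `]0, 1[%classic).
      by rewrite -[_ @^-1` _]setTI; apply: measurable_funP.
    apply/negligibleP; first by rewrite preimage_setC; exact: measurableC.
    have h := probability_setC P mXj; rewrite preimage_setC [LHS]h.
    by rewrite key_unit_prob subee.
  move=> [i j] /=; have [->|ij] := eqVneq i j.
    by rewrite (_ : [set w | _] = set0); [exact: negligible_set0|apply/seteqP; split => w // -[]].
  rewrite (_ : [set w | _] = [set w | (0 < X i w < 1)%R /\ X i w = X j w]).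
    by apply/negligibleP; [exact: measurable_tie|exact: key_tie0].
  by apply/seteqP; split => w // -[].
apply: negligibleS => w /= /not_andP[/existsNP[j hj]|/existsNP[i /existsNP[j /not_implyP[ij /negP e]]]].
  by left; exists j => //=; rewrite in_itv.
have [hi|hi] := pselect (0 < X i w < 1)%R; last by left; exists i => //=; rewrite in_itv.
by right; exists (i, j) => //=; split => //; split => //; apply/eqP/negPn.
Qed.

Lemma bad_pivots_negligible : P.-negligible bad_pivots.
Proof.
have : P.-negligible (\bigcup_(x : seq bool * nat) [set w | (0 < x.2)%N /\ (x.2 <= J x.1 x.2 w)%N]).
  apply: negligible_bigcup_count => -[v [|n]] /=.
    by rewrite (_ : [set w | _] = set0); [exact: negligible_set0|apply/seteqP; split => w // -[]].
  have mJ := @dmeas_RV _ _ _ _ (J v n.+1).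
  have mB : measurable (J v n.+1 @^-1` [set i | (i < n.+1)%N]) by exact: (dmeas_set _ mJ).
  have e : [set w | (0 < n.+1)%N /\ (n.+1 <= J v n.+1 w)%N] = ~` (J v n.+1 @^-1` [set i | (i < n.+1)%N]).
    by apply/seteqP; split => w /=; [move=> [_ h]; apply/negP; rewrite -leqNgt|move/negP; rewrite -leqNgt].
  rewrite e; apply/negligibleP; first exact: measurableC.
  have h := probability_setC P mB; apply: etrans h _.
  have -> : J v n.+1 @^-1` [set i | (i < n.+1)%N] =
      \big[setU/set0]_(i < n.+1) (J v n.+1 @^-1` [set (i : nat)]).
    rewrite -bigcup_seq; apply/seteqP; split => w /=.
      by move=> h; exists (Ordinal h) => //=; rewrite mem_index_enum.
    by move=> [i _ /= ->].
  rewrite measure_bigsetU_ord//; last first.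
    by apply/trivIsetP => i j _ _ ij; apply/seteqP; split => w //= [] -> /val_inj e'; rewrite e' eqxx in ij.
  rewrite (eq_bigr (fun=> (n.+1%:R^-1)%:E)); last first.
    by move=> i _; have := pivots_uniform model v (ltn_ord i).
  by rewrite sumEFin sumr_const card_ord -(mulr_natr n.+1%:R^-1) mulVf ?pnatr_eq0// subee.
apply: negligibleS => w /= /existsNP[v /existsNP[n /not_implyP[n0 /negP]]].
by rewrite -leqNgt => h; exists (v, n).
Qed.

End model.

(** * The expected number of bit comparisons *)

Section convex_counts.
Context {R : realType} {d : measure_display} {T : measurableType d}
  (P : probability T R) (lambda : R) (X : nat -> {RV P >-> R}) (N : {RV P >-> nat})
  (J : seq bool -> nat -> {RV P >-> nat}).
Hypothesis model : poisson_quicksort lambda X N J.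
Variables (A : pred R) (p : R).
Hypothesis A_convex : forall x y z, A x -> A z -> x < y -> y < z -> A y.
Hypothesis mA : measurable [set x | A x].
Hypothesis A_prob : forall j, P (X j @^-1` [set x | A x]) = p%:E.

Notation key := (key X).

Definition pairs_in (w : T) : nat :=
  pair_count (fun j => A (key w j))
    (qs (fun i j => key w i < key w j) (fun v n => J v n w) (N w) [::] (iota 1 (N w))).

Definition keys_in (w : T) : nat := count (fun j => A (key w j)) (iota 1 (N w)).

Lemma measurable_RV_key j : measurable_fun setT (key^~ j).
Proof. by case: j => [|j] //=; exact: measurable_funP. Qed.

Lemma dmeas_lt {d'} {T' : measurableType d'} (f g : T' -> R) :
  measurable_fun setT f -> measurable_fun setT g -> dmeas (fun w => f w < g w).
Proof.
move=> mf mg; apply: dmeas_bool; rewrite -[X in measurable X]setTI.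
exact: (measurable_fun_ltr mf mg measurableT (Y := [set true])).
Qed.

Lemma dmeas_in {d'} {T' : measurableType d'} (f : T' -> R) :
  measurable_fun setT f -> dmeas (fun w => A (f w)).
Proof.
move=> mf; apply: dmeas_bool; rewrite -[X in measurable X]setTI.
exact: (mf measurableT _ mA).
Qed.

Lemma dmeas_count (a : T -> pred nat) (s : seq nat) : (forall j, dmeas (a^~ j)) ->
  dmeas (fun w => count (a w) s).
Proof.
move=> ma; elim: s => [|j s IH] /=; first exact: dmeas_cst.
by apply: (dmeas_comp2 (fun (b : bool) n => b + n)%N).
Qed.

Lemma dmeas_pair_count (a : T -> pred nat) (s : seq (nat * nat)) : (forall j, dmeas (a^~ j)) ->
  dmeas (fun w => pair_count (a w) s).
Proof.
move=> ma; elim: s => [|c s IH]; first exact: dmeas_cst.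
apply: (dmeas_comp2 (fun (b : bool) n => b + n)%N) => //.
exact: (dmeas_comp2 andb).
Qed.

Lemma dmeas_compared : dmeas (fun w => qs (fun i j => key w i < key w j)
  (fun v n => J v n w) (N w) [::] (iota 1 (N w))).
Proof.
apply: (dmeas_bind (F := fun n w => qs (fun i j => key w i < key w j)
   (fun v n => J v n w) n [::] (iota 1 n))); first exact: dmeas_RV.
move=> n; apply: (dmeas_qs (lt := fun w i j => key w i < key w j)).
  by move=> i j; apply: dmeas_lt; exact: measurable_RV_key.
by move=> v m; exact: dmeas_RV.
Qed.

Lemma dmeas_pairs_in : dmeas pairs_in.
Proof.
apply: (dmeas_bind (F := fun l w => pair_count (fun j => A (key w j)) l)).
  exact: dmeas_compared.
by move=> l; apply: dmeas_pair_count => j; exact: dmeas_in (measurable_RV_key j).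
Qed.

Lemma dmeas_keys_in : dmeas keys_in.
Proof.
apply: (dmeas_bind (F := fun n w => count (fun j => A (key w j)) (iota 1 n))).
  exact: dmeas_RV.
by move=> n; apply: dmeas_count => j; exact: dmeas_in (measurable_RV_key j).
Qed.

(** All that matters of n keys for the comparisons within A, as an element of a finite type. Index 0
    is included for the default pivot. *)
Let conf n w : {ffun 'I_n.+1 * 'I_n.+1 -> bool} * {ffun 'I_n.+1 -> bool} :=
  ([ffun ij => key w (ij.1 : 'I_n.+1) < key w (ij.2 : 'I_n.+1)], [ffun i => A (key w (i : 'I_n.+1))]).

Let dmeas_conf n : dmeas (conf n : g_sigma_algebraType (key_cylinders X N) -> _).
Proof.
have mk j := @measurable_key _ _ _ P X N j.
apply: dmeas_comp2.
  by apply: dmeas_ffun => ij; exact: dmeas_lt (mk _) (mk _).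
by apply: dmeas_ffun => i; exact: dmeas_in (mk _).
Qed.

Let confE n w w' : conf n w = conf n w' ->
  (forall i j, (i <= n)%N -> (j <= n)%N -> (key w i < key w j) = (key w' i < key w' j)) /\
  (forall j, (j <= n)%N -> A (key w j) = A (key w' j)).
Proof.
move=> [] /ffunP h1 /ffunP h2; split.
  move=> i j ilt jlt.
  have i1 : (i < n.+1)%N by []. have j1 : (j < n.+1)%N by [].
  by have := h1 (Ordinal i1, Ordinal j1); rewrite !ffunE.
move=> j jlt; have j1 : (j < n.+1)%N by [].
by have := h2 (Ordinal j1); rewrite !ffunE.
Qed.

(** The event N = n is split by the configuration. A piece either lies among the bad keys and is
    null, or has a representative with distinct keys, to which the average over the pivots and
    [qe_qcmp] apply. *)
Lemma integral_pairs_in_size n :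
  (\int[P]_(w in N @^-1` [set n]) (pairs_in w)%:R%:E =
   \int[P]_(w in N @^-1` [set n]) (qcmp (keys_in w))%:E)%E.
Proof.
have sN : <<s key_cylinders X N >> (N @^-1` [set n]) by exact: dmeas_size.
have sc c : <<s key_cylinders X N >> (conf n @^-1` [set c]) by exact: dmeas_conf.
have s_meas C : <<s key_cylinders X N >> C -> measurable C.
  by move=> sC; have [] := sigma_keys_indep (model_independent model) sC.
have mN : measurable (N @^-1` [set n]) by exact: s_meas.
have mc : dmeas (conf n) by move=> c; exact: s_meas.
have mD D := @dmeas_measurable _ _ R _ D dmeas_pairs_in.
have mQ D := @dmeas_measurable_fun _ _ R _ _ (@qcmp R) D dmeas_keys_in.
rewrite (integral_split_fin P mc mN (mD _))//.
rewrite (integral_split_fin P mc mN (mQ _)); last by move=> w; rewrite lee_fin qcmp_ge0.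
apply: eq_bigr => c _; set C := _ `&` _.
have mC : measurable C by apply: measurableI => //; exact: mc.
(* On [C] the relative order of the keys and their membership in [A] are
   constant, so the keys may be replaced by those of any [w0] in [C]. *)
have [CB|/existsNP[w0 /not_implyP[[/= N0 c0] /contrapT[_ k0]]]] := pselect (C `<=` bad_keys X).
  have PC : P C = 0%E.
    by apply/negligibleP => //; apply: negligibleS CB (bad_keys_negligible model).
  by rewrite !null_set_integral.
have sC : <<s key_cylinders X N >> C.
  exact: (@measurableI _ (g_sigma_algebraType (key_cylinders X N)) _ _ sN (sc c)).
have iC := sigma_keys_indep (model_independent model) sC.
have le_n : {in iota 1 n, forall j, (j <= n)%N}.
  by move=> j; rewrite mem_iota add1n ltnS => /andP[].
have E w : C w -> (pairs_in w)%:R%:E = (pair_count (fun j => A (key w0 j))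
     (qs (fun i j => key w0 i < key w0 j) (fun v n => J v n w) n [::] (iota 1 n)))%:R%:E :> \bar R.
  move=> [/= Nw cw]; have [h1 h2] := @confE n w w0 (etrans cw (esym c0)).
  rewrite /pairs_in Nw (qs_ext _ _ _ h1 le_n); congr (_%:R%:E).
  apply: eq_in_count => x xl.
  by have /andP[x1 x2] := qs_le le_n xl; rewrite !h2.
have E' w : C w -> (qcmp (keys_in w))%:E = (qcmp (count (fun j => A (key w0 j)) (iota 1 n)))%:E :> \bar R.
  move=> [/= Nw cw]; have [h1 h2] := @confE n w w0 (etrans cw (esym c0)).
  rewrite /keys_in Nw; congr (qcmp _)%:E.
  by apply: eq_in_count => j /le_n jn; rewrite h2.
rewrite (eq_integral _ _ (fun w wC => E w (set_mem wC))).
rewrite (eq_integral _ _ (fun w wC => E' w (set_mem wC))).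
have mJ v m : dmeas (J v m : T -> nat) by exact: dmeas_RV.
have uJ v m i : (i < m)%N -> P (J v m @^-1` [set i]) = (m%:R^-1)%:E.
  by move=> im; have := pivots_uniform model v im.
rewrite (integral_pair_count mJ uJ _ _ _ _ iC).
rewrite qe_qcmp ?iota_uniq ?size_iota//; last first.
  move=> [|i] [|j]; rewrite !mem_iota //= => _ _ e.
  congr _.+1; apply/eqP/negPn/negP => ij; have /eqP := k0 i j ij; exact.
by rewrite integral_cst// -[X in (_ * X)%E](@fineK _ (P C)) ?fin_num_measure// -EFinM mulrC.
Qed.

Lemma sum_draws n (F : nat -> R) :
  \sum_(S : {set 'I_n}) F #|S| = \sum_(m < n.+1) 'C(n, m)%:R * F m.
Proof.
have cS (S : {set 'I_n}) : (#|S| < n.+1)%N by rewrite ltnS -[leqRHS](card_ord n) max_card.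
rewrite (partition_big (fun S : {set 'I_n} => Ordinal (cS S)) xpredT)//=.
apply: eq_bigr => m _.
rewrite (eq_bigl (fun S : {set 'I_n} => S \in [set S : {set 'I_n} | #|S| == m]%SET)); last first.
  by move=> S; rewrite inE -val_eqE.
rewrite (eq_bigr (fun=> F m)); last by move=> S; rewrite inE => /eqP ->.
by rewrite sumr_const card_draws card_ord mulr_natl.
Qed.

(** Splitting by the set S of indices whose key lies in A, each S has probability p^|S| (1 - p)^(n -
    |S|) by independence: the binomial law. *)
Lemma integral_keys_in_size n :
  (\int[P]_(w in N @^-1` [set n]) (qcmp (keys_in w))%:E =
   (poisson_pmf lambda n *
     \sum_(m < n.+1) 'C(n, m)%:R * p ^+ m * (1 - p) ^+ (n - m) * qcmp m)%:E)%E.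
Proof.
have mX j : measurable_fun setT (X j) by exact: measurable_funP.
pose c w := [set i : 'I_n | [ffun i : 'I_n => A (X i w)] i]%SET.
have mc : dmeas c.
  apply: (dmeas_comp (fun f : {ffun 'I_n -> bool} => [set i | f i]%SET)).
  by apply: dmeas_ffun => i; exact: dmeas_in.
have mN : measurable (N @^-1` [set n]) by exact: (@dmeas_RV _ _ _ _ N).
have mQ D := @dmeas_measurable_fun _ _ R _ _ (@qcmp R) D dmeas_keys_in.
rewrite (integral_split_fin P mc mN (mQ _)); last by move=> w; rewrite lee_fin qcmp_ge0.
pose E (S : {set 'I_n}) (j : nat) : set R :=
  oapp (fun i : 'I_n => if i \in S then [set x | A x] else ~` [set x | A x]) setT (insub j).
have mE S j : measurable (E S j).
  by rewrite /E; case: insubP => //= i _ _; case: ifP => // _; exact: measurableC.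
have EC S : N @^-1` [set n] `&` c @^-1` [set S] = key_cyl X N [set n] (E S).
  apply/seteqP; split => w [/= Nw].
    move=> cS; split => // j; rewrite /E; case: insubP => //= i _ <-.
    by rewrite -cS inE ffunE; case: ifP => // /negP.
  move=> h; split => //; apply/setP => i; rewrite inE ffunE.
  have := h i; rewrite /E valK /=; case: ifP => // _ /negP/negbTE; exact.
have cE w : N w = n -> keys_in w = #|c w|.
  move=> Nw; rewrite /keys_in Nw -[1%N]/(1 + 0)%N iotaDl count_map -val_enum_ord count_map.
  have -> : #|c w| = #|[pred i : 'I_n | A (X i w)]|.
    by apply: eq_card => i; rewrite !inE ffunE.
  by rewrite cardE /enum_mem size_filter -enumT (eq_filter (a2 := predT))// filter_predT.
have PC S : P (key_cyl X N [set n] (E S)) =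
    (poisson_pmf lambda n * (p ^+ #|S| * (1 - p) ^+ (n - #|S|)))%:E.
  rewrite (@key_cyl_prob _ _ _ _ _ _ _ (model_independent model) _ _ n (mE S)); last first.
    by move=> j nj; rewrite /E; case: insubP => //= i; rewrite ltnNge nj.
  have -> : P (N @^-1` [set n]) = (poisson_pmf lambda n)%:E by exact: size_poisson model n.
  rewrite EFinM; congr (_ * _)%E.
  rewrite (eq_bigr (fun i => (if i \in S then p else 1 - p)%:E)); last first.
    move=> i _; rewrite /E valK /=; case: ifP => // _.
    have mXA : measurable (X i @^-1` [set x | A x]) by rewrite -[_ @^-1` _]setTI; exact: mX.
    have h := probability_setC P mXA; rewrite preimage_setC; apply: etrans h _.
    by rewrite A_prob.
  rewrite prodEFin; congr EFin.
  rewrite (bigID (mem S))/=; congr (_ * _).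
    rewrite (eq_bigr (fun=> p)); last by move=> i ->.
    by rewrite prodr_const.
  rewrite (eq_bigr (fun=> 1 - p)); last by move=> i /negbTE ->.
  rewrite prodr_const; congr (_ ^+ _).
  have e := cardC (mem S); rewrite card_ord in e.
  transitivity #|[predC S]|; first exact: eq_card.
  by apply/esym/eqP; rewrite -(eqn_add2l #|S|) subnKC ?e// -[leqRHS]e leq_addr.
rewrite (eq_bigr (fun S : {set 'I_n} => (poisson_pmf lambda n *
    ((p ^+ #|S| * (1 - p) ^+ (n - #|S|)) * qcmp #|S|))%:E)); last first.
  move=> S _; rewrite (eq_integral (fun=> (qcmp #|S|)%:E)); last first.
    by move=> w; rewrite inE => -[/= Nw <-]; rewrite cE.
  rewrite integral_cst; last by apply: measurableI => //; exact: mc.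
  transitivity ((qcmp #|S|)%:E * (poisson_pmf lambda n * (p ^+ #|S| * (1 - p) ^+ (n - #|S|)))%:E)%E.
    by rewrite EC; congr (_ * _)%E; exact: PC.
  by rewrite -EFinM; congr EFin; ring.
rewrite sumEFin -mulr_sumr.
rewrite (sum_draws n (fun m => p ^+ m * (1 - p) ^+ (n - m) * qcmp m)).
by congr (_ * _)%:E; apply: eq_bigr => m _; rewrite !mulrA.
Qed.

Lemma integral_pairs_in : 0 < lambda -> 0 < p <= 1 ->
  (\int[P]_w (pairs_in w)%:R%:E =
   \sum_(m <oo) (poisson_pmf (lambda * p) m * qcmp m)%:E)%E.
Proof.
move=> l0 p01.
have NT : setT = \bigcup_n (N @^-1` [set n]).
  by apply/seteqP; split => // w _; exists (N w).
rewrite [X in (\int[_]_(_ in X) _)%E]NT ge0_integral_bigcup//; last 3 first.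
- by move=> n; exact: (@dmeas_RV _ _ _ _ N).
- exact: dmeas_measurable dmeas_pairs_in.
- by move=> i j _ _ [w [/= <- <-]].
rewrite -(poisson_thinning l0 p01 (@qcmp_ge0 R)).
by apply: eq_eseriesr => n _; rewrite integral_pairs_in_size integral_keys_in_size.
Qed.

End convex_counts.

(** * Summation over the dyadic intervals *)

Section bits_expectation.
Context {R : realType} {d : measure_display} {T : measurableType d}
  (P : probability T R) (lambda : R) (X : nat -> {RV P >-> R}) (N : {RV P >-> nat})
  (J : seq bool -> nat -> {RV P >-> nat}).
Hypothesis model : poisson_quicksort lambda X N J.

Notation key := (key X).
Notation B := (quicksort_bits (fun j => X j : T -> R) N (fun v n => J v n : T -> nat)).
Notation in_block k l := (fun x : R => block k x == (l : nat)%:Z).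

Lemma integral_block_pairs k (l : 'I_(2 ^ k)) : 0 < lambda ->
  (\int[P]_w (pairs_in X N J (in_block k l) w)%:R%:E =
   \sum_(m <oo) (poisson_pmf (lambda / 2 ^+ k) m * qcmp m)%:E)%E.
Proof.
move=> l0; apply: (integral_pairs_in model) => //.
- by move=> x y z; exact: block_convex.
- by rewrite block_itv; exact: measurable_itv.
- by move=> j; exact: (key_block_prob model).
- by rewrite invr_gt0 exprn_gt0//= invf_le1 ?exprn_gt0// exprn_ege1// ler1n.
Qed.

Lemma quicksort_bits_qs w : B w =
  (\sum_(c <- qs (fun i j => (key w i < key w j)%R) (fun v n => J v n w) (N w) [::] (iota 1 (N w)))
     first_diff_bit (key w c.1) (key w c.2))%N.
Proof.
rewrite /quicksort_bits /bit_comparisons /comparisons size_mkseq.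
have -> : mkseq (fun j => X j w) (N w) = [seq key w j | j <- iota 1 (N w)].
  by rewrite /mkseq -[1%N]/(1 + 0)%N iotaDl -map_comp.
by rewrite comparisons_rec_qs// big_map.
Qed.

Lemma dmeas_quicksort_bits : dmeas B.
Proof.
have -> : B = fun w => (\sum_(c <- qs (fun i j => (key w i < key w j)%R) (fun v n => J v n w) (N w) [::] (iota 1 (N w)))
     first_diff_bit (key w c.1) (key w c.2))%N.
  by apply/funext => w; exact: quicksort_bits_qs.
apply: (dmeas_bind (F := fun l w => (\sum_(c <- l) first_diff_bit (key w c.1) (key w c.2))%N)).
  exact: dmeas_compared.
move=> l; apply: (dmeas_sum l (F := fun c w => first_diff_bit (key w c.1) (key w c.2))) => c.
by apply: dmeas_first_diff_bit; exact: measurable_RV_key.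
Qed.

Lemma quicksort_bits_series w : ~ bad_keys X w -> ~ bad_pivots J w ->
  ((B w)%:R%:E = \sum_(k <oo) (\sum_(i < 2 ^ k) pairs_in X N J (in_block k i) w)%N%:R%:E :> \bar R)%E.
Proof.
move=> /contrapT[k01 kinj] /contrapT vJ; rewrite quicksort_bits_qs.
apply: bits_series => -[[|i] [|j]] /(qs_mem vJ (iota_uniq _ _))[] //=;
  rewrite !mem_iota //= => _ _ ij.
by split => //; apply: kinj.
Qed.

(** The levelwise decomposition of B holds off a null event, which is enough under the integral; the
    2^k blocks of level k have equal means. *)
Lemma expectation_bits_series : 0 < lambda ->
  (\int[P]_w (B w)%:R%:E = \sum_(k <oo) ((2 ^+ k)%:E *
     \sum_(m <oo) (poisson_pmf (lambda / 2 ^+ k) m * qcmp m)%:E))%E.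
Proof.
move=> l0.
have mp k (i : 'I_(2 ^ k)) : dmeas (pairs_in X N J (in_block k i)).
  by apply: dmeas_pairs_in; rewrite block_itv; exact: measurable_itv.
have mS k : measurable_fun setT (fun w =>
    (\sum_(i < 2 ^ k) pairs_in X N J (in_block k i) w)%N%:R%:E : \bar R).
  exact: dmeas_measurable (dmeas_sum _ _).
transitivity (\int[P]_w (\sum_(k <oo) (\sum_(i < 2 ^ k) pairs_in X N J (in_block k i) w)%N%:R%:E))%E.
  apply: ge0_ae_eq_integral => //.
  - exact: dmeas_measurable dmeas_quicksort_bits.
  - by apply: ge0_emeasurable_sum => // k w _ _.
  - by move=> w _; apply: nneseries_ge0.
  - have := negligibleU (bad_keys_negligible model) (bad_pivots_negligible model).
    apply: negligibleS => w /= h; apply: contrapT => /not_orP[h1 h2]; apply: h => _.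
    exact: quicksort_bits_series.
rewrite integral_nneseries//; apply: eq_eseriesr => k _.
rewrite (eq_integral (fun w => \sum_(i < 2 ^ k) (pairs_in X N J (in_block k i) w)%:R%:E)%E); last first.
  by move=> w _; rewrite natr_sum sumEFin.
rewrite ge0_integral_sum//; last by move=> i; exact: dmeas_measurable.
rewrite (eq_bigr _ (fun i _ => integral_block_pairs i l0)).
by rewrite sumr_const card_ord -natrX mule_natl.
Qed.

End bits_expectation.

Local Open Scope complex_scope.

Theorem proposition5p4 (R : realType) :
  (forall lambda : R, 0 < lambda ->
     has_sum [set k : int | k != 0] (pi_term lambda) (pi_ lambda)) /\
  (exists K : R, \forall lambda \near +oo%R,
     forall (d : measure_display) (T : measurableType d) (P : probability T R)
       (X : nat -> {RV P >-> R}) (N : {RV P >-> nat})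
       (J : seq bool -> nat -> {RV P >-> nat}),
     poisson_quicksort lambda X N J ->
     let B : T -> nat :=
       quicksort_bits (fun j => X j : T -> R) N (fun v n => J v n : T -> nat) in
     let EB : \bar R := ('E_P[fun w => (B w)%:R])%E in
     EB \is a fin_num /\
     `|(fine EB)%:C - main_terms lambda| <= (K * ln lambda)%:C).
Proof.
split; first by move=> l /eint_pfrac[_ /pi_has_sum[]].
have [K hK] := @eint_tVq R; exists K.
(* The threshold e makes ln l >= 1, as the error bound requires. *)
exists (expR 1); split; first exact: num_real.
move=> l /ltW el d T P X N J model /=; set EB := ('E_P[_])%E.
have l0 : 0 < l by apply: lt_le_trans el; exact: expR_gt0.
have [iV hV] := hK l el; have [_ cs] := eint_pfrac l0.
have [_ pi_l] := pi_has_sum cs.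
have EBE : EB = (eint (fun t => t * Vq (l / t)))%:E.
  rewrite /EB unlock (expectation_bits_series model l0) (poisson_qcmp_series l0).
  rewrite /eint /Rintegral fineK//.
  exact: integrable_fin_num iV.
split; first by rewrite EBE.
(* The sum [pi_] is real, so the complex modulus reduces to a real absolute value. *)
rewrite EBE /main_terms pi_l -rmorphM -!(rmorphB, rmorphD)/= normcE lecR.
have := hV _ cs; set s := _ - pmean => h.
rewrite [X in Normc.normc X](_ : _ = (eint (fun t => t * Vq (l / t)) -
    (l * ln l * lg l - c1 R * l * ln l + c2 R * l + s * l)) +i* 0).
  by apply: le_trans (le_normc_ReIm _ _) _; rewrite normr0 addr0.
done.
Qed.
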